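(* Each surface in $\mathbb R^4$ free of minimal points locally admits canonical principal parameters.
   Context: Functions are smooth; subscripts $u,v$ denote partial derivatives. $\mathbb R^4$ carries the standard Euclidean metric and orientation. Surfaces and principal parameters. For a local parametrization $z=z(u,v)$ of a 2-dimensional surface in $\mathbb R^4$, $E,F,G$ are the coefficients of the first fundamental form and $\sigma$ is the second fundamental tensor. With $\{n_1,n_2\}$ an orthonormal frame of the normal bundle and $c_{11}^k,c_{12}^k,c_{22}^k$ the $n_k$-components of $z_{uu},z_{uv},z_{vv}$, put $L=\frac{2}{\sqrt{EG-F^2}}(c_{11}^1c_{12}^2-c_{11}^2c_{12}^1)$, $M=\frac{1}{\sqrt{EG-F^2}}(c_{11}^1c_{22}^2-c_{11}^2c_{22}^1)$, $N=\frac{2}{\sqrt{EG-F^2}}(c_{12}^1c_{22}^2-c_{12}^2c_{22}^1)$, and $k=\frac{LN-M^2}{EG-F^2}$, $\varkappa=\frac{EN-2FM+GL}{2(EG-F^2)}$. The surface is free of minimal points if $\varkappa^2-k>0$ at every point; then its mean curvature vector field $H$ does not vanish. The parameters $(u,v)$ are principal if $F=M=0$. Geometric functions. For a surface free of minimal points in principal parameters, let $x=z_u/\sqrt E$, $y=z_v/\sqrt G$, $b=H/\|H\|$, and let $l$ be the unit normal field such that $\{x,y,b,l\}$ is a positively oriented orthonormal frame field. Then $\sigma(x,x)=\nu_1 b$, $\sigma(x,y)=\lambda b+\mu l$, $\sigma(y,y)=\nu_2 b$ for smooth functions $\nu_1,\nu_2,\lambda,\mu$, with $\mu\ne0$. The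 functions $f_i$. Put $$\Theta=4(\lambda^2+\mu^2)^2+(\lambda^2-2\mu^2-\nu_1\nu_2)(\nu_1-\nu_2)^2-4\lambda^2\nu_1\nu_2$$ and $$f_1=-\tfrac1\Theta\Big[\tfrac12\big((\lambda^2+\mu^2)^2\big)_v-(\lambda^2)_v\nu_1\nu_2+2\mu^2\nu_2(\nu_1)_v+\big(\lambda^2(\nu_1)_v-\tfrac12(\mu^2)_v\nu_1-\tfrac12(\nu_1^2)_v\nu_2\big)(\nu_1-\nu_2)\Big],$$ $$f_2=\tfrac1\Theta\Big[\lambda_u(\lambda^2-\nu_1\nu_2)(\nu_1-\nu_2)+2\lambda_u\mu^2\nu_2+2\lambda^3(\nu_2)_u+\tfrac12\lambda(\mu^2)_u(\nu_1-3\nu_2)+2\lambda\mu^2(\nu_2)_u-\lambda\nu_1(\nu_2^2)_u\Big],$$ $$f_3=\tfrac1\Theta\Big[\lambda_v(\lambda^2-\nu_1\nu_2)(\nu_2-\nu_1)+2\lambda_v\mu^2\nu_1+2\lambda^3(\nu_1)_v+\tfrac12\lambda(\mu^2)_v(\nu_2-3\nu_1)+2\lambda\mu^2(\nu_1)_v-\lambda(\nu_1^2)_v\nu_2\Big],$$ $$f_4=-\tfrac1\Theta\Big[\tfrac12\big((\lambda^2+\mu^2)^2\big)_u-(\lambda^2)_u\nu_1\nu_2+2\mu^2\nu_1(\nu_2)_u+\big(\lambda^2(\nu_2)_u-\tfrac12(\mu^2)_u\nu_2-\tfrac12\nu_1(\nu_2^2)_u\big)(\nu_2-\nu_1)\Big].$$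 Canonical principal parameters. For a surface free of minimal points in principal parameters $(u,v)$, an arbitrary point $(u_0,v_0)$ and any constants $c_1,c_2$, there exist functions $\varphi(u)$ and $\psi(v)$ such that $$\sqrt{E(u,v)}\,\exp\Big(-\int_{v_0}^v\big(f_1+f_2\tfrac{\sqrt G}{\sqrt E}\big)(u,t)\,dt-\int_{u_0}^u\big(f_3\tfrac{\sqrt E}{\sqrt G}+f_4\big)(s,v_0)\,ds+c_1\Big)=\varphi(u),$$ $$\sqrt{G(u,v)}\,\exp\Big(-\int_{u_0}^u\big(f_3\tfrac{\sqrt E}{\sqrt G}+f_4\big)(s,v)\,ds-\int_{v_0}^v\big(f_1+f_2\tfrac{\sqrt G}{\sqrt E}\big)(u_0,t)\,dt+c_2\Big)=\psi(v).$$ The principal parameters $(u,v)$ are called canonical principal parameters if these functions $\varphi(u)$ and $\psi(v)$ are equal to $1$.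
   Formalization: The formal theorem additionally assumes that Θ, the denominator of f_1,…,f_4, does not vanish on the surface; it can vanish on a surface free of minimal points (e.g. z=(u,v,u²/2,uv/√2) at the origin), where the f_i are undefined. *)

(* Defs.v *)
From mathcomp Require Import all_boot all_algebra.
From mathcomp Require Import Rstruct.
From Stdlib Require Import Reals.
From Coquelicot Require Import Coquelicot.

(* Vectors of R^4 are MathComp row vectors over Stdlib's R; all calculus is
   Coquelicot's, on scalar functions of two real variables. *)

Section Euclidean4.
Local Open Scope ring_scope.

Definition dot (a b : 'rV[R]_4) : R := \sum_(i < 4) a 0 i * b 0 i.

Definition det4 (a b c d : 'rV[R]_4) : R :=
  \det (\matrix_(i < 4) nth 0 [:: a; b; c; d] i).

(* The vector l with <l, w> = det4 a b c w for all w.  If a, b, c are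
   orthonormal, it is the unit vector that completes them to a positively
   oriented orthonormal basis. *)
Definition cross (a b c : 'rV[R]_4) : 'rV[R]_4 :=
  \row_j det4 a b c (delta_mx 0 j).

(* Component of w orthogonal to the span of x and y, for orthonormal x, y. *)
Definition normal_part (x y w : 'rV[R]_4) : 'rV[R]_4 :=
  w - dot w x *: x - dot w y *: y.

Definition normalize (w : 'rV[R]_4) : 'rV[R]_4 := (sqrt (dot w w))^-1 *: w.

Definition midpoint (v w : 'rV[R]_4) : 'rV[R]_4 := 2^-1 *: (v + w).

Definition vscale (a : R) (w : 'rV[R]_4) : 'rV[R]_4 := a *: w.

Definition vec4 (f : 'I_4 -> R) : 'rV[R]_4 := \row_i f i.

End Euclidean4.

Local Open Scope R_scope.

Definition du (f : R -> R -> R) (u v : R) : R := Derive (fun s => f s v) u.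
Definition dv (f : R -> R -> R) (u v : R) : R := Derive (fun t => f u t) v.

(* Iterated partial derivatives: true stands for d/du, false for d/dv. *)
Fixpoint partial (w : seq bool) (f : R -> R -> R) : R -> R -> R :=
  match w with
  | nil => f
  | b :: w' => if b then du (partial w' f) else dv (partial w' f)
  end.

(* C^infinity on D: all iterated partial derivatives exist and are continuous. *)
Definition smooth_on (D : R * R -> Prop) (f : R -> R -> R) : Prop :=
  forall (w : seq bool) (u v : R), D (u, v) ->
    ex_derive (fun s => partial w f s v) u /\
    ex_derive (fun t => partial w f u t) v /\
    continuity_2d_pt (partial w f) u v.

Definition comp (z : R -> R -> 'rV[R]_4) (i : 'I_4) : R -> R -> R :=
  fun u v => z u v ord0 i.

Definition Du (z : R -> R -> 'rV[R]_4) (u v : R) : 'rV[R]_4 :=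
  vec4 (fun i => du (comp z i) u v).
Definition Dv (z : R -> R -> 'rV[R]_4) (u v : R) : 'rV[R]_4 :=
  vec4 (fun i => dv (comp z i) u v).

Section Surface.
Variable z : R -> R -> 'rV[R]_4.

Definition cE (u v : R) : R := dot (Du z u v) (Du z u v).
Definition cF (u v : R) : R := dot (Du z u v) (Dv z u v).
Definition cG (u v : R) : R := dot (Dv z u v) (Dv z u v).
Definition W2 (u v : R) : R := cE u v * cG u v - cF u v ^ 2.

Definition zuu (u v : R) : 'rV[R]_4 := Du (Du z) u v.
Definition zuv (u v : R) : 'rV[R]_4 := Dv (Du z) u v.
Definition zvv (u v : R) : 'rV[R]_4 := Dv (Dv z) u v.

Definition normal_frame (u v : R) (n1 n2 : 'rV[R]_4) : Prop :=
  dot n1 n1 = 1 /\ dot n2 n2 = 1 /\ dot n1 n2 = 0 /\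
  dot n1 (Du z u v) = 0 /\ dot n1 (Dv z u v) = 0 /\
  dot n2 (Du z u v) = 0 /\ dot n2 (Dv z u v) = 0.

Definition cL (n1 n2 : 'rV[R]_4) (u v : R) : R :=
  2 / sqrt (W2 u v) *
  (dot (zuu u v) n1 * dot (zuv u v) n2 - dot (zuu u v) n2 * dot (zuv u v) n1).
Definition cM (n1 n2 : 'rV[R]_4) (u v : R) : R :=
  1 / sqrt (W2 u v) *
  (dot (zuu u v) n1 * dot (zvv u v) n2 - dot (zuu u v) n2 * dot (zvv u v) n1).
Definition cN (n1 n2 : 'rV[R]_4) (u v : R) : R :=
  2 / sqrt (W2 u v) *
  (dot (zuv u v) n1 * dot (zvv u v) n2 - dot (zuv u v) n2 * dot (zvv u v) n1).

Definition inv_k (n1 n2 : 'rV[R]_4) (u v : R) : R :=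
  (cL n1 n2 u v * cN n1 n2 u v - cM n1 n2 u v ^ 2) / W2 u v.
Definition inv_kappa (n1 n2 : 'rV[R]_4) (u v : R) : R :=
  (cE u v * cN n1 n2 u v - 2 * cF u v * cM n1 n2 u v + cG u v * cL n1 n2 u v)
  / (2 * W2 u v).

Definition surface (D : R * R -> Prop) : Prop :=
  open D /\ (forall i, smooth_on D (comp z i)) /\
  forall u v, D (u, v) -> 0 < W2 u v.

(* Another orthonormal normal frame changes L, M, N by a common sign only, so
   this condition and the vanishing of M do not depend on the frame. *)
Definition free_of_minimal_points (D : R * R -> Prop) : Prop :=
  forall u v n1 n2, D (u, v) -> normal_frame u v n1 n2 ->
    inv_kappa n1 n2 u v ^ 2 - inv_k n1 n2 u v > 0.

Definition principal (D : R * R -> Prop) : Prop :=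
  forall u v, D (u, v) ->
    cF u v = 0 /\ forall n1 n2, normal_frame u v n1 n2 -> cM n1 n2 u v = 0.

(* From here on the definitions are meaningful in principal parameters only;
   in particular x, y are orthonormal because F = 0. *)
Definition fx (u v : R) : 'rV[R]_4 := vscale (/ sqrt (cE u v)) (Du z u v).
Definition fy (u v : R) : 'rV[R]_4 := vscale (/ sqrt (cG u v)) (Dv z u v).

Definition sigma_xx (u v : R) : 'rV[R]_4 :=
  vscale (/ cE u v) (normal_part (fx u v) (fy u v) (zuu u v)).
Definition sigma_xy (u v : R) : 'rV[R]_4 :=
  vscale (/ (sqrt (cE u v) * sqrt (cG u v)))
         (normal_part (fx u v) (fy u v) (zuv u v)).
Definition sigma_yy (u v : R) : 'rV[R]_4 :=
  vscale (/ cG u v) (normal_part (fx u v) (fy u v) (zvv u v)).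

Definition mean_curvature (u v : R) : 'rV[R]_4 :=
  midpoint (sigma_xx u v) (sigma_yy u v).

Definition fb (u v : R) : 'rV[R]_4 := normalize (mean_curvature u v).
Definition fl (u v : R) : 'rV[R]_4 := cross (fx u v) (fy u v) (fb u v).

Definition nu1 (u v : R) : R := dot (sigma_xx u v) (fb u v).
Definition nu2 (u v : R) : R := dot (sigma_yy u v) (fb u v).
Definition lambda (u v : R) : R := dot (sigma_xy u v) (fb u v).
Definition mu (u v : R) : R := dot (sigma_xy u v) (fl u v).

End Surface.

Section Functions.
Variables (la mu n1 n2 : R -> R -> R) (u v : R).

Let l := la u v.
Let m := mu u v.
Let a := n1 u v.
Let b := n2 u v.

Definition ThetaF : R :=
  4 * (l ^ 2 + m ^ 2) ^ 2 + (l ^ 2 - 2 * m ^ 2 - a * b) * (a - b) ^ 2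
  - 4 * l ^ 2 * a * b.

Definition f1F : R :=
  - (1 / ThetaF) *
  ( / 2 * dv (fun u v => (la u v ^ 2 + mu u v ^ 2) ^ 2) u v
    - dv (fun u v => la u v ^ 2) u v * a * b
    + 2 * m ^ 2 * b * dv n1 u v
    + (l ^ 2 * dv n1 u v
       - / 2 * dv (fun u v => mu u v ^ 2) u v * a
       - / 2 * dv (fun u v => n1 u v ^ 2) u v * b) * (a - b)).

Definition f2F : R :=
  1 / ThetaF *
  ( du la u v * (l ^ 2 - a * b) * (a - b)
    + 2 * du la u v * m ^ 2 * b
    + 2 * l ^ 3 * du n2 u v
    + / 2 * l * du (fun u v => mu u v ^ 2) u v * (a - 3 * b)
    + 2 * l * m ^ 2 * du n2 u v
    - l * a * du (fun u v => n2 u v ^ 2) u v).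

Definition f3F : R :=
  1 / ThetaF *
  ( dv la u v * (l ^ 2 - a * b) * (b - a)
    + 2 * dv la u v * m ^ 2 * a
    + 2 * l ^ 3 * dv n1 u v
    + / 2 * l * dv (fun u v => mu u v ^ 2) u v * (b - 3 * a)
    + 2 * l * m ^ 2 * dv n1 u v
    - l * dv (fun u v => n1 u v ^ 2) u v * b).

Definition f4F : R :=
  - (1 / ThetaF) *
  ( / 2 * du (fun u v => (la u v ^ 2 + mu u v ^ 2) ^ 2) u v
    - du (fun u v => la u v ^ 2) u v * a * b
    + 2 * m ^ 2 * a * du n2 u v
    + (l ^ 2 * du n2 u v
       - / 2 * du (fun u v => mu u v ^ 2) u v * b
       - / 2 * a * du (fun u v => n2 u v ^ 2) u v) * (b - a)).

End Functions.

Section Canonical.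
Variable z : R -> R -> 'rV[R]_4.

Definition Theta := ThetaF (lambda z) (mu z) (nu1 z) (nu2 z).
Definition f1 := f1F (lambda z) (mu z) (nu1 z) (nu2 z).
Definition f2 := f2F (lambda z) (mu z) (nu1 z) (nu2 z).
Definition f3 := f3F (lambda z) (mu z) (nu1 z) (nu2 z).
Definition f4 := f4F (lambda z) (mu z) (nu1 z) (nu2 z).

Definition integrand_v (u v : R) : R :=
  f1 u v + f2 u v * (sqrt (cG z u v) / sqrt (cE z u v)).
Definition integrand_u (u v : R) : R :=
  f3 u v * (sqrt (cE z u v) / sqrt (cG z u v)) + f4 u v.

Definition phi_expr (u0 v0 c1 u v : R) : R :=
  sqrt (cE z u v) *
  exp (- RInt (fun t => integrand_v u t) v0 v
       - RInt (fun s => integrand_u s v0) u0 u + c1).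
Definition psi_expr (u0 v0 c2 u v : R) : R :=
  sqrt (cG z u v) *
  exp (- RInt (fun s => integrand_u s v) u0 u
       - RInt (fun t => integrand_v u0 t) v0 v + c2).

(* The functions phi(u) and psi(v), hence canonicity, are relative to the
   chosen base point and constants. *)
Definition canonical_principal
    (D : R * R -> Prop) (u0 v0 c1 c2 : R) : Prop :=
  principal z D /\
  forall u v, D (u, v) ->
    phi_expr u0 v0 c1 u v = 1 /\ psi_expr u0 v0 c2 u v = 1.

End Canonical.

(* On such a domain all the integration paths above stay inside the domain. *)
Definition open_rectangle (D : R * R -> Prop) : Prop :=
  exists a b c d : Rbar, forall u v,
    D (u, v) <->
    (Rbar_lt a u /\ Rbar_lt u b) /\ (Rbar_lt c v /\ Rbar_lt v d).

Definition diffeo (D V : R * R -> Prop) (h : R * R -> R * R) : Prop :=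
  open D /\ open V /\
  exists k : R * R -> R * R,
    smooth_on D (fun u v => fst (h (u, v))) /\
    smooth_on D (fun u v => snd (h (u, v))) /\
    smooth_on V (fun u v => fst (k (u, v))) /\
    smooth_on V (fun u v => snd (k (u, v))) /\
    (forall p, D p -> V (h p) /\ k (h p) = p) /\
    (forall q, V q -> D (k q) /\ h (k q) = q).

Definition reparam (z : R -> R -> 'rV[R]_4) (h : R * R -> R * R) :
    R -> R -> 'rV[R]_4 :=
  fun u v => z (fst (h (u, v))) (snd (h (u, v))).

(* Theta is the denominator of f1, ..., f4, and it can vanish on a surface
   free of minimal points.  Principal parameters are unique up to exchanging
   them and reparametrizing each one, which leaves Theta unchanged as a
   function on the surface. *)
Definition Theta_nonzero (U : R * R -> Prop) (z : R -> R -> 'rV[R]_4) : Prop :=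
  forall (D V : R * R -> Prop) (h : R * R -> R * R),
    (forall p, V p -> U p) -> diffeo D V h -> principal (reparam z h) D ->
    forall u v, D (u, v) -> Theta (reparam z h) u v <> 0.

(* Main.v *)
Require Import Defs.
From mathcomp Require Import all_boot all_algebra.
From mathcomp Require Import Rstruct.
From Stdlib Require Import Reals Lra Psatz.
From Stdlib Require Import ClassicalEpsilon FunctionalExtensionality.
From Coquelicot Require Import Coquelicot.
Local Open Scope R_scope.

(** Principal parameters exist because the first fundamental form and the form
    L du^2 + 2M du dv + N dv^2 have two common conjugate directions, and
    kappa^2 - k is, up to a positive factor, the discriminant of the quadratic
    equation for these directions: where it is positive the directions are
    distinct and depend smoothly on the point.  Integrating one of the two
    direction fields makes its integral curves coordinate lines; the second
    field is then the orthogonal one, and integrating it in turn gives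
    parameters with F = M = 0 ([principal_direction], [straighten],
    [principal_coordinates]).  The integration needs a smooth local flow of a
    scalar ordinary differential equation ([local_flow]) and the invertibility
    of maps (x, y) |-> (x, Y x y) with Y increasing in y ([triangular_diffeo]).

    In principal parameters put e = sqrt E and g = sqrt G.  The Codazzi
    equations are the b- and l-components of the equality of the mixed third
    derivatives of z.  They form a linear system of four equations in e_v, g_u
    and the two coefficients of the normal connection; its determinant is
    -Theta e g, and Cramer's rule gives
<<
      f1 + f2 g/e = (ln e)_v,        f3 e/g + f4 = (ln g)_u
>>
    ([codazzi_equations], [integrand_v_log], [integrand_u_log]).  The integrals
    in the definition of canonical parameters can therefore be evaluated:
<<
      phi(u) = e(u,v0) / g(u,v0) * g(u0,v0) * exp c1,
      psi(v) = g(u0,v) / e(u0,v) * e(u0,v0) * exp c2.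
>>
    Principal parameters stay principal when each of them is changed
    separately, which multiplies e by a function of u and g by a function of v.
    The two factors can be chosen so that both expressions become 1: their
    values are prescribed along the coordinate lines through the base point,
    and two quadratures give the new parameters ([canonical_change]).

    Smoothness is handled throughout by the classes [Ck]: a solution map whose
    first partial derivatives are expressed through the map itself by operations
    that preserve C^n is of class C^(n+1) as soon as it is of class C^n. *)

(** * Functions of class C^k in two variables *)

Lemma open_locally_2d (D : R * R -> Prop) u v : open D -> D (u, v) ->
  locally_2d (fun a b => D (a, b)) u v.
Proof.
move=> oD Duv; apply/locally_2d_locally.
by apply: filter_imp (oD _ Duv) => -[a b].
Qed.

Lemma locally_2d_open (D : R * R -> Prop) :
  (forall u v, D (u, v) -> locally_2d (fun a b => D (a, b)) u v) -> open D.
Proof.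
move=> H [u v] Duv; have /locally_2d_locally := H u v Duv.
by apply: filter_imp => -[a b].
Qed.

Lemma open_locally_1 (D : R * R -> Prop) u v : open D -> D (u, v) -> locally u (fun a => D (a, v)).
Proof. by move=> oD Duv; have := locally_2d_1d_const_y _ _ _ (open_locally_2d D u v oD Duv). Qed.

Lemma open_locally_2 (D : R * R -> Prop) u v : open D -> D (u, v) -> locally v (fun b => D (u, b)).
Proof. by move=> oD Duv; have := locally_2d_1d_const_x _ _ _ (open_locally_2d D u v oD Duv). Qed.

(** The outermost letter of a word in [partial] is the derivative taken last;
    here the first derivative is split off instead, which is the form that
    inductions on the order of differentiability need. *)
Fixpoint Ck (n : nat) (D : R * R -> Prop) (f : R -> R -> R) : Prop :=
  match n with
  | O => forall u v, D (u, v) -> continuity_2d_pt f u v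
  | S n => (forall u v, D (u, v) ->
              ex_derive (fun s => f s v) u /\ ex_derive (fun t => f u t) v /\
              continuity_2d_pt f u v) /\
           Ck n D (du f) /\ Ck n D (dv f)
  end.

Lemma partial_rcons w b f :
  partial (rcons w b) f = partial w (if b then du f else dv f).
Proof. by elim: w => [|b' w IH] //=; rewrite IH. Qed.

Lemma smooth_onP D f : smooth_on D f <-> forall n, Ck n D f.
Proof.
split.
- move=> H n; elim: n f H => [|n IH] f H /=.
    by move=> u v Duv; have [_ []] := H [::] u v Duv.
  split; first by move=> u v Duv; have := H [::] u v Duv.
  by split; apply: IH => w u v Duv;
    [have := H (rcons w true) u v Duv | have := H (rcons w false) u v Duv];
    rewrite partial_rcons.
- move=> H w; elim/last_ind: w f H => [|w b IH] f H u v Duv.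
    by have [H1 _] := H 1%nat; exact: H1.
  rewrite partial_rcons; apply: IH => // n.
  by have [_ [H1 H2]] := H n.+1; case: b.
Qed.

Lemma Ck_pred n D f : Ck n.+1 D f -> Ck n D f.
Proof.
elim: n f => [|n IH] f; first by case=> H _ u v /H [_ []].
by case=> H [/IH H1 /IH H2].
Qed.

Lemma Ck_cont n D f u v : Ck n D f -> D (u, v) -> continuity_2d_pt f u v.
Proof. by elim: n => [H|n IH /Ck_pred /IH] //; apply: H. Qed.

Lemma Ck_ext n D f g : open D -> (forall u v, D (u, v) -> f u v = g u v) ->
  Ck n D f -> Ck n D g.
Proof.
move=> oD; elim: n f g => [|n IH] f g E.
  move=> H u v Duv; apply: continuity_2d_pt_ext_loc (H u v Duv).
  by apply: (locally_2d_impl _ _ _ _ _ (open_locally_2d D u v oD Duv));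
     apply: locally_2d_forall.
have e1 u v : D (u, v) -> locally u (fun s => f s v = g s v).
  by move=> Duv; apply: filter_imp (open_locally_1 D u v oD Duv) => s; exact: E.
have e2 u v : D (u, v) -> locally v (fun s => f u s = g u s).
  by move=> Duv; apply: filter_imp (open_locally_2 D u v oD Duv) => s; exact: E.
case=> H [H1 H2]; split; [|split].
- move=> u v Duv; have [A [B C]] := H u v Duv; split; [|split].
  + exact: ex_derive_ext_loc (e1 u v Duv) A.
  + exact: ex_derive_ext_loc (e2 u v Duv) B.
  + apply: continuity_2d_pt_ext_loc C.
    by apply: (locally_2d_impl _ _ _ _ _ (open_locally_2d D u v oD Duv));
       apply: locally_2d_forall.
- by apply: IH H1 => u v Duv; apply: Derive_ext_loc; exact: e1.
- by apply: IH H2 => u v Duv; apply: Derive_ext_loc; exact: e2.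
Qed.

(** Explicit candidates for the partial derivatives: away from [D], [du f] is
    an unspecified value, so equalities between functions can only be claimed
    on [D]. *)
Definition partials_on (D : R * R -> Prop) (f fu fv : R -> R -> R) : Prop :=
  forall u v, D (u, v) ->
    is_derive (fun s => f s v) u (fu u v) /\ is_derive (fun t => f u t) v (fv u v).

Lemma partials_on_du D f fu fv u v : partials_on D f fu fv -> D (u, v) ->
  du f u v = fu u v.
Proof. by move=> H /H[H1 _]; apply: is_derive_unique. Qed.

Lemma partials_on_dv D f fu fv u v : partials_on D f fu fv -> D (u, v) ->
  dv f u v = fv u v.
Proof. by move=> H /H[_ H1]; apply: is_derive_unique. Qed.

(** Continuity of one partial derivative suffices for differentiability. *)
Lemma partials_diff D f fu fv u v : open D -> partials_on D f fu fv ->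
  continuity_2d_pt fu u v -> D (u, v) ->
  differentiable_pt_lim f u v (fu u v) (fv u v).
Proof.
move=> oD H c Duv.
have [E1 E2] := H u v Duv.
apply/filterdiff_differentiable_pt_lim; apply: is_derive_filterdiff => //.
- by apply: filter_imp (oD _ Duv) => -[a b] Dab; have [] := H a b Dab.
- exact/continuity_2d_pt_filterlim.
Qed.

(** The way in which every regularity statement below gains one derivative. *)
Lemma Ck_intro n D f fu fv : open D -> partials_on D f fu fv ->
  Ck n D fu -> Ck n D fv -> Ck n.+1 D f.
Proof.
move=> oD H C1 C2; split; [|split].
- move=> u v Duv; have [E1 E2] := H u v Duv.
  split; [by eexists; exact: E1|split; first by eexists; exact: E2].
  apply: differentiable_continuity_pt; exists (fu u v), (fv u v).
  by apply: (partials_diff D) => //; exact: Ck_cont C1 Duv.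
- by apply: Ck_ext C1 => // u v Duv; rewrite (partials_on_du D f fu fv).
- by apply: Ck_ext C2 => // u v Duv; rewrite (partials_on_dv D f fu fv).
Qed.

Lemma Ck_partials n D f : Ck n.+1 D f -> partials_on D f (du f) (dv f).
Proof.
by case=> H _ u v /H [A [B _]]; split; apply: Derive_correct.
Qed.

Lemma Ck_du n D f : Ck n.+1 D f -> Ck n D (du f).
Proof. by case=> _ []. Qed.
Lemma Ck_dv n D f : Ck n.+1 D f -> Ck n D (dv f).
Proof. by case=> _ []. Qed.

Lemma partials_plus D f g fu fv gu gv :
  partials_on D f fu fv -> partials_on D g gu gv ->
  partials_on D (fun u v => f u v + g u v) (fun u v => fu u v + gu u v)
    (fun u v => fv u v + gv u v).
Proof.
move=> Hf Hg u v Duv; have [A B] := Hf u v Duv; have [A' B'] := Hg u v Duv.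
by split; apply: (is_derive_plus (V := R_NormedModule)).
Qed.

Lemma partials_opp D f fu fv :
  partials_on D f fu fv ->
  partials_on D (fun u v => - f u v) (fun u v => - fu u v) (fun u v => - fv u v).
Proof.
move=> Hf u v Duv; have [A B] := Hf u v Duv.
by split; apply: (is_derive_opp (V := R_NormedModule)).
Qed.

Lemma partials_mult D f g fu fv gu gv :
  partials_on D f fu fv -> partials_on D g gu gv ->
  partials_on D (fun u v => f u v * g u v)
    (fun u v => fu u v * g u v + f u v * gu u v)
    (fun u v => fv u v * g u v + f u v * gv u v).
Proof.
move=> Hf Hg u v Duv; have [A B] := Hf u v Duv; have [A' B'] := Hg u v Duv.
by split; apply: is_derive_mult => //; exact: Rmult_comm.
Qed.

Lemma partials_fun D (k k' : R -> R) f fu fv :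
  partials_on D f fu fv ->
  (forall u v, D (u, v) -> is_derive k (f u v) (k' (f u v))) ->
  partials_on D (fun u v => k (f u v)) (fun u v => fu u v * k' (f u v))
    (fun u v => fv u v * k' (f u v)).
Proof.
move=> Hf Hk u v Duv; have [A B] := Hf u v Duv.
by split; apply: (is_derive_comp (V := R_NormedModule)) => //; exact: Hk.
Qed.

Lemma partials_ext D f fu fv f' fu' fv' : open D -> partials_on D f fu fv ->
  (forall u v, D (u, v) -> f u v = f' u v) ->
  (forall u v, D (u, v) -> fu u v = fu' u v) ->
  (forall u v, D (u, v) -> fv u v = fv' u v) -> partials_on D f' fu' fv'.
Proof.
move=> oD H E Eu Ev u v Duv; rewrite -Eu // -Ev //; have [A B] := H u v Duv.
split; [apply: is_derive_ext_loc A | apply: is_derive_ext_loc B].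
- by apply: filter_imp (open_locally_1 D u v oD Duv) => s; exact: E.
- by apply: filter_imp (open_locally_2 D u v oD Duv) => s; exact: E.
Qed.

Lemma Ck_const n D c : Ck n D (fun _ _ => c).
Proof.
elim: n c => [|n IH] c /=; first by move=> *; exact: continuity_2d_pt_const.
have E1 : du (fun _ _ => c) = (fun _ _ => 0).
  by apply: FunctionalExtensionality.functional_extensionality => u;
     apply: FunctionalExtensionality.functional_extensionality => v; exact: Derive_const.
have E2 : dv (fun _ _ => c) = (fun _ _ => 0).
  by apply: FunctionalExtensionality.functional_extensionality => u;
     apply: FunctionalExtensionality.functional_extensionality => v; exact: Derive_const.
rewrite E1 E2; split=> // u v _; split; [|split].
- exact: ex_derive_const.
- exact: ex_derive_const.
- exact: continuity_2d_pt_const.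
Qed.

Lemma Ck_fst n D : open D -> Ck n D (fun u _ => u).
Proof.
move=> oD; case: n => [|n] /=; first by move=> *; exact: continuity_2d_pt_id1.
apply: (Ck_intro _ _ _ (fun _ _ => 1) (fun _ _ => 0)) => //; try exact: Ck_const.
by move=> u v _; split; [exact: is_derive_id | exact: is_derive_const].
Qed.

Lemma Ck_snd n D : open D -> Ck n D (fun _ v => v).
Proof.
move=> oD; case: n => [|n] /=; first by move=> *; exact: continuity_2d_pt_id2.
apply: (Ck_intro _ _ _ (fun _ _ => 0) (fun _ _ => 1)) => //; try exact: Ck_const.
by move=> u v _; split; [exact: is_derive_const | exact: is_derive_id].
Qed.

Lemma Ck_plus n D f g : open D -> Ck n D f -> Ck n D g ->
  Ck n D (fun u v => f u v + g u v).
Proof.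
move=> oD; elim: n f g => [|n IH] f g Cf Cg.
  by move=> u v Duv; apply: continuity_2d_pt_plus; [exact: Cf | exact: Cg].
by apply: (Ck_intro _ _ _ _ _ oD (partials_plus _ _ _ _ _ _ _ (Ck_partials _ _ _ Cf) (Ck_partials _ _ _ Cg)));
  apply: IH; (exact: Ck_du || exact: Ck_dv).
Qed.

Lemma Ck_opp n D f : open D -> Ck n D f -> Ck n D (fun u v => - f u v).
Proof.
move=> oD; elim: n f => [|n IH] f Cf.
  by move=> u v Duv; apply: continuity_2d_pt_opp; exact: Cf.
by apply: (Ck_intro _ _ _ _ _ oD (partials_opp _ _ _ _ (Ck_partials _ _ _ Cf)));
  apply: IH; (exact: Ck_du || exact: Ck_dv).
Qed.

Lemma Ck_mult n D f g : open D -> Ck n D f -> Ck n D g ->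
  Ck n D (fun u v => f u v * g u v).
Proof.
move=> oD; elim: n f g => [|n IH] f g Cf Cg.
  by move=> u v Duv; apply: continuity_2d_pt_mult; [exact: Cf | exact: Cg].
apply: (Ck_intro _ _ _ _ _ oD (partials_mult _ _ _ _ _ _ _ (Ck_partials _ _ _ Cf) (Ck_partials _ _ _ Cg)));
  apply: Ck_plus => //; apply: IH; try exact: Ck_pred; (exact: Ck_du || exact: Ck_dv).
Qed.

Lemma Ck_inv n D f : open D -> (forall u v, D (u, v) -> f u v <> 0) ->
  Ck n D f -> Ck n D (fun u v => / f u v).
Proof.
move=> oD nz; elim: n => [|n IH] Cf.
  by move=> u v Duv; apply: continuity_2d_pt_inv; [exact: Cf | exact: nz].
have Ci := IH (Ck_pred _ _ _ Cf).
have P := partials_fun D Rinv (fun x => - (/ x * / x)) _ _ _ (Ck_partials _ _ _ Cf).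
have {}P := P _.
apply: (Ck_intro _ _ _ _ _ oD (P _)).
- move=> u v Duv; have := nz u v Duv => nzf.
  have -> : - (/ f u v * / f u v) = - 1 / f u v ^ 2 by field.
  by apply: is_derive_inv => //; exact: is_derive_id.
- apply: Ck_mult => //; first exact: Ck_du.
  by apply: Ck_opp => //; apply: Ck_mult.
- apply: Ck_mult => //; first exact: Ck_dv.
  by apply: Ck_opp => //; apply: Ck_mult.
Qed.

Lemma Ck_exp n D f : open D -> Ck n D f -> Ck n D (fun u v => exp (f u v)).
Proof.
move=> oD; elim: n => [|n IH] Cf.
  move=> u v Duv; apply: continuity_1d_2d_pt_comp (Cf u v Duv).
  exact: derivable_continuous_pt (derivable_pt_exp _).
have Ci := IH (Ck_pred _ _ _ Cf).
have P := partials_fun D exp exp _ _ _ (Ck_partials _ _ _ Cf).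
apply: (Ck_intro _ _ _ _ _ oD (P _)).
- by move=> u v Duv; exact: is_derive_exp.
- by apply: Ck_mult => //; exact: Ck_du.
- by apply: Ck_mult => //; exact: Ck_dv.
Qed.

Lemma Ck_sqrt n D f : open D -> (forall u v, D (u, v) -> 0 < f u v) ->
  Ck n D f -> Ck n D (fun u v => sqrt (f u v)).
Proof.
move=> oD pos; elim: n => [|n IH] Cf.
  move=> u v Duv; apply: continuity_1d_2d_pt_comp (Cf u v Duv).
  by apply: continuity_pt_sqrt; have := pos u v Duv; lra.
have Ci := IH (Ck_pred _ _ _ Cf).
have P := partials_fun D sqrt (fun x => / (2 * sqrt x)) _ _ _ (Ck_partials _ _ _ Cf).
have Cj : Ck n D (fun u v => / (2 * sqrt (f u v))).
  apply: Ck_inv => //; last by apply: Ck_mult => //; exact: Ck_const.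
  by move=> u v Duv; have := sqrt_lt_R0 _ (pos u v Duv); lra.
apply: (Ck_intro _ _ _ _ _ oD (P _)).
- move=> u v Duv; have [s Hs] : { l | is_derive sqrt (f u v) l}.
    eexists; apply: is_derive_sqrt; [exact: is_derive_id | exact: pos].
  have := is_derive_sqrt id (f u v) 1 (is_derive_id _) (pos u v Duv).
  have -> : 1 / (2 * sqrt (id (f u v))) = / (2 * sqrt (f u v)).
    by rewrite /id /Rdiv Rmult_1_l.
  by [].
- by apply: Ck_mult => //; exact: Ck_du.
- by apply: Ck_mult => //; exact: Ck_dv.
Qed.

Lemma partials_comp D D' f a b fu fv au av bu bv : open D' ->
  partials_on D' f fu fv -> (forall u v, D' (u, v) -> continuity_2d_pt fu u v) ->
  partials_on D a au av -> partials_on D b bu bv ->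
  (forall u v, D (u, v) -> D' (a u v, b u v)) ->
  partials_on D (fun u v => f (a u v) (b u v))
    (fun u v => fu (a u v) (b u v) * au u v + fv (a u v) (b u v) * bu u v)
    (fun u v => fu (a u v) (b u v) * av u v + fv (a u v) (b u v) * bv u v).
Proof.
move=> oD' Hf cf Ha Hb sub u v Duv.
have [Au Av] := Ha u v Duv; have [Bu Bv] := Hb u v Duv.
have df := partials_diff D' f fu fv _ _ oD' Hf (cf _ _ (sub u v Duv)) (sub u v Duv).
split; apply/is_derive_Reals.
- by apply: (derivable_pt_lim_comp_2d f (fun s => a s v) (fun s => b s v)) => //; apply/is_derive_Reals.
- by apply: (derivable_pt_lim_comp_2d f (fun s => a u s) (fun s => b u s)) => //; apply/is_derive_Reals.
Qed.

Lemma continuity_2d_pt_comp (f a b : R -> R -> R) u v :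
  continuity_2d_pt f (a u v) (b u v) -> continuity_2d_pt a u v ->
  continuity_2d_pt b u v -> continuity_2d_pt (fun u v => f (a u v) (b u v)) u v.
Proof.
move=> cf ca cb eps; have [d Hd] := cf eps.
have [d1 H1] := ca d; have [d2 H2] := cb d.
have dp : 0 < Rmin d1 d2 by apply: Rmin_pos; [case: d1 {H1} | case: d2 {H2}].
exists (mkposreal _ dp) => /= x y hx hy; apply: Hd.
- by apply: H1; [apply: Rlt_le_trans hx _ | apply: Rlt_le_trans hy _]; exact: Rmin_l.
- by apply: H2; [apply: Rlt_le_trans hx _ | apply: Rlt_le_trans hy _]; exact: Rmin_r.
Qed.

Lemma Ck_comp n D D' f a b : open D -> open D' ->
  Ck n D' f -> Ck n D a -> Ck n D b ->
  (forall u v, D (u, v) -> D' (a u v, b u v)) ->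
  Ck n D (fun u v => f (a u v) (b u v)).
Proof.
move=> oD oD' + + + sub; elim: n f a b sub => [|n IH] f a b sub Cf Ca Cb.
  move=> u v Duv; apply: continuity_2d_pt_comp; [|exact: Ca|exact: Cb].
  exact: Cf (sub _ _ Duv).
have Cf1 := Ck_du _ _ _ Cf; have Cf2 := Ck_dv _ _ _ Cf.
have cf u v : D' (u, v) -> continuity_2d_pt (du f) u v by exact: Ck_cont Cf1.
have P := partials_comp D D' f a b _ _ _ _ _ _ oD' (Ck_partials _ _ _ Cf) cf
  (Ck_partials _ _ _ Ca) (Ck_partials _ _ _ Cb) sub.
have Ca' := Ck_pred _ _ _ Ca; have Cb' := Ck_pred _ _ _ Cb.
by apply: (Ck_intro _ _ _ _ _ oD P); apply: Ck_plus => //; apply: Ck_mult => //;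
  (apply: IH => // || exact: Ck_du || exact: Ck_dv).
Qed.

Section SmoothClosure.
Variables (D : R * R -> Prop) (oD : open D).

Lemma smooth_const c : smooth_on D (fun _ _ => c).
Proof. by apply/smooth_onP => n; exact: Ck_const. Qed.
Lemma smooth_fst : smooth_on D (fun u _ => u).
Proof. by apply/smooth_onP => n; exact: Ck_fst. Qed.
Lemma smooth_snd : smooth_on D (fun _ v => v).
Proof. by apply/smooth_onP => n; exact: Ck_snd. Qed.
Lemma smooth_plus f g : smooth_on D f -> smooth_on D g ->
  smooth_on D (fun u v => f u v + g u v).
Proof. by move=> /smooth_onP Hf /smooth_onP Hg; apply/smooth_onP => n; apply: Ck_plus. Qed.
Lemma smooth_opp f : smooth_on D f -> smooth_on D (fun u v => - f u v).
Proof. by move=> /smooth_onP Hf; apply/smooth_onP => n; apply: Ck_opp. Qed.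
Lemma smooth_minus f g : smooth_on D f -> smooth_on D g ->
  smooth_on D (fun u v => f u v - g u v).
Proof. by move=> Hf Hg; apply: smooth_plus => //; apply: smooth_opp. Qed.
Lemma smooth_mult f g : smooth_on D f -> smooth_on D g ->
  smooth_on D (fun u v => f u v * g u v).
Proof. by move=> /smooth_onP Hf /smooth_onP Hg; apply/smooth_onP => n; apply: Ck_mult. Qed.
Lemma smooth_inv f : smooth_on D f -> (forall u v, D (u, v) -> f u v <> 0) ->
  smooth_on D (fun u v => / f u v).
Proof. by move=> /smooth_onP Hf nz; apply/smooth_onP => n; apply: Ck_inv. Qed.
Lemma smooth_sqrt f : smooth_on D f -> (forall u v, D (u, v) -> 0 < f u v) ->
  smooth_on D (fun u v => sqrt (f u v)).
Proof. by move=> /smooth_onP Hf nz; apply/smooth_onP => n; apply: Ck_sqrt. Qed.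
Lemma smooth_du f : smooth_on D f -> smooth_on D (du f).
Proof. by move=> /smooth_onP Hf; apply/smooth_onP => n; apply: Ck_du. Qed.
Lemma smooth_dv f : smooth_on D f -> smooth_on D (dv f).
Proof. by move=> /smooth_onP Hf; apply/smooth_onP => n; apply: Ck_dv. Qed.
Lemma smooth_ext f g : (forall u v, D (u, v) -> f u v = g u v) ->
  smooth_on D f -> smooth_on D g.
Proof. by move=> E /smooth_onP Hf; apply/smooth_onP => n; apply: Ck_ext (Hf n). Qed.
Lemma smooth_pow f n : smooth_on D f -> smooth_on D (fun u v => f u v ^ n).
Proof.
move=> Hf; elim: n => [|n IH]; first exact: smooth_const.
exact: smooth_mult.
Qed.
Lemma smooth_partials f : smooth_on D f -> partials_on D f (du f) (dv f).
Proof. by move=> /smooth_onP /(_ 1%nat) /Ck_partials. Qed.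
Lemma smooth_cont f u v : smooth_on D f -> D (u, v) -> continuity_2d_pt f u v.
Proof. by move=> /smooth_onP /(_ 0%nat) C; exact: C. Qed.
Lemma smooth_comp D' f a b : open D' ->
  smooth_on D' f -> smooth_on D a -> smooth_on D b ->
  (forall u v, D (u, v) -> D' (a u v, b u v)) ->
  smooth_on D (fun u v => f (a u v) (b u v)).
Proof.
move=> oD' /smooth_onP Hf /smooth_onP Ha /smooth_onP Hb sub.
by apply/smooth_onP => n; apply: (Ck_comp _ _ D').
Qed.
Lemma smooth_comp_partials D' f a b : open D' ->
  smooth_on D' f -> smooth_on D a -> smooth_on D b ->
  (forall u v, D (u, v) -> D' (a u v, b u v)) ->
  partials_on D (fun u v => f (a u v) (b u v))
    (fun u v => du f (a u v) (b u v) * du a u v + dv f (a u v) (b u v) * du b u v)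
    (fun u v => du f (a u v) (b u v) * dv a u v + dv f (a u v) (b u v) * dv b u v).
Proof.
move=> oD' Hf Ha Hb sub; apply: (partials_comp _ D') => //.
- by move: Hf => /smooth_onP /(_ 1%nat) /Ck_partials.
- by move=> u v; move: Hf => /smooth_onP /(_ 1%nat) /Ck_du; exact: Ck_cont.
- exact: smooth_partials.
- exact: smooth_partials.
Qed.
Lemma smooth_schwarz f u v : smooth_on D f -> D (u, v) ->
  du (dv f) u v = dv (du f) u v.
Proof.
move=> Hf Duv; apply: Schwarz.
- apply: (locally_2d_impl _ _ _ _ _ (open_locally_2d D u v oD Duv)).
  apply: locally_2d_forall => a b Dab.
  have [H1 [H2 _]] := Hf [::] a b Dab.
  by have [H3 _] := Hf [:: false] a b Dab; have [_ [H4 _]] := Hf [:: true] a b Dab.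
- by have [_ []] := Hf [:: true; false] u v Duv.
- by have [_ []] := Hf [:: false; true] u v Duv.
Qed.
End SmoothClosure.

Lemma smooth_sub (D D' : R * R -> Prop) f :
  (forall p, D' p -> D p) -> smooth_on D f -> smooth_on D' f.
Proof. by move=> sub H w u v /sub; exact: H. Qed.

(** * Integrals depending on a parameter *)
Lemma continuity_2d_pt_fst f x y : continuity_2d_pt f x y ->
  continuous (fun t => f t y) x.
Proof.
move=> H; apply/filterlim_locally => eps; have [d Hd] := H eps.
exists d => t Ht; apply: Hd => //; rewrite Rminus_diag Rabs_R0; exact: cond_pos.
Qed.

Lemma continuity_2d_pt_snd f x y : continuity_2d_pt f x y ->
  continuous (fun t => f x t) y.
Proof.
move=> H; apply/filterlim_locally => eps; have [d Hd] := H eps.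
exists d => t Ht; apply: Hd => //; rewrite Rminus_diag Rabs_R0; exact: cond_pos.
Qed.

Lemma RInt_bound (f : R -> R) a b M :
  (forall t, Rmin a b <= t <= Rmax a b -> continuous f t) ->
  (forall t, Rmin a b <= t <= Rmax a b -> Rabs (f t) <= M) ->
  Rabs (RInt f a b) <= Rabs (b - a) * M.
Proof.
move=> cf bf.
have ex : ex_RInt f a b by apply: ex_RInt_continuous.
case: (Rle_dec a b) => ab.
  rewrite (Rabs_right (b - a)); last lra.
  apply: (abs_RInt_le_const f a b M) => // t Ht; apply: bf.
  by rewrite Rmin_left // Rmax_right.
have {}ab : b <= a by lra.
have ex' : ex_RInt f b a by apply: ex_RInt_swap.
rewrite -(opp_RInt_swap f b a) // Rabs_Ropp (Rabs_left1 (b - a)); last lra.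
rewrite Ropp_minus_distr; apply: (abs_RInt_le_const f b a M) => // t Ht; apply: bf.
by rewrite Rmin_right // Rmax_left.
Qed.

Section ParametricIntegral.
Variables (D : R * R -> Prop) (x0 : R).
Hypothesis oD : open D.
Hypothesis star : forall x s t, D (x, s) -> Rmin x0 x <= t <= Rmax x0 x -> D (t, s).

(** Moving the parameter changes the integrand uniformly little on the compact
    segment from [x0] to [u]; moving the end point adds an integral over a short
    segment, on which the integrand is bounded. *)
Lemma cont_RInt_param g : (forall u v, D (u, v) -> continuity_2d_pt g u v) ->
  forall u v, D (u, v) -> continuity_2d_pt (fun x s => RInt (fun t => g t s) x0 x) u v.
Proof.
move=> cg u v Duv eps.
set a := Rmin x0 u; set b := Rmax x0 u.
have cab t : a <= t <= b -> continuity_2d_pt g t v.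
  by move=> Ht; apply: cg; apply: star Ht.
set e1 := eps / 2 / (1 + Rabs (u - x0)).
have p1 := Rabs_pos (u - x0); have pe := cond_pos eps.
have pe1 : 0 < e1 by apply: Rdiv_lt_0_compat; lra.
have [d1 H1] := uniform_continuity_2d_1d g a b v cab (mkposreal _ pe1).
have [d2 H2] := cg u v Duv (mkposreal _ Rlt_0_1).
set K := Rabs (g u v) + 1.
have pK : 0 < K by have := Rabs_pos (g u v); rewrite /K; lra.
have [d3 H3] := open_locally_2d D u v oD Duv.
have pd : 0 < eps / 2 / K by apply: Rdiv_lt_0_compat; lra.
have pm : 0 < Rmin (Rmin d1 d2) (Rmin d3 (eps / 2 / K)).
  by repeat apply: Rmin_pos; try apply: cond_pos.
exists (mkposreal _ pm) => /= x s hx hs.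
have m1 := Rmin_l (Rmin d1 d2) (Rmin d3 (eps / 2 / K)).
have m2 := Rmin_r (Rmin d1 d2) (Rmin d3 (eps / 2 / K)).
have m3 := Rmin_l d1 d2; have m4 := Rmin_r d1 d2.
have m5 := Rmin_l d3 (eps / 2 / K); have m6 := Rmin_r d3 (eps / 2 / K).
have Dus : D (u, s).
  by apply: H3; [rewrite Rminus_diag Rabs_R0; exact: cond_pos | lra].
have Dxs : D (x, s) by apply: H3; lra.
have tx t : Rmin u x <= t <= Rmax u x -> Rabs (t - u) <= Rabs (x - u).
  by rewrite /Rmin /Rmax; case: Rle_dec => ? ?;
     [rewrite !Rabs_right; lra | rewrite !Rabs_left1; lra].
have Dts t : Rmin u x <= t <= Rmax u x -> D (t, s).
  by move=> /tx Ht; apply: H3; lra.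
have c1 t : Rmin x0 u <= t <= Rmax x0 u -> continuous (fun t => g t s) t.
  by move=> Ht; apply: continuity_2d_pt_fst; apply: cg; apply: star Ht.
have c0 t : Rmin x0 u <= t <= Rmax x0 u -> continuous (fun t => g t v) t.
  by move=> Ht; apply: continuity_2d_pt_fst; apply: cg; apply: star Ht.
have c2 t : Rmin u x <= t <= Rmax u x -> continuous (fun t => g t s) t.
  by move=> Ht; apply: continuity_2d_pt_fst; apply: cg; apply: Dts.
have i1 := ex_RInt_continuous _ _ _ c1; have i0 := ex_RInt_continuous _ _ _ c0.
have i2 := ex_RInt_continuous _ _ _ c2.
rewrite -(RInt_Chasles _ x0 u x i1 i2) /plus /=.
have -> : RInt (fun t => g t s) x0 u + RInt (fun t => g t s) u x - RInt (fun t => g t v) x0 u =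
   RInt (fun t => g t s - g t v) x0 u + RInt (fun t => g t s) u x.
  by rewrite (RInt_minus _ _ _ _ i1 i0) /minus /plus /opp /=; ring.
have B1 : Rabs (RInt (fun t => g t s - g t v) x0 u) <= Rabs (u - x0) * e1.
  apply: RInt_bound.
    by move=> t Ht; apply: (continuous_minus (V := R_NormedModule)); [apply: c1|apply: c0].
  move=> t Ht; apply: Rlt_le; apply: H1 => //.
  - have pd1 := cond_pos d1; split; lra.
  - have pd1 := cond_pos d1; move/Rabs_def2: hs => hs; split; lra.
  - rewrite Rminus_diag Rabs_R0; exact: cond_pos.
have B2 : Rabs (RInt (fun t => g t s) u x) <= Rabs (x - u) * K.
  apply: RInt_bound => // t Ht.
  have /= := H2 t s; have := tx t Ht => h1 h2; rewrite /K.
  have {}h2 : Rabs (g t s - g u v) < 1 by apply: h2; lra.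
  by have := Rabs_triang (g t s - g u v) (g u v); rewrite /Rminus Rplus_assoc Rplus_opp_l Rplus_0_r; move: h2; rewrite /Rminus; lra.
have B3 : Rabs (x - u) * K < eps / 2.
  have -> : eps / 2 = eps / 2 / K * K by field; lra.
  by apply: Rmult_lt_compat_r => //; lra.
have B4 : Rabs (u - x0) * e1 <= eps / 2.
  have -> : eps / 2 = (1 + Rabs (u - x0)) * e1 by rewrite /e1; field; lra.
  by apply: Rmult_le_compat_r; lra.
apply: Rle_lt_trans (Rabs_triang _ _) _; lra.
Qed.

(** The x-derivative is [g] itself, and the s-derivative is the same kind of
    integral for [dv g], so the order of differentiability goes down to the
    continuous case by induction. *)
Lemma Ck_RInt_param n g : Ck n D g ->
  Ck n D (fun x s => RInt (fun t => g t s) x0 x).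
Proof.
elim: n g => [|n IH] g Cg; first exact: cont_RInt_param.
have cg u v : D (u, v) -> continuity_2d_pt g u v by exact: Ck_cont Cg.
have exI u v : D (u, v) -> ex_RInt (fun t => g t v) x0 u.
  move=> Duv; apply: ex_RInt_continuous => t Ht; apply: continuity_2d_pt_fst.
  by apply: cg; apply: star Ht.
apply: (Ck_intro _ _ _ g (fun x s => RInt (fun t => dv g t s) x0 x)) => //.
- move=> u v Duv; split.
    apply: (is_derive_RInt (V:=R_NormedModule) (fun t => g t v) (fun x => RInt (fun t => g t v) x0 x) x0 u); last by apply: continuity_2d_pt_fst; apply: cg.
    apply: filter_imp (open_locally_1 D u v oD Duv) => x Dxv.
    by apply: RInt_correct; apply: exI.
  + apply: (is_derive_RInt_param (fun s t => g t s)).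
    * have cab t : Rmin x0 u <= t <= Rmax x0 u -> D (t, v) by move=> Ht; apply: star Ht.
      have [d Hd] : exists d : posreal, forall s, Rabs (s - v) < d -> D (u, s).
        by have [d Hd] := open_locally_2 D u v oD Duv; exists d => s Hs; apply: Hd.
      exists d => s Hs t Ht; exists (dv g t s).
      by have [_] := Ck_partials _ _ _ Cg t s (star u s t (Hd s Hs) Ht).
    * move=> t Ht eps.
      have [d Hd] := Ck_cont _ _ _ t v (Ck_dv _ _ _ Cg) (star u v t Duv Ht) eps.
      by exists d => a b Ha Hb; apply: Hd.
    * by apply: filter_imp (open_locally_2 D u v oD Duv) => s Dus; apply: exI.
- exact: Ck_pred.
- by apply: IH; exact: Ck_dv.
Qed.
End ParametricIntegral.

(** * Ordinary differential equations with smooth dependence on the initial value *)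
Definition clamp (c r t : R) : R := Rmax (c - r) (Rmin (c + r) t).

Ltac case_minmax :=
  rewrite /Rmax /Rmin /Rabs;
  repeat match goal with
  | |- context [Rle_dec ?x ?y] => destruct (Rle_dec x y)
  | |- context [Rcase_abs ?x] => destruct (Rcase_abs x)
  | H : context [Rle_dec ?x ?y] |- _ => destruct (Rle_dec x y)
  end; repeat split; lra.

Lemma clamp_range c r t : 0 <= r -> c - r <= clamp c r t <= c + r.
Proof. rewrite /clamp => r0; case_minmax. Qed.

Lemma clamp_id c r t : c - r <= t <= c + r -> clamp c r t = t.
Proof. rewrite /clamp => r0; case_minmax. Qed.

Lemma clamp_lip c r t t' : 0 <= r -> Rabs (clamp c r t - clamp c r t') <= Rabs (t - t').
Proof. rewrite /clamp => r0; case_minmax. Qed.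

Lemma lip_continuous (f : R -> R) K x : 0 <= K ->
  (forall t t', Rabs (f t - f t') <= K * Rabs (t - t')) -> continuous f x.
Proof.
move=> K0 H; apply/filterlim_locally => eps.
have pe := cond_pos eps.
have pd : 0 < eps / (K + 1) by apply: Rdiv_lt_0_compat; lra.
exists (mkposreal _ pd) => t Ht.
have {}Ht : Rabs (t - x) < eps / (K + 1) by exact: Ht.
have h := H t x; apply: (Rle_lt_trans _ _ _ h).
have -> : pos eps = (K + 1) * (eps / (K + 1)) by field; lra.
have := Rabs_pos (t - x) => hp; nra.
Qed.

(** The right-hand side is assumed bounded and Lipschitz on the whole plane, and
    time is clamped to [x0 - a, x0 + a]; then the iteration never leaves its
    domain.  The condition a L <= 1/2 makes one step a contraction by the factor
    1/2, without weights. *)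
Section Picard.
Variables (M : R -> R -> R) (K L x0 a : R).
Hypothesis cM : forall x y, continuity_2d_pt M x y.
Hypothesis (K0 : 0 <= K) (bM : forall x y, Rabs (M x y) <= K).
Hypothesis (L0 : 0 <= L)
  (lM : forall x y y', Rabs (M x y - M x y') <= L * Rabs (y - y')).
Hypothesis (a0 : 0 < a) (aL : a * L <= / 2).

Let T (s : R) (f : R -> R) (x : R) : R :=
  s + RInt (fun t => M t (f t)) x0 (clamp x0 a x).

Lemma picard_integrand_cont f t : continuous f t -> continuous (fun t => M t (f t)) t.
Proof.
move=> cf.
have cid := @continuous_id R_UniformSpace t; apply: (continuous_comp_2 (fun t : R => t) f M t cid cf).
exact/continuity_2d_pt_filterlim.
Qed.

Lemma picard_integrand_int f b c : (forall t, continuous f t) -> ex_RInt (fun t => M t (f t)) b c.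
Proof. by move=> cf; apply: ex_RInt_continuous => t _; apply: picard_integrand_cont. Qed.

Lemma picard_step_lip s f x x' : (forall t, continuous f t) ->
  Rabs (T s f x - T s f x') <= K * Rabs (x - x').
Proof.
move=> cf; rewrite /T.
have -> : s + RInt (fun t => M t (f t)) x0 (clamp x0 a x) - (s + RInt (fun t => M t (f t)) x0 (clamp x0 a x'))
  = RInt (fun t => M t (f t)) (clamp x0 a x') (clamp x0 a x).
  rewrite -(RInt_Chasles (fun t => M t (f t)) x0 (clamp x0 a x') (clamp x0 a x)); try exact: picard_integrand_int.
  by rewrite /plus /=; ring.
apply: Rle_trans (RInt_bound _ _ _ K _ _) _.
- by move=> t _; apply: picard_integrand_cont.
- by move=> t _; apply: bM.
- rewrite Rmult_comm; apply: Rmult_le_compat_l => //; apply: clamp_lip; lra.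
Qed.

Lemma picard_step_cont s f x : (forall t, continuous f t) -> continuous (T s f) x.
Proof. by move=> cf; apply: (lip_continuous _ K) => // t t'; apply: picard_step_lip. Qed.

(** Contraction and Lipschitz dependence on the initial value in a single
    estimate: the first is the case s = s', the second follows by iterating. *)
Lemma picard_step_contr s s' f g d x : (forall t, continuous f t) -> (forall t, continuous g t) ->
  (forall t, Rabs (f t - g t) <= d) ->
  Rabs (T s f x - T s' g x) <= Rabs (s - s') + d / 2.
Proof.
move=> cf cg H; rewrite /T.
have d0 : 0 <= d by have := H 0; have := Rabs_pos (f 0 - g 0); lra.
set z := clamp x0 a x.
have -> : s + RInt (fun t => M t (f t)) x0 z - (s' + RInt (fun t => M t (g t)) x0 z)
  = (s - s') + RInt (fun t => M t (f t) - M t (g t)) x0 z.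
  by rewrite (RInt_minus (fun t => M t (f t)) (fun t => M t (g t))); try exact: picard_integrand_int;
     rewrite /minus /plus /opp /=; ring.
apply: Rle_trans (Rabs_triang _ _) _; apply: Rplus_le_compat_l.
apply: Rle_trans (RInt_bound _ _ _ (L * d) _ _) _.
- by move=> t _; apply: (continuous_minus (V := R_NormedModule)); apply: picard_integrand_cont.
- move=> t _; apply: Rle_trans (lM _ _ _) _; exact: Rmult_le_compat_l.
- have hz : Rabs (z - x0) <= a.
    by apply: Rabs_le; have := clamp_range x0 a x (Rlt_le _ _ a0); rewrite -/z; lra.
  have := Rabs_pos (z - x0) => hp.
  have : Rabs (z - x0) * (L * d) <= a * (L * d).
    by apply: Rmult_le_compat_r => //; apply: Rmult_le_pos.
  have : (a * L) * d <= / 2 * d by apply: Rmult_le_compat_r.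
  lra.
Qed.

Fixpoint picard_iter (n : nat) (s : R) : R -> R :=
  match n with O => fun _ => s | S n => T s (picard_iter n s) end.

Lemma picard_iter_cont n s x : continuous (picard_iter n s) x.
Proof. by elim: n x => [|n IH] x /=; [exact: continuous_const | exact: picard_step_cont]. Qed.

Lemma picard_iter_lip n s x x' : Rabs (picard_iter n s x - picard_iter n s x') <= K * Rabs (x - x').
Proof.
case: n => [|n] /=; last exact: picard_step_lip (picard_iter_cont n s).
by rewrite Rminus_diag Rabs_R0; have := Rabs_pos (x - x'); nra.
Qed.

(** The constant 2 is the fixed point of c |-> 1 + c/2. *)
Lemma picard_iter_lip_init n s s' x : Rabs (picard_iter n s x - picard_iter n s' x) <= 2 * Rabs (s - s').
Proof.
elim: n x => [|n IH] x /=; first by have := Rabs_pos (s - s'); lra.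
by have := picard_step_contr s s' _ _ _ x (picard_iter_cont n s) (picard_iter_cont n s') IH; lra.
Qed.

Lemma picard_iter_step (n : nat) s x : Rabs (picard_iter n.+1 s x - picard_iter n s x) <= K * a * (/ 2) ^ n.
Proof.
elim: n x => [|n IH] x.
  rewrite /= /T.
  have -> : forall r, s + r - s = r by move=> r; ring.
  apply: Rle_trans (RInt_bound _ _ _ K _ _) _.
  - by move=> t _; apply: (picard_integrand_cont (fun _ => s)); exact: continuous_const.
  - by move=> t _; apply: bM.
  - have := clamp_range x0 a x (Rlt_le _ _ a0) => hz.
    have h : Rabs (clamp x0 a x - x0) <= a by apply: Rabs_le; lra.
    by rewrite Rmult_1_r Rmult_comm; apply: Rmult_le_compat_l.
have := picard_step_contr s s _ _ _ x (picard_iter_cont n.+1 s) (picard_iter_cont n s) IH.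
rewrite [picard_iter n.+2 s]/= [picard_iter n.+1 s x]/=.
by rewrite (Rminus_diag s) Rabs_R0 /= => h; apply: Rle_trans h _; right; field.
Qed.

Lemma picard_iter_far (n k : nat) s x :
  Rabs (picard_iter (k + n)%nat s x - picard_iter n s x) <= 2 * (K * a) * (/ 2) ^ n.
Proof.
have Ka : 0 <= K * a by apply: Rmult_le_pos; lra.
suff : Rabs (picard_iter (k + n)%nat s x - picard_iter n s x) <= 2 * (K * a) * (/ 2) ^ n * (1 - (/ 2) ^ k).
  move=> h; apply: Rle_trans h _.
  have h2 m : 0 <= (/ 2) ^ m by apply: pow_le; lra.
  have := h2 n; have := h2 k => h3 h4.
  have : 0 <= K * a * (/ 2) ^ n by apply: Rmult_le_pos.
  by nra.
elim: k => [|k IH]; first by rewrite add0n Rminus_diag Rabs_R0 /=; lra.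
rewrite addSn.
have -> : picard_iter (k + n)%nat.+1 s x - picard_iter n s x =
  (picard_iter (k + n)%nat.+1 s x - picard_iter (k + n)%nat s x) + (picard_iter (k + n)%nat s x - picard_iter n s x).
  by ring.
apply: Rle_trans (Rabs_triang _ _) _.
have E : (/ 2) ^ (k + n)%nat = (/ 2) ^ k * (/ 2) ^ n by exact: pow_add.
have := picard_iter_step (k + n)%nat s x; rewrite E => h.
rewrite [(/ 2) ^ k.+1]/=; lra.
Qed.

Lemma picard : exists Y : R -> R -> R,
  (forall x s, Y x s = s + RInt (fun t => M t (Y t s)) x0 (clamp x0 a x)) /\
  (forall x x' s, Rabs (Y x s - Y x' s) <= K * Rabs (x - x')) /\
  (forall x s s', Rabs (Y x s - Y x s') <= 2 * Rabs (s - s')).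
Proof.
have geo : is_lim_seq (fun n => 2 * (K * a) * (/ 2) ^ n) 0.
  have -> : Finite 0 = Rbar_mult (2 * (K * a)) 0 by rewrite /= Rmult_0_r.
  apply: is_lim_seq_scal_l; apply: is_lim_seq_geom; rewrite Rabs_right; lra.
have cv x s : ex_finite_lim_seq (fun n => picard_iter n s x).
  apply/ex_lim_seq_cauchy_corr => eps.
  have /is_lim_seq_spec /(_ (pos_div_2 eps)) [N HN] := geo.
  exists N => n m /leP Hn /leP Hm.
  have {}HN := HN N (le_n _).
  have h k : (N <= k)%nat -> Rabs (picard_iter k s x - picard_iter N s x) < eps / 2.
    move=> Hk; have := picard_iter_far N (k - N)%nat s x; rewrite subnK // => h.
    apply: Rle_lt_trans h _; move: HN; rewrite Rminus_0_r /= => h; exact: Rle_lt_trans (Rle_abs _) h.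
  have -> : picard_iter n s x - picard_iter m s x =
    (picard_iter n s x - picard_iter N s x) - (picard_iter m s x - picard_iter N s x) by ring.
  apply: Rle_lt_trans (Rabs_triang _ _) _; rewrite Rabs_Ropp.
  by have := h n Hn; have := h m Hm; lra.
set Y := fun x s => real (Lim_seq (fun n => picard_iter n s x)).
have limY x s : is_lim_seq (fun n => picard_iter n s x) (Y x s) by apply: Lim_seq_correct'.
have close n x s : Rabs (Y x s - picard_iter n s x) <= 2 * (K * a) * (/ 2) ^ n.
  have h : is_lim_seq (fun k => Rabs (picard_iter (k + n)%nat s x - picard_iter n s x))
             (Rabs (Y x s - picard_iter n s x)).
    apply: (is_lim_seq_abs _ (Finite _)); apply: is_lim_seq_minus'; last exact: is_lim_seq_const.
    have := is_lim_seq_incr_n (fun k => picard_iter k s x) n (Y x s).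
    by move=> [H _]; apply: H.
  apply: (is_lim_seq_le _ _ (Finite _) (Finite _) _ h (is_lim_seq_const _)) => k.
  exact: picard_iter_far.
have Ylip x x' s : Rabs (Y x s - Y x' s) <= K * Rabs (x - x').
  have h : is_lim_seq (fun k => Rabs (picard_iter k s x - picard_iter k s x')) (Rabs (Y x s - Y x' s)).
    by apply: (is_lim_seq_abs _ (Finite _)); apply: is_lim_seq_minus'.
  by apply: (is_lim_seq_le _ _ (Finite _) (Finite _) _ h (is_lim_seq_const _)) => k; exact: picard_iter_lip.
have Yc x s : continuous (fun x => Y x s) x by apply: (lip_continuous _ K).
exists Y; split; [|split] => //.
- move=> x s; rewrite -/(T s (fun t => Y t s) x).
  (* The shifted sequence converges to T Y by contraction, and to Y as a shift;
     the two limits agree. *)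
  have : is_lim_seq (fun n => picard_iter n.+1 s x) (T s (fun t => Y t s) x).
    apply/is_lim_seq_spec => eps.
    have /is_lim_seq_spec /(_ eps) [N HN] := geo.
    exists N => n Hn; have := HN n Hn; rewrite Rminus_0_r => h.
    have h' := picard_step_contr s s (picard_iter n s) (fun t => Y t s) (2 * (K * a) * (/ 2) ^ n) x
      (picard_iter_cont n s) (fun t => Yc t s).
    have {}h' : Rabs (T s (picard_iter n s) x - T s (fun t => Y t s) x) <=
      Rabs (s - s) + 2 * (K * a) * (/ 2) ^ n / 2.
      by apply: h' => t; rewrite Rabs_minus_sym; apply: close.
    rewrite (Rminus_diag s) Rabs_R0 in h'.
    have := Rle_abs (2 * (K * a) * (/ 2) ^ n) => h3.
    apply: Rle_lt_trans h' _.
    have : 0 <= 2 * (K * a) * (/ 2) ^ n by apply: Rle_trans (close n x s); exact: Rabs_pos.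
    lra.
  move=> h1; have := is_lim_seq_incr_1 (fun n => picard_iter n s x) (Y x s).
  move=> [/(_ (limY x s)) h2 _].
  have := is_lim_seq_unique _ _ h1; rewrite (is_lim_seq_unique _ _ h2).
  by case.
- move=> x s s'.
  have h : is_lim_seq (fun k => Rabs (picard_iter k s x - picard_iter k s' x)) (Rabs (Y x s - Y x s')).
    by apply: (is_lim_seq_abs _ (Finite _)); apply: is_lim_seq_minus'.
  by apply: (is_lim_seq_le _ _ (Finite _) (Finite _) _ h (is_lim_seq_const _)) => k; exact: picard_iter_lip_init.
Qed.
End Picard.

Definition box (x0 a y0 b : R) (p : R * R) : Prop :=
  Rabs (fst p - x0) < a /\ Rabs (snd p - y0) < b.

Lemma open_box x0 a y0 b : open (box x0 a y0 b).
Proof.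
apply: locally_2d_open => u v [/= Hu Hv].
have pd : 0 < Rmin (a - Rabs (u - x0)) (b - Rabs (v - y0)) by apply: Rmin_pos; lra.
exists (mkposreal _ pd) => /= x y hx hy; split=> /=.
- have := Rmin_l (a - Rabs (u - x0)) (b - Rabs (v - y0)) => h.
  by have := Rabs_triang (x - u) (u - x0); rewrite (_ : x - u + (u - x0) = x - x0); [lra|ring].
- have := Rmin_r (a - Rabs (u - x0)) (b - Rabs (v - y0)) => h.
  by have := Rabs_triang (y - v) (v - y0); rewrite (_ : y - v + (v - y0) = y - y0); [lra|ring].
Qed.

Lemma between_abs x0 x t : Rmin x0 x <= t <= Rmax x0 x -> Rabs (t - x0) <= Rabs (x - x0).
Proof. case_minmax. Qed.

Lemma box_star x0 a y0 b x s t : box x0 a y0 b (x, s) -> Rmin x0 x <= t <= Rmax x0 x ->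
  box x0 a y0 b (t, s).
Proof. by move=> [/= H1 H2] /between_abs H; split => //=; lra. Qed.

(** Bounds near one point come from continuity there, so that no compactness is
    needed to bound the right-hand side and its derivatives on a small box. *)
Lemma continuity_2d_pt_bound f x0 y0 : continuity_2d_pt f x0 y0 ->
  locally_2d (fun x y => Rabs (f x y) <= Rabs (f x0 y0) + 1) x0 y0.
Proof.
move=> c; have [d Hd] := c (mkposreal _ Rlt_0_1); exists d => x y hx hy.
have /= := Hd x y hx hy => h.
have := Rabs_triang (f x y - f x0 y0) (f x0 y0).
by rewrite (_ : f x y - f x0 y0 + f x0 y0 = f x y); [lra | ring].
Qed.

Section LocalFlow.
Variables (O : R * R -> Prop) (m : R -> R -> R) (x0 y0 r K L C : R).
Hypotheses (oO : open O) (sm : smooth_on O m).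
Hypotheses (r0 : 0 < r) (K0 : 0 < K) (L0 : 0 < L) (C0 : 0 <= C).
Hypothesis inO : forall x y, Rabs (x - x0) <= r -> Rabs (y - y0) <= r ->
  O (x, y) /\ Rabs (m x y) <= K /\ Rabs (dv m x y) <= L /\ Rabs (dv (dv m) x y) <= C.

Lemma mvt_snd x y y' : Rabs (x - x0) <= r -> Rabs (y - y0) <= r -> Rabs (y' - y0) <= r ->
  exists c, Rmin y y' <= c <= Rmax y y' /\ m x y' - m x y = dv m x c * (y' - y).
Proof.
move=> hx hy hy'.
have btw c : Rmin y y' <= c <= Rmax y y' -> Rabs (c - y0) <= r.
  by move: hy hy'; case_minmax.
apply: (MVT_gen (fun y => m x y) y y' (fun c => dv m x c)).
- move=> c Hc; have [Oc _] := inO x c hx (btw c (conj (Rlt_le _ _ (proj1 Hc)) (Rlt_le _ _ (proj2 Hc)))).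
  by have [] := smooth_partials _ _ sm x c Oc.
- move=> c /btw Hc; have [Oc _] := inO x c hx Hc.
  apply/continuity_pt_filterlim; apply: continuity_2d_pt_snd.
  exact: smooth_cont sm Oc.
Qed.

(** The quadratic remainder is what allows differentiating the flow in the
    initial value without uniform continuity arguments. *)
Lemma taylor_snd x y y' : Rabs (x - x0) <= r -> Rabs (y - y0) <= r -> Rabs (y' - y0) <= r ->
  Rabs (m x y' - m x y - dv m x y * (y' - y)) <= C * (y' - y) ^ 2.
Proof.
move=> hx hy hy'.
have btw c : Rmin y y' <= c <= Rmax y y' -> Rabs (c - y0) <= r.
  by move: hy hy'; case_minmax.
have [c [Hc ->]] := mvt_snd x y y' hx hy hy'.
have btw' d : Rmin y c <= d <= Rmax y c -> Rabs (d - y0) <= r.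
  by move: hy (btw c Hc); case_minmax.
have [d [Hd E]] : exists d, Rmin y c <= d <= Rmax y c /\ dv m x c - dv m x y = dv (dv m) x d * (c - y).
  have sm' := smooth_dv _ _ sm.
  apply: (MVT_gen (fun y => dv m x y) y c (fun c => dv (dv m) x c)).
  - move=> e He; have [Oc _] := inO x e hx (btw' e (conj (Rlt_le _ _ (proj1 He)) (Rlt_le _ _ (proj2 He)))).
    by have [] := smooth_partials _ _ sm' x e Oc.
  - move=> e /btw' He; have [Oc _] := inO x e hx He.
    apply/continuity_pt_filterlim; apply: continuity_2d_pt_snd.
    exact: smooth_cont sm' Oc.
have -> : dv m x c * (y' - y) - dv m x y * (y' - y) = dv (dv m) x d * ((c - y) * (y' - y)).
  by rewrite -Rmult_assoc -E; ring.
have [_ [_ [_ bd]]] := inO x d hx (btw' d Hd).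
rewrite Rabs_mult; apply: Rmult_le_compat => //; try exact: Rabs_pos.
have -> : (y' - y) ^ 2 = Rabs (y' - y) * Rabs (y' - y) by rewrite -Rabs_mult Rabs_right; [ring | apply: Rle_ge; exact: Rle_0_sqr].
rewrite Rabs_mult; apply: Rmult_le_compat_r; first exact: Rabs_pos.
exact: between_abs.
Qed.

Let M (x y : R) : R := m (clamp x0 r x) (clamp y0 r y).

Let clampO c t : Rabs (clamp c r t - c) <= r.
Proof. by have := clamp_range c r t (Rlt_le _ _ r0) => h; apply: Rabs_le; lra. Qed.

Let cM x y : continuity_2d_pt M x y.
Proof.
have [OO _] := inO _ _ (clampO x0 x) (clampO y0 y).
apply: (continuity_2d_pt_comp m (fun x _ => clamp x0 r x) (fun _ y => clamp y0 r y)).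
- exact: smooth_cont sm OO.
- apply: continuity_1d_2d_pt_comp (continuity_2d_pt_id1 _ _).
  apply/continuity_pt_filterlim; apply: (lip_continuous _ 1); first lra.
  by move=> t t'; rewrite Rmult_1_l; apply: clamp_lip; lra.
- apply: continuity_1d_2d_pt_comp (continuity_2d_pt_id2 _ _).
  apply/continuity_pt_filterlim; apply: (lip_continuous _ 1); first lra.
  by move=> t t'; rewrite Rmult_1_l; apply: clamp_lip; lra.
Qed.

Let bM x y : Rabs (M x y) <= K.
Proof. by have [_ []] := inO _ _ (clampO x0 x) (clampO y0 y). Qed.

Let lM x y y' : Rabs (M x y - M x y') <= L * Rabs (y - y').
Proof.
have [c [Hc ->]] := mvt_snd _ _ _ (clampO x0 x) (clampO y0 y') (clampO y0 y).
have btw : Rabs (c - y0) <= r by move: Hc (clampO y0 y) (clampO y0 y'); case_minmax.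
have [_ [_ [bd _]]] := inO _ _ (clampO x0 x) btw.
rewrite Rabs_mult; apply: Rmult_le_compat => //; try exact: Rabs_pos.
by apply: clamp_lip; lra.
Qed.

(** Outside the box of radius [r] the equation is continued by clamping both
    variables; solutions starting within r/2 stay inside for the times
    considered, where the clamped and the given equation agree.  The derivative
    of the solution in its initial value s is exp (P x s), P being the integral
    of the linearization dm/dy along the solution; smoothness then follows by
    bootstrapping. *)
Lemma local_flow_bounds : exists (Y : R -> R -> R) (a b : R), 0 < a /\ 0 < b /\
  smooth_on (box x0 a y0 b) Y /\
  (forall x s, box x0 a y0 b (x, s) ->
     O (x, Y x s) /\ du Y x s = m x (Y x s) /\ 0 < dv Y x s) /\
  (forall s, Y x0 s = s).
Proof.
set a := Rmin r (Rmin (/ (2 * L)) (r / (2 * K))).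
have pa : 0 < a.
  repeat apply: Rmin_pos => //; first by apply: Rinv_0_lt_compat; lra.
  by apply: Rdiv_lt_0_compat; lra.
have ar : a <= r by exact: Rmin_l.
have aL : a * L <= / 2.
  have h : a <= / (2 * L) by apply: Rle_trans (Rmin_r _ _) (Rmin_l _ _).
  have -> : / 2 = / (2 * L) * L by field; lra.
  by apply: Rmult_le_compat_r => //; lra.
have aK : K * a <= r / 2.
  have h : a <= r / (2 * K) by apply: Rle_trans (Rmin_r _ _) (Rmin_r _ _).
  have -> : r / 2 = K * (r / (2 * K)) by field; lra.
  by apply: Rmult_le_compat_l => //; lra.
have [Y [Yeq [Ylipx Ylips]]] := picard M K L x0 a cM (Rlt_le _ _ K0) bM (Rlt_le _ _ L0) lM pa aL.
exists Y, a, (r / 2).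
set D := box x0 a y0 (r / 2).
have oD : open D := open_box _ _ _ _.
have init s : Y x0 s = s.
  by rewrite Yeq clamp_id; [rewrite RInt_point /zero /=; ring | lra].
have Ybox x s : D (x, s) -> Rabs (Y x s - y0) < r.
  move=> [/= hx hs].
  have := Ylipx x x0 s; rewrite init => h.
  have h2 : K * Rabs (x - x0) <= r / 2 by apply: Rle_trans aK; apply: Rmult_le_compat_l; lra.
  have := Rabs_triang (Y x s - s) (s - y0).
  by rewrite (_ : Y x s - s + (s - y0) = Y x s - y0); [lra | ring].
have xr x s : D (x, s) -> Rabs (x - x0) <= r by case=> /= h _; lra.
have DO x s : D (x, s) -> O (x, Y x s).
  by move=> Dxs; have [] := inO x (Y x s) (xr x s Dxs) (Rlt_le _ _ (Ybox x s Dxs)).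
have MM x s : D (x, s) -> M x (Y x s) = m x (Y x s).
  move=> Dxs; have h1 := xr x s Dxs; have h2 := Ybox x s Dxs; rewrite /M.
  have -> : clamp x0 r x = x by apply: clamp_id; move: h1; case_minmax.
  by have -> : clamp y0 r (Y x s) = Y x s by apply: clamp_id; move: h2; case_minmax.
have Yc x s : continuous (fun x => Y x s) x by apply: (lip_continuous _ K) => //; lra.
have Yx x s : D (x, s) -> is_derive (fun x => Y x s) x (m x (Y x s)).
  move=> Dxs.
  have cMY t : continuous (fun t => M t (Y t s)) t.
    have cid := @continuous_id R_UniformSpace t.
    apply: (continuous_comp_2 (fun t : R => t) (fun t => Y t s) M t cid (Yc t s)).
    exact/continuity_2d_pt_filterlim.
  rewrite -MM // -[M x (Y x s)]Rplus_0_l.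
  apply: (is_derive_ext_loc (fun x => s + RInt (fun t => M t (Y t s)) x0 x)).
    apply: filter_imp (open_locally_1 D x s oD Dxs) => t [/= Ht _].
    by rewrite (Yeq t) clamp_id //; have := Rabs_def2 _ _ Ht; lra.
  apply: (is_derive_plus (V := R_NormedModule)); first exact: is_derive_const.
  apply: (is_derive_RInt (V := R_NormedModule) (fun t => M t (Y t s)) (fun x => RInt (fun t => M t (Y t s)) x0 x) x0 x) => //.
  by apply: filter_forall => t; apply: RInt_correct; apply: ex_RInt_continuous => ? _; exact: cMY.
have cY : Ck 0 D Y.
  move=> x s _ eps.
  have pe := cond_pos eps.
  have pd : 0 < Rmin (eps / (2 * (K + 1))) (eps / 4).
    by apply: Rmin_pos; apply: Rdiv_lt_0_compat; lra.
  exists (mkposreal _ pd) => /= u v hu hv.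
  have h1 : Rabs (u - x) < eps / (2 * (K + 1)) by apply: Rlt_le_trans hu (Rmin_l _ _).
  have h2 : Rabs (v - s) < eps / 4 by apply: Rlt_le_trans hv (Rmin_r _ _).
  have h3 := Ylipx u x v; have h4 := Ylips x v s.
  have h5 : K * Rabs (u - x) <= eps / 2.
    have -> : eps / 2 = (K + 1) * (eps / (2 * (K + 1))) by field; lra.
    by apply: Rmult_le_compat; try exact: Rabs_pos; lra.
  have := Rabs_triang (Y u v - Y x v) (Y x v - Y x s).
  by rewrite (_ : Y u v - Y x v + (Y x v - Y x s) = Y u v - Y x s); [lra | ring].
pose g x s := dv m x (Y x s).
pose P x s := RInt (fun t => g t s) x0 x.
have star x s t : D (x, s) -> Rmin x0 x <= t <= Rmax x0 x -> D (t, s) by exact: box_star.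
have sdm := smooth_dv _ _ sm.
have Ck_m n : Ck n D Y -> Ck n D (fun x s => m x (Y x s)).
  move=> CY; move: sm => /smooth_onP sm'.
  exact: (Ck_comp n D O m (fun x _ => x) Y oD oO (sm' n) (Ck_fst _ _ oD) CY DO).
have Ck_g n : Ck n D Y -> Ck n D g.
  move=> CY; move: sdm => /smooth_onP sm'.
  exact: (Ck_comp n D O (dv m) (fun x _ => x) Y oD oO (sm' n) (Ck_fst _ _ oD) CY DO).
have cg := Ck_g 0%nat cY.
have gL x s : D (x, s) -> Rabs (g x s) <= L.
  by move=> Dxs; have [_ [_ []]] := inO x (Y x s) (xr x s Dxs) (Rlt_le _ _ (Ybox x s Dxs)).
have gcont x s : D (x, s) -> continuous (fun t => g t s) x.
  by move=> Dxs; apply: continuity_2d_pt_fst; apply: cg.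
have Px x s : D (x, s) -> is_derive (fun x => P x s) x (g x s).
  move=> Dxs; apply: (is_derive_RInt (V := R_NormedModule) (fun t => g t s) (fun x => RInt (fun t => g t s) x0 x) x0 x); last exact: gcont.
  apply: filter_imp (open_locally_1 D x s oD Dxs) => t Dts.
  apply: RInt_correct; apply: ex_RInt_continuous => u Hu; apply: gcont; exact: star Hu.
have Pb x s : D (x, s) -> Rabs (P x s) <= / 2.
  move=> Dxs; apply: Rle_trans (RInt_bound _ _ _ L _ _) _.
  - by move=> t Ht; apply: gcont; apply: star Ht.
  - by move=> t Ht; apply: gL; apply: star Ht.
  - apply: Rle_trans aL; case: Dxs => /= h _; apply: Rmult_le_compat_r; lra.
have e3 t : Rabs t <= / 2 -> exp t <= 3.
  move=> Ht; apply: Rle_trans exp_le_3; apply: Rlt_le; apply: exp_increasing.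
  by have := Rle_abs t; lra.
have Ys x s : D (x, s) -> is_derive (fun s => Y x s) s (exp (P x s)).
  move=> Dxs.
  (* delta = Y(.,s') - Y(.,s) satisfies delta' = dm/dy delta + O(delta^2), so
     delta exp(-P) has derivative O((s' - s)^2), and the mean value theorem
     compares it with its initial value s' - s.  In the constant, 4 bounds
     (delta / (s' - s))^2, and the two factors 3 bound exp(P) and exp(-P). *)
  have key s' : D (x, s') -> Rabs (Y x s' - Y x s - (s' - s) * exp (P x s)) <= 36 * C * a * (s' - s) ^ 2.
    move=> Dxs'.
    have [c [Hc E]] : exists c, Rmin x0 x <= c <= Rmax x0 x /\
        (Y x s' - Y x s) * exp (- P x s) - (Y x0 s' - Y x0 s) * exp (- P x0 s) =
        ((m c (Y c s') - m c (Y c s) - g c s * (Y c s' - Y c s)) * exp (- P c s)) * (x - x0).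
      have der c : Rmin x0 x <= c <= Rmax x0 x ->
         is_derive (fun x => (Y x s' - Y x s) * exp (- P x s)) c
           ((m c (Y c s') - m c (Y c s) - g c s * (Y c s' - Y c s)) * exp (- P c s)).
        move=> Hc; have Dc := star x s c Dxs Hc; have Dc' := star x s' c Dxs' Hc.
        have d1 := is_derive_minus _ _ _ _ _ (Yx c s' Dc') (Yx c s Dc).
        have d2 := is_derive_comp exp _ _ _ _ (is_derive_exp _) (is_derive_opp _ _ _ (Px c s Dc)).
        have d3 := is_derive_mult _ _ _ _ _ d1 d2 Rmult_comm.
        move: d3; rewrite /minus /plus /opp /mult /scal /= /mult /= => d3.
        by evar_last; [exact: d3 | ring].
      apply: (MVT_gen (fun x => (Y x s' - Y x s) * exp (- P x s)) x0 x) => c Hc.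
        by apply: der; lra.
      apply/continuity_pt_filterlim; apply: (ex_derive_continuous (V := R_NormedModule)); eexists; exact: der.
    have Dc := star x s c Dxs Hc; have Dc' := star x s' c Dxs' Hc.
    have P0 : P x0 s = 0 by rewrite /P RInt_point.
    rewrite !init P0 Ropp_0 exp_0 Rmult_1_r in E.
    have -> : Y x s' - Y x s - (s' - s) * exp (P x s) =
      ((Y x s' - Y x s) * exp (- P x s) - (s' - s)) * exp (P x s).
      by rewrite exp_Ropp; field; have := exp_pos (P x s); lra.
    rewrite E.
    have T := taylor_snd c (Y c s) (Y c s') (xr c s Dc) (Rlt_le _ _ (Ybox c s Dc)) (Rlt_le _ _ (Ybox c s' Dc')).
    have l2 : (Y c s' - Y c s) ^ 2 <= 4 * (s' - s) ^ 2.
      have h := Ylips c s' s; have h1 := Rabs_pos (Y c s' - Y c s).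
      rewrite -(pow2_abs (Y c s' - Y c s)) -(pow2_abs (s' - s)).
      nra.
    have {}T : Rabs (m c (Y c s') - m c (Y c s) - g c s * (Y c s' - Y c s)) <= 4 * C * (s' - s) ^ 2.
      by apply: Rle_trans T _; nra.
    have b1 : Rabs (exp (- P c s)) <= 3.
      rewrite Rabs_right; last by have := exp_pos (- P c s); lra.
      by apply: e3; rewrite Rabs_Ropp; apply: Pb.
    have b2 : Rabs (exp (P x s)) <= 3.
      rewrite Rabs_right; last by have := exp_pos (P x s); lra.
      by apply: e3; apply: Pb.
    have b3 : Rabs (x - x0) <= a by case: Dxs => /= h _; lra.
    rewrite !Rabs_mult.
    have -> : 36 * C * a * (s' - s) ^ 2 = 4 * C * (s' - s) ^ 2 * 3 * a * 3 by ring.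
    repeat (apply: Rmult_le_compat => //); repeat (apply: Rmult_le_pos); exact: Rabs_pos.
  apply/is_derive_Reals => eps peps.
  have [d Hd] := open_locally_2 D x s oD Dxs.
  have Ca : 0 <= C * a by apply: Rmult_le_pos; lra.
  have pC : 0 < 36 * C * a + 1 by lra.
  have pd : 0 < Rmin d (eps / (36 * C * a + 1)).
    by apply: Rmin_pos; [exact: cond_pos | apply: Rdiv_lt_0_compat].
  exists (mkposreal _ pd) => h hn0 /= hh.
  have hd : Rabs h < d by apply: Rlt_le_trans hh (Rmin_l _ _).
  have he : Rabs h < eps / (36 * C * a + 1) by apply: Rlt_le_trans hh (Rmin_r _ _).
  have Dh : D (x, s + h).
    by apply: Hd; rewrite /ball /= /AbsRing_ball /abs /minus /plus /opp /= (_ : s + h + - s = h) //; ring.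
  have := key (s + h) Dh; rewrite (_ : s + h - s = h); last by ring.
  have ph : 0 < Rabs h by apply: Rabs_pos_lt.
  have -> : (Y x (s + h) - Y x s) / h - exp (P x s) = (Y x (s + h) - Y x s - h * exp (P x s)) / h by field.
  rewrite /Rdiv Rabs_mult Rabs_inv => k.
  apply: (Rmult_lt_reg_r (Rabs h)) => //.
  rewrite Rmult_assoc Rinv_l; last lra.
  rewrite Rmult_1_r; apply: Rle_lt_trans k _.
  rewrite -pow2_abs.
  have -> : 36 * C * a * Rabs h ^ 2 = (36 * C * a * Rabs h) * Rabs h by ring.
  apply: Rmult_lt_compat_r => //.
  have h1 : (36 * C * a + 1) * Rabs h < (36 * C * a + 1) * (eps / (36 * C * a + 1)).
    exact: Rmult_lt_compat_l.
  have h2 : (36 * C * a + 1) * (eps / (36 * C * a + 1)) = eps by field; lra.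
  lra.
have PD : partials_on D Y (fun x s => m x (Y x s)) (fun x s => exp (P x s)).
  by move=> x s Dxs; split; [exact: Yx | exact: Ys].
have CkY n : Ck n D Y.
  elim: n => [|n IH] //; apply: (Ck_intro n D Y _ _ oD PD); first exact: Ck_m.
  apply: Ck_exp => //; apply: Ck_RInt_param => //; exact: Ck_g.
split=> //; split; first lra.
split; first exact/smooth_onP.
split=> // x s Dxs; split; first exact: DO.
rewrite (partials_on_du _ _ _ _ _ _ PD Dxs) (partials_on_dv _ _ _ _ _ _ PD Dxs).
by split => //; exact: exp_pos.
Qed.
End LocalFlow.

Lemma local_flow (O : R * R -> Prop) m x0 y0 : open O -> O (x0, y0) -> smooth_on O m ->
  exists (Y : R -> R -> R) (a b : R), 0 < a /\ 0 < b /\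
  smooth_on (box x0 a y0 b) Y /\
  (forall x s, box x0 a y0 b (x, s) ->
     O (x, Y x s) /\ du Y x s = m x (Y x s) /\ 0 < dv Y x s) /\
  (forall s, Y x0 s = s).
Proof.
move=> oO O0 sm.
have sm1 := smooth_dv _ _ sm; have sm2 := smooth_dv _ _ sm1.
have l1 := continuity_2d_pt_bound _ _ _ (smooth_cont _ _ _ _ sm O0).
have l2 := continuity_2d_pt_bound _ _ _ (smooth_cont _ _ _ _ sm1 O0).
have l3 := continuity_2d_pt_bound _ _ _ (smooth_cont _ _ _ _ sm2 O0).
have [d Hd] := locally_2d_and _ _ _ _ (open_locally_2d O x0 y0 oO O0)
  (locally_2d_and _ _ _ _ l1 (locally_2d_and _ _ _ _ l2 l3)).
have pd := cond_pos d.
have p1 := Rabs_pos (m x0 y0); have p2 := Rabs_pos (dv m x0 y0).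
have p3 := Rabs_pos (dv (dv m) x0 y0).
apply: (local_flow_bounds O m x0 y0 (d / 2) (Rabs (m x0 y0) + 1)
  (Rabs (dv m x0 y0) + 1) (Rabs (dv (dv m) x0 y0) + 1)) => //; try lra.
by move=> x y hx hy; apply: Hd; lra.
Qed.

(** * Triangular changes of variables and diffeomorphisms *)

(** Both flow maps are triangular, so a one-variable inverse function argument
    replaces the inverse function theorem in the plane. *)
Section Triangular.
Variables (D : R * R -> Prop) (Y : R -> R -> R).
Hypothesis oD : open D.
Hypothesis conv : forall x s s' t, D (x, s) -> D (x, s') -> s <= t <= s' -> D (x, t).
Hypothesis sY : smooth_on D Y.
Hypothesis Ypos : forall x s, D (x, s) -> 0 < dv Y x s.

Definition tri_image (q : R * R) : Prop :=
  exists s, D (fst q, s) /\ Y (fst q) s = snd q.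

Definition tri_inv (x y : R) : R :=
  epsilon (inhabits 0) (fun s => D (x, s) /\ Y x s = y).

Lemma tri_invP x y : tri_image (x, y) -> D (x, tri_inv x y) /\ Y x (tri_inv x y) = y.
Proof. by move=> H; apply: (epsilon_spec (inhabits 0) (fun s => D (x, s) /\ Y x s = y)). Qed.

Lemma tri_incr x s s' : D (x, s) -> D (x, s') -> s < s' -> Y x s < Y x s'.
Proof.
move=> Ds Ds' lt.
have Dc c : s <= c <= s' -> D (x, c) by apply: conv.
have [c [Hc E]] : exists c, Rmin s s' <= c <= Rmax s s' /\ Y x s' - Y x s = dv Y x c * (s' - s).
  apply: (MVT_gen (fun t => Y x t) s s' (fun t => dv Y x t)) => c;
    rewrite Rmin_left ?Rmax_right; try lra; move=> Hc.
  - by have [] := smooth_partials _ _ sY x c (Dc c (conj (Rlt_le _ _ (proj1 Hc)) (Rlt_le _ _ (proj2 Hc)))).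
  - apply/continuity_pt_filterlim; apply: continuity_2d_pt_snd.
    exact: smooth_cont sY (Dc c Hc).
have {}Hc : s <= c <= s' by move: Hc; rewrite /Rmin /Rmax; case: Rle_dec; lra.
have := Ypos x c (Dc c Hc); nra.
Qed.

Lemma tri_inj x s s' : D (x, s) -> D (x, s') -> Y x s = Y x s' -> s = s'.
Proof.
move=> Ds Ds' E; case: (Rtotal_order s s') => [lt|[]] //.
- by have := tri_incr x s s' Ds Ds' lt; lra.
- by move=> lt; have := tri_incr x s' s Ds' Ds lt; lra.
Qed.

(** At the heights s - e and s + e the values of [Y] lie strictly below and
    above [Y x s], and by continuity they still do so for nearby abscissas; the
    intermediate value theorem gives a solution in between.  This yields at once
    that the image is open and that the inverse is continuous. *)
Lemma tri_solve x s (eps : posreal) : D (x, s) ->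
  exists d : posreal, forall x' y', Rabs (x' - x) < d -> Rabs (y' - Y x s) < d ->
  exists s', Rabs (s' - s) < eps /\ D (x', s') /\ Y x' s' = y'.
Proof.
move=> Ds.
have [d0 H0] := open_locally_2d D x s oD Ds.
have pe := cond_pos eps; have pd0 := cond_pos d0.
set e := Rmin eps d0 / 2.
have e0 : 0 < e by rewrite /e; have := Rmin_pos _ _ pe pd0; lra.
have ee : e < eps by rewrite /e; have := Rmin_l eps d0; lra.
have ed : e < d0 by rewrite /e; have := Rmin_r eps d0; lra.
have zx : Rabs (x - x) < d0 by rewrite Rminus_diag Rabs_R0.
have D1 : D (x, s - e) by apply: H0 => //; rewrite (_ : s - e - s = - e); [rewrite Rabs_Ropp Rabs_right; lra | ring].
have D2 : D (x, s + e) by apply: H0 => //; rewrite (_ : s + e - s = e); [rewrite Rabs_right; lra | ring].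
have i1 := tri_incr x (s - e) s D1 Ds ltac:(lra).
have i2 := tri_incr x s (s + e) Ds D2 ltac:(lra).
set eta := Rmin (Y x s - Y x (s - e)) (Y x (s + e) - Y x s) / 2.
have m1 := Rmin_l (Y x s - Y x (s - e)) (Y x (s + e) - Y x s).
have m2 := Rmin_r (Y x s - Y x (s - e)) (Y x (s + e) - Y x s).
have peta : 0 < eta by rewrite /eta; apply: Rdiv_lt_0_compat; [apply: Rmin_pos|]; lra.
have q1 : 2 * eta <= Y x s - Y x (s - e) by rewrite /eta; lra.
have q2 : 2 * eta <= Y x (s + e) - Y x s by rewrite /eta; lra.
clearbody eta.
have [d1 H1] := smooth_cont _ _ _ _ sY D1 (mkposreal _ peta).
have [d2 H2] := smooth_cont _ _ _ _ sY D2 (mkposreal _ peta).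
have pd : 0 < Rmin (Rmin d0 eta) (Rmin d1 d2).
  by repeat apply: Rmin_pos => //; exact: cond_pos.
exists (mkposreal _ pd) => /= x' y' hx hy.
have k1 := Rmin_l (Rmin d0 eta) (Rmin d1 d2); have k2 := Rmin_r (Rmin d0 eta) (Rmin d1 d2).
have k3 := Rmin_l d0 eta; have k4 := Rmin_r d0 eta.
have k5 := Rmin_l d1 d2; have k6 := Rmin_r d1 d2.
have z1 : Rabs (s - e - (s - e)) < d1 by rewrite Rminus_diag Rabs_R0; exact: cond_pos.
have z2 : Rabs (s + e - (s + e)) < d2 by rewrite Rminus_diag Rabs_R0; exact: cond_pos.
have /= b1 := H1 x' (s - e) ltac:(lra) z1.
have /= b2 := H2 x' (s + e) ltac:(lra) z2.
have Dx t : s - e <= t <= s + e -> D (x', t).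
  move=> Ht; apply: H0; first lra.
  by apply: Rle_lt_trans ed; apply: Rabs_le; lra.
have [/Rabs_def2 a1 /Rabs_def2 a2] := conj b1 b2.
have a3 := Rabs_def2 _ _ hy.
have [s' [Hs' E]] : {z | s - e <= z <= s + e /\ Y x' z - y' = 0}.
  apply: (Ranalysis5.IVT_interv (fun t => Y x' t - y')).
  - move=> t Ht; apply: continuity_pt_minus; last by apply: continuity_pt_const => ? ?.
    apply/continuity_pt_filterlim; apply: continuity_2d_pt_snd.
    exact: smooth_cont sY (Dx t Ht).
  - lra.
  - lra.
  - lra.
exists s'; split; last by split; [exact: Dx | lra].
by apply: Rle_lt_trans ee; apply: Rabs_le; lra.
Qed.

Lemma tri_inv_uniq x s : D (x, s) -> tri_inv x (Y x s) = s.
Proof.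
move=> Ds; have [|D' E] := tri_invP x (Y x s); first by exists s.
exact: tri_inj E.
Qed.

Lemma tri_inv_near x y (eps : posreal) : tri_image (x, y) ->
  locally_2d (fun x' y' => tri_image (x', y') /\
    Rabs (tri_inv x' y' - tri_inv x y) < eps) x y.
Proof.
move=> /tri_invP [Ds E].
have [d Hd] := tri_solve x _ eps Ds.
exists d => x' y' hx hy; rewrite E in Hd.
have [s' [h1 [h2 h3]]] := Hd x' y' hx hy.
by split; [exists s' | rewrite -h3 tri_inv_uniq].
Qed.

Lemma open_tri_image : open tri_image.
Proof.
apply: locally_2d_open => x y H.
have := tri_inv_near x y (mkposreal _ Rlt_0_1) H.
by apply: locally_2d_impl; apply: locally_2d_forall => u v [].
Qed.

(** Differentiability of [Y] at (x, s) reads ly ds = dy - lx dx + o(|dx| + |ds|).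
    A first use with o bounded by ly/2 gives |ds| <= A max(|dx|, |dy|); a second
    use turns the remainder into o(max(|dx|, |dy|)). *)
Lemma tri_inv_diff x y : tri_image (x, y) ->
  differentiable_pt_lim tri_inv x y
    (- du Y x (tri_inv x y) / dv Y x (tri_inv x y)) (/ dv Y x (tri_inv x y)).
Proof.
move=> im; have [Ds E] := tri_invP x y im.
set s := tri_inv x y in Ds E *.
set lx := du Y x s; set ly := dv Y x s.
have ly0 : 0 < ly by exact: Ypos.
have dY : differentiable_pt_lim Y x s lx ly.
  apply: (partials_diff D Y (du Y) (dv Y)) => //; first exact: smooth_partials.
  exact: smooth_cont (smooth_du _ _ sY) Ds.
set A := 2 * (Rabs lx + 1) / ly + 1.
have plx := Rabs_pos lx.
have A1 : 1 <= A.
  have pq : 0 < 2 * (Rabs lx + 1) / ly by apply: Rdiv_lt_0_compat; lra.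
  by rewrite /A; lra.
move=> eps; have pe := cond_pos eps.
set e1 := Rmin (ly / 2) (eps * ly / A).
have e1p : 0 < e1.
  apply: Rmin_pos; first lra.
  by apply: Rdiv_lt_0_compat; [nra | lra].
have [d Hd] := dY (mkposreal _ e1p).
have [d' Hd'] := tri_inv_near x y d im.
have pd : 0 < Rmin d d' by apply: Rmin_pos; exact: cond_pos.
exists (mkposreal _ pd) => /= x' y' hx hy.
have hx1 : Rabs (x' - x) < d by apply: Rlt_le_trans hx (Rmin_l _ _).
have hx2 : Rabs (x' - x) < d' by apply: Rlt_le_trans hx (Rmin_r _ _).
have hy2 : Rabs (y' - y) < d' by apply: Rlt_le_trans hy (Rmin_r _ _).
have [im' hs] := Hd' x' y' hx2 hy2.
have [Ds' E'] := tri_invP x' y' im'.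
rewrite -/s in hs *; set s' := tri_inv x' y' in hs Ds' E' *.
have /= := Hd x' s' hx1 hs; rewrite E E' => key.
set dx := x' - x in hx hx1 hx2 key *; set dy := y' - y in hy hy2 key *.
set ds := s' - s in hs key *.
set m := Rmax (Rabs dx) (Rabs dy).
have mx : Rabs dx <= m by exact: Rmax_l.
have my : Rabs dy <= m by exact: Rmax_r.
set M := Rmax (Rabs dx) (Rabs ds) in key.
have Msum : M <= Rabs dx + Rabs ds.
  by rewrite /M /Rmax; case: Rle_dec => _; have := Rabs_pos dx; have := Rabs_pos ds; lra.
have M0 : 0 <= M by apply: Rle_trans (Rabs_pos dx) (Rmax_l _ _).
have e1l : e1 <= ly / 2 by exact: Rmin_l.
have e1r : e1 <= eps * ly / A by exact: Rmin_r.
have k1 : Rabs (ly * ds) <= Rabs dy + Rabs lx * Rabs dx + e1 * M.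
  have -> : ly * ds = dy - lx * dx - (dy - (lx * dx + ly * ds)) by ring.
  apply: Rle_trans (Rabs_triang _ _) _; rewrite Rabs_Ropp.
  have := Rabs_triang dy (- (lx * dx)); rewrite Rabs_Ropp Rabs_mult => t.
  by move: t key; rewrite /Rminus; lra.
rewrite Rabs_mult (Rabs_right ly) in k1; last lra.
have k2 : ly * Rabs ds <= 2 * (Rabs lx + 1) * m + ly * m.
  have : e1 * M <= ly / 2 * (Rabs dx + Rabs ds) by apply: Rmult_le_compat; lra.
  have : Rabs lx * Rabs dx <= Rabs lx * m by apply: Rmult_le_compat_l.
  have : ly * Rabs dx <= ly * m by apply: Rmult_le_compat_l; lra.
  lra.
have k3 : Rabs ds <= A * m.
  apply: (Rmult_le_reg_l ly) => //.
  by have -> : ly * (A * m) = 2 * (Rabs lx + 1) * m + ly * m by rewrite /A; field; lra.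
have m0 : 0 <= m by apply: Rle_trans mx; exact: Rabs_pos.
have k4 : M <= A * m.
  by rewrite /M; apply: Rmax_lub => //; nra.
have -> : s' - s - (- lx / ly * dx + / ly * dy) = - (dy - (lx * dx + ly * ds)) * / ly.
  by rewrite /ds; field; lra.
rewrite Rabs_mult Rabs_Ropp (Rabs_right (/ ly)); last by apply: Rle_ge; apply: Rlt_le; apply: Rinv_0_lt_compat.
apply: (Rmult_le_reg_r ly) => //.
rewrite Rmult_assoc Rinv_l ?Rmult_1_r; last lra.
apply: Rle_trans key _.
apply: (Rle_trans _ (eps * ly / A * (A * m))).
  by apply: Rmult_le_compat => //; lra.
by right; field; lra.
Qed.

Lemma partials_tri_inv : partials_on tri_image tri_inv
  (fun x y => - du Y x (tri_inv x y) * / dv Y x (tri_inv x y))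
  (fun x y => / dv Y x (tri_inv x y)).
Proof.
move=> x y /tri_inv_diff H; split; apply/is_derive_Reals.
- have := derivable_pt_lim_comp_2d tri_inv (fun t => t) (fun _ => y) x _ _ _ _ H
    (derivable_pt_lim_id x) (derivable_pt_lim_const y x).
  by rewrite Rmult_1_r Rmult_0_r Rplus_0_r.
- have := derivable_pt_lim_comp_2d tri_inv (fun _ => x) (fun t => t) y _ _ _ _ H
    (derivable_pt_lim_const x y) (derivable_pt_lim_id y).
  by rewrite Rmult_1_r Rmult_0_r Rplus_0_l.
Qed.

(** The partial derivatives of the inverse are rational in the derivatives of
    [Y] taken at the inverse itself, hence bootstrapping applies. *)
Lemma smooth_tri_inv : smooth_on tri_image tri_inv.
Proof.
have oV := open_tri_image.
have sub x y : tri_image (x, y) -> D (x, tri_inv x y) by move=> /tri_invP[].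
have /smooth_onP cu := smooth_du _ _ sY; have /smooth_onP cv := smooth_dv _ _ sY.
apply/smooth_onP; elim=> [|n IH].
  by move=> x y /tri_inv_diff H; apply: differentiable_continuity_pt; eexists; eexists; exact: H.
have c1 := Ck_comp n _ D _ _ _ oV oD (cu n) (Ck_fst n _ oV) IH sub.
have c2 := Ck_comp n _ D _ _ _ oV oD (cv n) (Ck_fst n _ oV) IH sub.
have c3 : Ck n tri_image (fun x y => / dv Y x (tri_inv x y)).
  by apply: Ck_inv => // x y /sub /Ypos; lra.
apply: (Ck_intro _ _ _ _ _ oV partials_tri_inv) => //.
by apply: Ck_mult => //; apply: Ck_opp.
Qed.

Lemma triangular_diffeo : diffeo D tri_image (fun p => (fst p, Y (fst p) (snd p))).
Proof.
have oV := open_tri_image.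
split=> //; split=> //; exists (fun q => (fst q, tri_inv (fst q) (snd q))) => /=.
split; first exact: smooth_fst.
split; first exact: sY.
split; first exact: smooth_fst.
split; first exact: smooth_tri_inv.
split=> -[x y] /= H; last by have [H1 ->] := tri_invP x y H.
by rewrite tri_inv_uniq //; split => //; exists y.
Qed.
End Triangular.

Lemma smooth_pair_comp (D V : R * R -> Prop) (h : R * R -> R * R) (f : R * R -> R) :
  open D -> open V -> (forall p, D p -> V (h p)) ->
  smooth_on D (fun u v => fst (h (u, v))) -> smooth_on D (fun u v => snd (h (u, v))) ->
  smooth_on V (fun u v => f (u, v)) -> smooth_on D (fun u v => f (h (u, v))).
Proof.
move=> oD oV sub s1 s2 sf.
have := smooth_comp D oD V (fun u v => f (u, v)) _ _ oV sf s1 s2.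
move=> /(_ _) H; apply: smooth_ext oD _ _ _ (H _); last first.
  by move=> u v /sub; case: (h (u, v)).
by move=> u v _; case: (h (u, v)).
Qed.

Lemma diffeo_comp D V W h g : diffeo D V h -> diffeo V W g ->
  diffeo D W (fun p => g (h p)).
Proof.
move=> [oD [oV [k [h1 [h2 [k1 [k2 [hk kh]]]]]]]] [_ [oW [j [g1 [g2 [j1 [j2 [gj jg]]]]]]]].
split=> //; split=> //; exists (fun p => k (j p)).
have hs p : D p -> V (h p) by move=> /hk[].
have js p : W p -> V (j p) by move=> /jg[].
split; first exact: (smooth_pair_comp D V h (fun p => fst (g p))).
split; first exact: (smooth_pair_comp D V h (fun p => snd (g p))).
split; first exact: (smooth_pair_comp W V j (fun p => fst (k p))).
split; first exact: (smooth_pair_comp W V j (fun p => snd (k p))).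
split=> p.
- by move=> /hk [/gj [Wp ->]].
- by move=> /jg [/kh [Dp ->]].
Qed.

Lemma open_preimage (V D : R * R -> Prop) (k : R * R -> R * R) : open V -> open D ->
  smooth_on V (fun u v => fst (k (u, v))) -> smooth_on V (fun u v => snd (k (u, v))) ->
  open (fun q => V q /\ D (k q)).
Proof.
move=> oV oD k1 k2; apply: locally_2d_open => u v [Vuv Dk].
have [d0 H0] := open_locally_2d V u v oV Vuv.
have [d Hd] : locally_2d (fun a b => D (a, b)) (fst (k (u, v))) (snd (k (u, v))).
  by apply: open_locally_2d => //; case: (k (u, v)) Dk.
have [d1 H1] := smooth_cont _ _ _ _ k1 Vuv d.
have [d2 H2] := smooth_cont _ _ _ _ k2 Vuv d.
have pd : 0 < Rmin d0 (Rmin d1 d2) by repeat apply: Rmin_pos; exact: cond_pos.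
have m1 := Rmin_l d0 (Rmin d1 d2); have m2 := Rmin_r d0 (Rmin d1 d2).
have m3 := Rmin_l d1 d2; have m4 := Rmin_r d1 d2.
exists (mkposreal _ pd) => /= x y hx hy; split; first by apply: H0; lra.
have := Hd (fst (k (x, y))) (snd (k (x, y))).
case E : (k (x, y)) => [a b] /=; apply.
- by have := H1 x y; rewrite E; apply; lra.
- by have := H2 x y; rewrite E; apply; lra.
Qed.

(** The image has to be described through the inverse map, in order to be
    recognized as open. *)
Lemma diffeo_restrict (D V D' : R * R -> Prop) h : diffeo D V h -> open D' ->
  (forall p, D' p -> D p) ->
  exists V', diffeo D' V' h /\ (forall q, V' q -> V q).
Proof.
move=> [oD [oV [k [h1 [h2 [k1 [k2 [hk kh]]]]]]]] oD' sub.
exists (fun q => V q /\ D' (k q)); split; last by move=> q [].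
split=> //; split; first exact: open_preimage.
exists k.
split; first exact: smooth_sub h1.
split; first exact: smooth_sub h2.
split; first by apply: smooth_sub k1 => q [].
split; first by apply: smooth_sub k2 => q [].
split=> [p Dp|q [Vq Dq]]; last by have [] := kh q Vq.
by have [Vp E] := hk p (sub p Dp); rewrite E.
Qed.

Lemma diffeo_swap D : open D ->
  diffeo (fun p => D (snd p, fst p)) D (fun p => (snd p, fst p)).
Proof.
move=> oD.
have oD' : open (fun p : R * R => D (snd p, fst p)).
  apply: locally_2d_open => u v /= H; have [d Hd] := open_locally_2d D v u oD H.
  by exists d => x y hx hy; apply: Hd.
split=> //; split=> //; exists (fun p => (snd p, fst p)) => /=.
split; first exact: smooth_snd.
split; first exact: smooth_fst.
split; first exact: smooth_snd.
split; first exact: smooth_fst.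
by split=> -[x y].
Qed.

(** * Vectors of R^4 *)
Delimit Scope ring_scope with V.

Definition i0 : 'I_4 := @Ordinal 4 0 isT.
Definition i1 : 'I_4 := @Ordinal 4 1 isT.
Definition i2 : 'I_4 := @Ordinal 4 2 isT.
Definition i3 : 'I_4 := @Ordinal 4 3 isT.

Lemma forall_I4 (P : 'I_4 -> Prop) : P i0 -> P i1 -> P i2 -> P i3 -> forall i, P i.
Proof.
move=> p0 p1 p2 p3 [[|[|[|[|i]]]] Hi] //.
- by have -> : Ordinal Hi = i0 by apply: val_inj.
- by have -> : Ordinal Hi = i1 by apply: val_inj.
- by have -> : Ordinal Hi = i2 by apply: val_inj.
- by have -> : Ordinal Hi = i3 by apply: val_inj.
Qed.

Section RingSums.
Local Open Scope ring_scope.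
Lemma sum_I4 (F : 'I_4 -> R) : \sum_(i < 4) F i = F i0 + F i1 + F i2 + F i3.
Proof.
rewrite !big_ord_recr big_ord0 /= GRing.add0r.
by congr (F _ + F _ + F _ + F _); exact: val_inj.
Qed.
End RingSums.

Lemma dotE (a b : 'rV[R]_4) : dot a b =
  a ord0 i0 * b ord0 i0 + a ord0 i1 * b ord0 i1 + a ord0 i2 * b ord0 i2 + a ord0 i3 * b ord0 i3.
Proof. by rewrite /dot sum_I4. Qed.

Definition det3 (a1 a2 a3 b1 b2 b3 c1 c2 c3 : R) : R :=
  a1 * (b2 * c3 - b3 * c2) - a2 * (b1 * c3 - b3 * c1) + a3 * (b1 * c2 - b2 * c1).

(** Coordinates indexed by natural numbers: the indices that Laplace expansion
    produces can then be computed. *)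
Lemma rV4_nat (w : 'rV[R]_4) : exists f : nat -> R, forall i : 'I_4, w ord0 i = f (nat_of_ord i).
Proof.
exists (fun n => w ord0 (inord n)) => i; congr (w _ _).
by apply: val_inj; rewrite /= inordK.
Qed.

Lemma det_mx33 (M : 'M[R]_3) (f : nat -> nat -> R) :
  (forall i j : 'I_3, M i j = f (nat_of_ord i) (nat_of_ord j)) ->
  determinant M = det3 (f 0 0)%nat (f 0 1)%nat (f 0 2)%nat (f 1 0)%nat (f 1 1)%nat
    (f 1 2)%nat (f 2 0)%nat (f 2 1)%nat (f 2 2)%nat.
Proof.
move=> E.
rewrite !(expand_det_row _ ord0) !big_ord_recr !big_ord0 /= /cofactor.
rewrite !(expand_det_row _ ord0) !big_ord_recr !big_ord0 /= /cofactor.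
rewrite !det_mx11 !mxE !E /= /bump /= !addn0 !add0n !addn1 /=.
rewrite !GRing.expr0 !GRing.expr1 !GRing.exprS !GRing.expr0.
rewrite /det3 /GRing.add /GRing.mul /GRing.opp /GRing.one /GRing.zero /=.
ring.
Qed.

Lemma det4E (a b c d : 'rV[R]_4) : det4 a b c d =
  a ord0 i0 * det3 (b ord0 i1) (b ord0 i2) (b ord0 i3) (c ord0 i1) (c ord0 i2) (c ord0 i3)
    (d ord0 i1) (d ord0 i2) (d ord0 i3)
  - a ord0 i1 * det3 (b ord0 i0) (b ord0 i2) (b ord0 i3) (c ord0 i0) (c ord0 i2) (c ord0 i3)
    (d ord0 i0) (d ord0 i2) (d ord0 i3)
  + a ord0 i2 * det3 (b ord0 i0) (b ord0 i1) (b ord0 i3) (c ord0 i0) (c ord0 i1) (c ord0 i3)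
    (d ord0 i0) (d ord0 i1) (d ord0 i3)
  - a ord0 i3 * det3 (b ord0 i0) (b ord0 i1) (b ord0 i2) (c ord0 i0) (c ord0 i1) (c ord0 i2)
    (d ord0 i0) (d ord0 i1) (d ord0 i2).
Proof.
rewrite /det4 (expand_det_row _ i0) sum_I4 /cofactor.
have [fa Ea] := rV4_nat a; have [fb Eb] := rV4_nat b.
have [fc Ec] := rV4_nat c; have [fd Ed] := rV4_nat d.
have E (j : 'I_4) : determinant (row' i0 (col' j (\matrix_(i < 4) nth 0 [:: a; b; c; d] i)))%V =
  det3 (fb (bump j 0)) (fb (bump j 1)) (fb (bump j 2))
       (fc (bump j 0)) (fc (bump j 1)) (fc (bump j 2))
       (fd (bump j 0)) (fd (bump j 1)) (fd (bump j 2)).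
  rewrite (det_mx33 _ (fun k l => nth (fun _ => 0) [:: fb; fc; fd] k (bump j l))) //.
  by move=> [[|[|[|k]]] Hk] l //; rewrite !mxE /= ?Eb ?Ec ?Ed.
rewrite !E !mxE /= !Ea !Eb !Ec !Ed /= /bump /= !add0n !add1n.
rewrite !GRing.expr0 !GRing.expr1 !GRing.exprS !GRing.expr0.
rewrite /det3 /GRing.add /GRing.mul /GRing.opp /GRing.one /GRing.zero /=.
ring.
Qed.

Ltac vec_ring := rewrite ?dotE ?mxE ?det4E ?mxE /det3 /GRing.add /GRing.mul /GRing.opp /GRing.one
   /GRing.natmul /= /GRing.zero /=; ring.

Lemma rV4_ext (v w : 'rV[R]_4) : (forall i, v ord0 i = w ord0 i) -> v = w.
Proof. by move=> H; apply/rowP. Qed.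

Lemma dotC a b : dot a b = dot b a.
Proof. vec_ring. Qed.
Lemma dotDl a b c : dot (a + b)%V c = dot a c + dot b c.
Proof. vec_ring. Qed.
Lemma dotBl a b c : dot (a - b)%V c = dot a c - dot b c.
Proof. vec_ring. Qed.
Lemma dotZl k a c : dot (k *: a)%V c = k * dot a c.
Proof. vec_ring. Qed.
Lemma dotDr a b c : dot c (a + b)%V = dot c a + dot c b.
Proof. vec_ring. Qed.
Lemma dotZr k a c : dot c (k *: a)%V = k * dot c a.
Proof. vec_ring. Qed.
Lemma dot_vscalel k a c : dot (vscale k a) c = k * dot a c.
Proof. exact: dotZl. Qed.
Lemma dot_vscaler k a c : dot c (vscale k a) = k * dot c a.
Proof. exact: dotZr. Qed.
Lemma dot_normal_part x y w n : dot (normal_part x y w) n =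
  dot w n - dot w x * dot x n - dot w y * dot y n.
Proof. by rewrite /normal_part !dotBl !dotZl. Qed.
Lemma dot_normalize w n : dot (normalize w) n = / sqrt (dot w w) * dot w n.
Proof. exact: dotZl. Qed.
Lemma dot_midpoint v w n : dot (midpoint v w) n = / 2 * (dot v n + dot w n).
Proof. by rewrite /midpoint dotZl dotDl. Qed.

Lemma dot_ge0 a : 0 <= dot a a.
Proof. rewrite dotE; nra. Qed.

Lemma dot_eq0 a : dot a a = 0 -> forall b, dot a b = 0.
Proof.
rewrite dotE => H b; rewrite dotE.
have : a ord0 i0 = 0 by nra. have : a ord0 i1 = 0 by nra.
have : a ord0 i2 = 0 by nra. have : a ord0 i3 = 0 by nra.
by move=> -> -> -> ->; ring.
Qed.

(** This reduces all properties of the cross product to alternation of the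
    determinant. *)
Lemma dot_cross a b c w : dot (cross a b c) w = det4 a b c w.
Proof. vec_ring. Qed.

Lemma det4_alt13 a b c : det4 a b c a = 0.
Proof. vec_ring. Qed.
Lemma det4_alt23 a b c : det4 a b c b = 0.
Proof. vec_ring. Qed.
Lemma det4_alt33 a b c : det4 a b c c = 0.
Proof. vec_ring. Qed.

(** Lagrange's identity. *)
Lemma cross_norm a b c : dot (cross a b c) (cross a b c) =
  det3 (dot a a) (dot a b) (dot a c) (dot b a) (dot b b) (dot b c)
       (dot c a) (dot c b) (dot c c).
Proof.
rewrite dot_cross det4E !mxE !det4E !mxE !dotE /det3 /GRing.add /GRing.mul /GRing.opp /GRing.one
   /GRing.natmul /= /GRing.zero /=.
ring.
Qed.

Definition orthonormal3 (x y b : 'rV[R]_4) : Prop :=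
  dot x x = 1 /\ dot y y = 1 /\ dot b b = 1 /\ dot x y = 0 /\ dot x b = 0 /\ dot y b = 0.

Lemma cross_orthonormal x y b : orthonormal3 x y b ->
  let l := cross x y b in
  dot l l = 1 /\ dot l x = 0 /\ dot l y = 0 /\ dot l b = 0.
Proof.
move=> [xx [yy [bb [xy [xb yb]]]]] l.
rewrite /l !dot_cross det4_alt13 det4_alt23 det4_alt33 -dot_cross cross_norm.
rewrite (dotC y x) (dotC b x) (dotC b y) xx yy bb xy xb yb; split => //.
by rewrite /det3; ring.
Qed.

(** Parseval's identity: A A^T = 1 implies A^T A = 1 for the matrix of the four
    vectors. *)
Lemma dot_expand x y b l v w : orthonormal3 x y b ->
  dot l l = 1 -> dot l x = 0 -> dot l y = 0 -> dot l b = 0 ->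
  dot v w = dot v x * dot w x + dot v y * dot w y + dot v b * dot w b + dot v l * dot w l.
Proof.
move=> [xx [yy [bb [xy [xb yb]]]]] ll lx ly lb.
pose A : 'M[R]_4 := (\matrix_(i < 4) nth 0 [:: x; y; b; l] i)%V.
have dm (p q : 'rV[R]_4) : dot p q = (p *m q^T)%V ord0 ord0.
  by rewrite mxE /dot; apply: eq_bigr => i _; rewrite !mxE.
have AAT : (A *m A^T = 1%:M)%V.
  apply/matrixP => i j; rewrite mxE.
  have -> : (\sum_(k < 4) A i k * A^T k j)%V = dot (row i A) (row j A).
    by rewrite /dot; apply: eq_bigr => k _; rewrite !mxE.
  rewrite !rowK mxE.
  move: i j; apply: forall_I4; apply: forall_I4 => /=; rewrite ?(dotC y x) ?(dotC x b)
    ?(dotC x l) ?(dotC y b) ?(dotC y l) ?(dotC b l) //; by rewrite ?(dotC b x) ?(dotC b y).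
have ATA := mulmx1C AAT.
rewrite dm -{1}(mulmx1 v) -ATA mulmxA -mulmxA mxE sum_I4.
have E k : (v *m A^T)%V ord0 k = dot v (row k A).
  by rewrite mxE /dot; apply: eq_bigr => i _; rewrite !mxE.
have E' k : (A *m w^T)%V k ord0 = dot w (row k A).
  by rewrite mxE /dot; apply: eq_bigr => i _; rewrite !mxE GRing.mulrC.
by rewrite !E !E' !rowK.
Qed.

(** Against a normal frame most entries of this Gram matrix vanish, which
    relates determinants with two tangent rows to normal components. *)
Lemma det4_mul a b c d a' b' c' d' :
  det4 a b c d * det4 a' b' c' d' =
  det4 (vec4 (fun j => dot a (nth 0 [:: a'; b'; c'; d'] j)%V))
       (vec4 (fun j => dot b (nth 0 [:: a'; b'; c'; d'] j)%V))
       (vec4 (fun j => dot c (nth 0 [:: a'; b'; c'; d'] j)%V))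
       (vec4 (fun j => dot d (nth 0 [:: a'; b'; c'; d'] j)%V)).
Proof.
rewrite /det4.
set A := (\matrix_(i < 4) nth 0 [:: a; b; c; d] i)%V.
set B := (\matrix_(i < 4) nth 0 [:: a'; b'; c'; d'] i)%V.
have -> : determinant A * determinant B = determinant (A *m B^T)%V by rewrite det_mulmx det_tr.
congr (determinant _); apply/matrixP => i j; rewrite mxE.
have -> : (\sum_(k < 4) A i k * B^T k j)%V = dot (row i A) (row j B).
  by rewrite /dot; apply: eq_bigr => k _; rewrite !mxE.
rewrite !rowK mxE.
by move: i; apply: forall_I4; rewrite /= mxE.
Qed.

(** * Normal frames and vector fields *)
Lemma normalize_unit c : 0 < dot c c -> dot (normalize c) (normalize c) = 1.
Proof.
move=> c0; rewrite dot_normalize dotC dot_normalize.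
have s0 := sqrt_lt_R0 _ c0; have ss := sqrt_sqrt _ (Rlt_le _ _ c0).
transitivity (/ sqrt (dot c c) * (/ sqrt (dot c c) * (sqrt (dot c c) * sqrt (dot c c)))).
  by rewrite ss.
by field; lra.
Qed.

(** The vectors p x q x e_i are normal to p and q, and their squared norms sum
    to twice the Gram determinant of p and q; hence one of them is nonzero. *)
Lemma exists_normal (p q : 'rV[R]_4) : 0 < dot p p * dot q q - dot p q ^ 2 ->
  exists n, dot n n = 1 /\ dot n p = 0 /\ dot n q = 0.
Proof.
move=> W0.
have [[i Hi]|H] : (exists i, 0 < dot (cross p q (delta_mx ord0 i)) (cross p q (delta_mx ord0 i))) \/
    ~ (exists i, 0 < dot (cross p q (delta_mx ord0 i)) (cross p q (delta_mx ord0 i))).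
  exact: Classical_Prop.classic.
- set c := cross p q (delta_mx ord0 i) in Hi.
  exists (normalize c); rewrite normalize_unit //; split=> //.
  by rewrite !dot_normalize /c !dot_cross det4_alt13 det4_alt23 !Rmult_0_r.
- have Z i : dot (cross p q (delta_mx ord0 i)) (cross p q (delta_mx ord0 i)) = 0.
    have := dot_ge0 (cross p q (delta_mx ord0 i)).
    by case/Rle_lt_or_eq_dec => // lt; case: H; exists i.
  suff : dot p p * dot q q - dot p q ^ 2 = 0 by lra.
  have := Z i0; have := Z i1; have := Z i2; have := Z i3.
  rewrite !cross_norm !(dotC (delta_mx _ _)).
  have D0 (w : 'rV[R]_4) : dot w (delta_mx ord0 i0) = w ord0 i0 by vec_ring.
  have D1 (w : 'rV[R]_4) : dot w (delta_mx ord0 i1) = w ord0 i1 by vec_ring.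
  have D2 (w : 'rV[R]_4) : dot w (delta_mx ord0 i2) = w ord0 i2 by vec_ring.
  have D3 (w : 'rV[R]_4) : dot w (delta_mx ord0 i3) = w ord0 i3 by vec_ring.
  rewrite !D0 !D1 !D2 !D3.
  rewrite !mxE /det3 /GRing.natmul /= -!R1E => h3 h2 h1 h0.
  have : 2 * (dot p p * dot q q - dot p q ^ 2) = 0; last by lra.
  have := dotE p p; have := dotE q q; have := dotE p q; have := dotC q p.
  set pp := dot p p in h0 h1 h2 h3 *; set qq := dot q q in h0 h1 h2 h3 *.
  set pq := dot p q in h0 h1 h2 h3 *; set qp := dot q p in h0 h1 h2 h3 *.
  move=> e0 e1 e2 e3.
  rewrite e0 in h0 h1 h2 h3.
  transitivity ((pp * qq - pq ^ 2) * 4 - 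
    (pp * (q ord0 i0 * q ord0 i0 + q ord0 i1 * q ord0 i1 + q ord0 i2 * q ord0 i2 + q ord0 i3 * q ord0 i3)
     + qq * (p ord0 i0 * p ord0 i0 + p ord0 i1 * p ord0 i1 + p ord0 i2 * p ord0 i2 + p ord0 i3 * p ord0 i3)
     - 2 * pq * (p ord0 i0 * q ord0 i0 + p ord0 i1 * q ord0 i1 + p ord0 i2 * q ord0 i2 + p ord0 i3 * q ord0 i3))).
    by rewrite -e1 -e2 -e3; ring.
  lra.
Qed.

Lemma normal_frame_exists z u v : 0 < W2 z u v -> exists n1 n2, normal_frame z u v n1 n2.
Proof.
rewrite /W2 /cE /cF /cG /normal_frame.
set p := Du z u v; set q := Dv z u v => W0.
have [n1 [nn [np nq]]] := exists_normal p q W0.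
set c := cross p q n1.
have cc : dot c c = dot p p * dot q q - dot p q ^ 2.
  by rewrite /c cross_norm (dotC p n1) (dotC q n1) (dotC q p) nn np nq /det3; ring.
have c0 : 0 < dot c c by rewrite cc.
have cn : dot c p = 0 /\ dot c q = 0 /\ dot c n1 = 0.
  by rewrite /c !dot_cross det4_alt13 det4_alt23 det4_alt33.
move: cn => [cp [cq cn]].
exists n1, (normalize c); rewrite normalize_unit // (dotC n1 (normalize c)) !dot_normalize.
by rewrite cp cq cn !Rmult_0_r.
Qed.

Definition normal_minor (n1 n2 w1 w2 : 'rV[R]_4) : R := dot w1 n1 * dot w2 n2 - dot w1 n2 * dot w2 n1.

(** The determinant d is the oriented area sqrt W up to sign.  It replaces the
    frame in questions of smoothness, since frames are only given pointwise. *)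
Lemma normal_frame_det z u v n1 n2 : normal_frame z u v n1 n2 ->
  let d := det4 (Du z u v) (Dv z u v) n1 n2 in
  d * d = W2 z u v /\
  forall w1 w2, det4 (Du z u v) (Dv z u v) w1 w2 * d = W2 z u v * normal_minor n1 n2 w1 w2.
Proof.
rewrite /W2 /cE /cF /cG /normal_frame /normal_minor.
set p := Du z u v; set q := Dv z u v => -[n11 [n22 [n12 [n1p [n1q [n2p n2q]]]]]]; set d := det4 p q n1 n2.
have E w1 w2 : det4 p q w1 w2 * d =
    (dot p p * dot q q - dot p q ^ 2) * (dot w1 n1 * dot w2 n2 - dot w1 n2 * dot w2 n1).
  rewrite /d det4_mul det4E !mxE /det3 /= (dotC p n1) (dotC p n2) (dotC q n1) (dotC q n2) (dotC q p).
  by rewrite n1p n2p n1q n2q; ring.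
split; last exact: E.
have := E n1 n2; rewrite -/d => ->; rewrite (dotC n2 n1) n11 n22 n12; ring.
Qed.

Definition vsmooth (D : R * R -> Prop) (A : R -> R -> 'rV[R]_4) : Prop :=
  forall i, smooth_on D (Defs.comp A i).

Lemma comp_Du A i : Defs.comp (Du A) i = du (Defs.comp A i).
Proof. by apply: functional_extensionality => u; apply: functional_extensionality => v; rewrite /Defs.comp mxE. Qed.
Lemma comp_Dv A i : Defs.comp (Dv A) i = dv (Defs.comp A i).
Proof. by apply: functional_extensionality => u; apply: functional_extensionality => v; rewrite /Defs.comp mxE. Qed.

Lemma vsmooth_Du D A : vsmooth D A -> vsmooth D (Du A).
Proof. by move=> H i; rewrite comp_Du; apply: smooth_du. Qed.
Lemma vsmooth_Dv D A : vsmooth D A -> vsmooth D (Dv A).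
Proof. by move=> H i; rewrite comp_Dv; apply: smooth_dv. Qed.

Lemma vec_schwarz D A u v : open D -> vsmooth D A -> D (u, v) ->
  Du (Dv A) u v = Dv (Du A) u v.
Proof.
move=> oD sA Duv; apply: rV4_ext => i.
rewrite -/(Defs.comp (Du (Dv A)) i u v) -/(Defs.comp (Dv (Du A)) i u v).
by rewrite comp_Du !comp_Dv comp_Du; exact: (smooth_schwarz D).
Qed.

Lemma smooth_dot D A B : open D -> vsmooth D A -> vsmooth D B ->
  smooth_on D (fun u v => dot (A u v) (B u v)).
Proof.
move=> oD sA sB.
apply: (smooth_ext D oD (fun u v => Defs.comp A i0 u v * Defs.comp B i0 u v + Defs.comp A i1 u v * Defs.comp B i1 u v
  + Defs.comp A i2 u v * Defs.comp B i2 u v + Defs.comp A i3 u v * Defs.comp B i3 u v)).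
  by move=> u v _; rewrite dotE.
by repeat apply: smooth_plus => //; apply: smooth_mult.
Qed.

Lemma partials_dot D A B : open D -> vsmooth D A -> vsmooth D B ->
  partials_on D (fun u v => dot (A u v) (B u v))
    (fun u v => dot (Du A u v) (B u v) + dot (A u v) (Du B u v))
    (fun u v => dot (Dv A u v) (B u v) + dot (A u v) (Dv B u v)).
Proof.
move=> oD sA sB.
have P i := partials_mult _ _ _ _ _ _ _ (smooth_partials _ _ (sA i)) (smooth_partials _ _ (sB i)).
apply: (partials_ext _ _ _ _ _ _ _ oD (partials_plus _ _ _ _ _ _ _ (partials_plus _ _ _ _ _ _ _ (partials_plus _ _ _ _ _ _ _ (P i0) (P i1)) (P i2)) (P i3))) => u v _.
- by rewrite dotE.
- by rewrite !dotE !mxE /Defs.comp; ring.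
- by rewrite !dotE !mxE /Defs.comp; ring.
Qed.

Lemma du_dot D A B u v : open D -> vsmooth D A -> vsmooth D B -> D (u, v) ->
  du (fun u v => dot (A u v) (B u v)) u v = dot (Du A u v) (B u v) + dot (A u v) (Du B u v).
Proof. by move=> oD sA sB; exact: partials_on_du (partials_dot _ _ _ oD sA sB). Qed.
Lemma dv_dot D A B u v : open D -> vsmooth D A -> vsmooth D B -> D (u, v) ->
  dv (fun u v => dot (A u v) (B u v)) u v = dot (Dv A u v) (B u v) + dot (A u v) (Dv B u v).
Proof. by move=> oD sA sB; exact: partials_on_dv (partials_dot _ _ _ oD sA sB). Qed.

Lemma smooth_det3 D a1 a2 a3 b1 b2 b3 c1 c2 c3 : open D ->
  smooth_on D a1 -> smooth_on D a2 -> smooth_on D a3 -> smooth_on D b1 -> smooth_on D b2 ->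
  smooth_on D b3 -> smooth_on D c1 -> smooth_on D c2 -> smooth_on D c3 ->
  smooth_on D (fun u v => det3 (a1 u v) (a2 u v) (a3 u v) (b1 u v) (b2 u v) (b3 u v)
    (c1 u v) (c2 u v) (c3 u v)).
Proof.
move=> *; rewrite /det3.
by repeat first [apply: smooth_minus => // | apply: smooth_plus => // | apply: smooth_mult => //].
Qed.

Lemma smooth_det4 D A B C E : open D -> vsmooth D A -> vsmooth D B -> vsmooth D C -> vsmooth D E ->
  smooth_on D (fun u v => det4 (A u v) (B u v) (C u v) (E u v)).
Proof.
move=> oD sA sB sC sE.
have H i a1 a2 a3 b1 b2 b3 c1 c2 c3 : smooth_on D (fun u v => Defs.comp A i u v *
   det3 (Defs.comp B a1 u v) (Defs.comp B a2 u v) (Defs.comp B a3 u v) (Defs.comp C b1 u v) (Defs.comp C b2 u v) (Defs.comp C b3 u v)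
    (Defs.comp E c1 u v) (Defs.comp E c2 u v) (Defs.comp E c3 u v)).
  by apply: smooth_mult => //; apply: smooth_det3.
have Hs := smooth_minus _ oD _ _ (smooth_plus _ oD _ _ (smooth_minus _ oD _ _
  (H i0 i1 i2 i3 i1 i2 i3 i1 i2 i3) (H i1 i0 i2 i3 i0 i2 i3 i0 i2 i3))
  (H i2 i0 i1 i3 i0 i1 i3 i0 i1 i3)) (H i3 i0 i1 i2 i0 i1 i2 i0 i1 i2).
by apply: smooth_ext oD _ _ _ Hs => u v _; rewrite det4E.
Qed.

(** * The fundamental forms under reparametrization *)
Section Chain2.
Variables (D U : R * R -> Prop) (f a b : R -> R -> R).
Hypotheses (oD : open D) (oU : open U).
Hypotheses (sf : smooth_on U f) (sa : smooth_on D a) (sb : smooth_on D b).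
Hypothesis sub : forall u v, D (u, v) -> U (a u v, b u v).

Let F (u v : R) : R := f (a u v) (b u v).
Let at_h (g : R -> R -> R) (u v : R) : R := g (a u v) (b u v).

Lemma chain1 : partials_on D F
  (fun u v => at_h (du f) u v * du a u v + at_h (dv f) u v * du b u v)
  (fun u v => at_h (du f) u v * dv a u v + at_h (dv f) u v * dv b u v).
Proof. exact: (smooth_comp_partials D U f a b oU sf sa sb sub). Qed.

Lemma smooth_chain : smooth_on D F.
Proof. exact: (smooth_comp D oD U f a b oU sf sa sb sub). Qed.

Let chain_d g : smooth_on U g -> partials_on D (at_h g)
  (fun u v => at_h (du g) u v * du a u v + at_h (dv g) u v * du b u v)
  (fun u v => at_h (du g) u v * dv a u v + at_h (dv g) u v * dv b u v).
Proof. by move=> sg; exact: (smooth_comp_partials D U g a b oU sg sa sb sub). Qed.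

Lemma chain2_u : partials_on D (du F)
  (fun u v => (at_h (du (du f)) u v * du a u v + at_h (dv (du f)) u v * du b u v) * du a u v
     + at_h (du f) u v * du (du a) u v
     + ((at_h (dv (du f)) u v * du a u v + at_h (dv (dv f)) u v * du b u v) * du b u v
     + at_h (dv f) u v * du (du b) u v))
  (fun u v => (at_h (du (du f)) u v * dv a u v + at_h (dv (du f)) u v * dv b u v) * du a u v
     + at_h (du f) u v * dv (du a) u v
     + ((at_h (dv (du f)) u v * dv a u v + at_h (dv (dv f)) u v * dv b u v) * du b u v
     + at_h (dv f) u v * dv (du b) u v)).
Proof.
have P1 := partials_mult _ _ _ _ _ _ _ (chain_d _ (smooth_du _ _ sf)) (smooth_partials _ _ (smooth_du _ _ sa)).
have P2 := partials_mult _ _ _ _ _ _ _ (chain_d _ (smooth_dv _ _ sf)) (smooth_partials _ _ (smooth_du _ _ sb)).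
have sw u v : D (u, v) -> at_h (du (dv f)) u v = at_h (dv (du f)) u v.
  by move=> /sub Huv; exact: (smooth_schwarz U).
apply: (partials_ext _ _ _ _ _ _ _ oD (partials_plus _ _ _ _ _ _ _ P1 P2)) => u v Duv.
- by rewrite (partials_on_du _ _ _ _ _ _ chain1 Duv).
- by rewrite sw.
- by rewrite sw.
Qed.

Lemma chain2_v : partials_on D (dv F)
  (fun u v => (at_h (du (du f)) u v * du a u v + at_h (dv (du f)) u v * du b u v) * dv a u v
     + at_h (du f) u v * du (dv a) u v
     + ((at_h (dv (du f)) u v * du a u v + at_h (dv (dv f)) u v * du b u v) * dv b u v
     + at_h (dv f) u v * du (dv b) u v))
  (fun u v => (at_h (du (du f)) u v * dv a u v + at_h (dv (du f)) u v * dv b u v) * dv a u v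
     + at_h (du f) u v * dv (dv a) u v
     + ((at_h (dv (du f)) u v * dv a u v + at_h (dv (dv f)) u v * dv b u v) * dv b u v
     + at_h (dv f) u v * dv (dv b) u v)).
Proof.
have P1 := partials_mult _ _ _ _ _ _ _ (chain_d _ (smooth_du _ _ sf)) (smooth_partials _ _ (smooth_dv _ _ sa)).
have P2 := partials_mult _ _ _ _ _ _ _ (chain_d _ (smooth_dv _ _ sf)) (smooth_partials _ _ (smooth_dv _ _ sb)).
have sw u v : D (u, v) -> at_h (du (dv f)) u v = at_h (dv (du f)) u v.
  by move=> /sub Huv; exact: (smooth_schwarz U).
apply: (partials_ext _ _ _ _ _ _ _ oD (partials_plus _ _ _ _ _ _ _ P1 P2)) => u v Duv.
- by rewrite (partials_on_dv _ _ _ _ _ _ chain1 Duv).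
- by rewrite sw.
- by rewrite sw.
Qed.
End Chain2.

Definition hu (h : R * R -> R * R) (u v : R) : R := fst (h (u, v)).
Definition hv (h : R * R -> R * R) (u v : R) : R := snd (h (u, v)).
Definition jac (h : R * R -> R * R) (u v : R) : R :=
  du (hu h) u v * dv (hv h) u v - dv (hu h) u v * du (hv h) u v.

(** The chain rule for the inverse gives two Jacobians of product 1. *)
Lemma diffeo_jac D V h u v : diffeo D V h -> D (u, v) -> jac h u v <> 0.
Proof.
move=> [oD [oV [k [h1 [h2 [k1 [k2 [hk kh]]]]]]]] Duv.
have sub u' v' : D (u', v') -> V (hu h u' v', hv h u' v').
  by move=> /hk []; rewrite /hu /hv; case: (h (u', v')).
have C1 := chain1 D V _ _ _ oV k1 h1 h2 sub.
have C2 := chain1 D V _ _ _ oV k2 h1 h2 sub.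
have I1 u' v' : D (u', v') -> fst (k (hu h u' v', hv h u' v')) = u'.
  by rewrite /hu /hv => /hk []; case: (h (u', v')) => x y /= _ ->.
have I2 u' v' : D (u', v') -> snd (k (hu h u' v', hv h u' v')) = v'.
  by rewrite /hu /hv => /hk []; case: (h (u', v')) => x y /= _ ->.
have Q1 := partials_ext _ _ _ _ (fun u _ => u) _ _ oD C1 I1 (fun _ _ _ => erefl) (fun _ _ _ => erefl).
have Q2 := partials_ext _ _ _ _ (fun _ v => v) _ _ oD C2 I2 (fun _ _ _ => erefl) (fun _ _ _ => erefl).
have [/is_derive_unique e1 /is_derive_unique e2] := Q1 u v Duv.
have [/is_derive_unique e3 /is_derive_unique e4] := Q2 u v Duv.
rewrite Derive_id in e1; rewrite Derive_const in e2.
rewrite Derive_const in e3; rewrite Derive_id in e4.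
rewrite /jac => J0.
set p := du (hu h) u v in e1 e3 J0; set q := dv (hu h) u v in e2 e4 J0.
set r := du (hv h) u v in e1 e3 J0; set t := dv (hv h) u v in e2 e4 J0.
move: e1 e2 e3 e4; rewrite -/(hu h) -/(hv h).
set k11 := du _ _ _; set k12 := dv _ _ _; set k21 := du _ _ _; set k22 := dv _ _ _.
move=> e1 e2 e3 e4.
have : (k11 * k22 - k12 * k21) * (p * t - q * r) = 1.
  transitivity ((k11 * p + k12 * r) * (k21 * q + k22 * t) - (k11 * q + k12 * t) * (k21 * p + k22 * r)).
    ring.
  by rewrite -e1 -e2 -e3 -e4; ring.
rewrite J0; lra.
Qed.

Section Reparam.
Variables (z : R -> R -> 'rV[R]_4) (D U : R * R -> Prop) (h : R * R -> R * R).
Hypotheses (oD : open D) (oU : open U) (sz : vsmooth U z).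
Hypotheses (s1 : smooth_on D (hu h)) (s2 : smooth_on D (hv h)).
Hypothesis sub : forall p, D p -> U (h p).

Let Z := reparam z h.

Let sub' u v : D (u, v) -> U (hu h u v, hv h u v).
Proof. by move=> /sub; rewrite /hu /hv; case: (h (u, v)). Qed.

Lemma reparam_smooth : vsmooth D Z.
Proof. by move=> i; exact: (smooth_chain D U (Defs.comp z i) (hu h) (hv h)). Qed.

Variables (u v : R).
Hypothesis Duv : D (u, v).
Let p := du (hu h) u v.
Let q := du (hv h) u v.
Let r := dv (hu h) u v.
Let t := dv (hv h) u v.
Let x := hu h u v.
Let y := hv h u v.

Lemma reparam_Du : Du Z u v = (p *: Du z x y + q *: Dv z x y)%V.
Proof.
apply: rV4_ext => i; rewrite !mxE.
have C := chain1 D U _ _ _ oU (sz i) s1 s2 sub'.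
rewrite -[Defs.comp Z i]/(fun u v => Defs.comp z i (hu h u v) (hv h u v)).
rewrite (partials_on_du _ _ _ _ _ _ C Duv) /GRing.mul /GRing.add /= -/p -/q -/x -/y; ring.
Qed.

Lemma reparam_Dv : Dv Z u v = (r *: Du z x y + t *: Dv z x y)%V.
Proof.
apply: rV4_ext => i; rewrite !mxE.
have C := chain1 D U _ _ _ oU (sz i) s1 s2 sub'.
rewrite -[Defs.comp Z i]/(fun u v => Defs.comp z i (hu h u v) (hv h u v)).
rewrite (partials_on_dv _ _ _ _ _ _ C Duv) /GRing.mul /GRing.add /= -/r -/t -/x -/y; ring.
Qed.

Lemma compDuu w i x' y' : du (du (Defs.comp w i)) x' y' = zuu w x' y' ord0 i.
Proof. by rewrite /zuu mxE comp_Du. Qed.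
Lemma compDuv w i x' y' : dv (du (Defs.comp w i)) x' y' = zuv w x' y' ord0 i.
Proof. by rewrite /zuv mxE comp_Du. Qed.
Lemma compDvv w i x' y' : dv (dv (Defs.comp w i)) x' y' = zvv w x' y' ord0 i.
Proof. by rewrite /zvv mxE comp_Dv. Qed.
Lemma compDu w i x' y' : du (Defs.comp w i) x' y' = Du w x' y' ord0 i.
Proof. by rewrite mxE. Qed.
Lemma compDv w i x' y' : dv (Defs.comp w i) x' y' = Dv w x' y' ord0 i.
Proof. by rewrite mxE. Qed.

(** The second derivatives of the change of parameters only multiply tangent
    vectors, which a normal vector annihilates. *)
Lemma reparam_second n : dot n (Du z x y) = 0 -> dot n (Dv z x y) = 0 ->
  dot (zuu Z u v) n = p ^ 2 * dot (zuu z x y) n + 2 * p * q * dot (zuv z x y) n + q ^ 2 * dot (zvv z x y) n /\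
  dot (zuv Z u v) n = p * r * dot (zuu z x y) n + (p * t + q * r) * dot (zuv z x y) n + q * t * dot (zvv z x y) n /\
  dot (zvv Z u v) n = r ^ 2 * dot (zuu z x y) n + 2 * r * t * dot (zuv z x y) n + t ^ 2 * dot (zvv z x y) n.
Proof.
move=> nu nv.
have Cu i := chain2_u D U _ _ _ oD oU (sz i) s1 s2 sub'.
have Cv i := chain2_v D U _ _ _ oD oU (sz i) s1 s2 sub'.
have Euu i : zuu Z u v ord0 i = p ^ 2 * zuu z x y ord0 i + 2 * p * q * zuv z x y ord0 i
   + q ^ 2 * zvv z x y ord0 i + du (du (hu h)) u v * Du z x y ord0 i + du (du (hv h)) u v * Dv z x y ord0 i.
  rewrite -compDuu -[Defs.comp Z i]/(fun u v => Defs.comp z i (hu h u v) (hv h u v)).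
  rewrite (partials_on_du _ _ _ _ _ _ (Cu i) Duv) -/p -/q -/x -/y compDuu compDuv compDvv compDu compDv.
  ring.
have Euv i : zuv Z u v ord0 i = p * r * zuu z x y ord0 i + (p * t + q * r) * zuv z x y ord0 i
   + q * t * zvv z x y ord0 i + dv (du (hu h)) u v * Du z x y ord0 i + dv (du (hv h)) u v * Dv z x y ord0 i.
  rewrite -compDuv -[Defs.comp Z i]/(fun u v => Defs.comp z i (hu h u v) (hv h u v)).
  rewrite (partials_on_dv _ _ _ _ _ _ (Cu i) Duv) -/p -/q -/r -/t -/x -/y compDuu compDuv compDvv compDu compDv.
  ring.
have Evv i : zvv Z u v ord0 i = r ^ 2 * zuu z x y ord0 i + 2 * r * t * zuv z x y ord0 i
   + t ^ 2 * zvv z x y ord0 i + dv (dv (hu h)) u v * Du z x y ord0 i + dv (dv (hv h)) u v * Dv z x y ord0 i.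
  rewrite -compDvv -[Defs.comp Z i]/(fun u v => Defs.comp z i (hu h u v) (hv h u v)).
  rewrite (partials_on_dv _ _ _ _ _ _ (Cv i) Duv) -/r -/t -/x -/y compDuu compDuv compDvv compDu compDv.
  ring.
have L (w w1 w2 w3 : 'rV[R]_4) c1 c2 c3 c4 c5 :
  (forall i, w ord0 i = c1 * w1 ord0 i + c2 * w2 ord0 i + c3 * w3 ord0 i + c4 * Du z x y ord0 i + c5 * Dv z x y ord0 i) ->
  dot w n = c1 * dot w1 n + c2 * dot w2 n + c3 * dot w3 n.
  move=> H; transitivity (c1 * dot w1 n + c2 * dot w2 n + c3 * dot w3 n + c4 * dot n (Du z x y) + c5 * dot n (Dv z x y)).
    by rewrite !dotE !H; ring.
  by rewrite nu nv; ring.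
by split; [exact: L Euu | split; [exact: L Euv | exact: L Evv]].
Qed.

Lemma reparam_E : cE Z u v = p ^ 2 * cE z x y + 2 * p * q * cF z x y + q ^ 2 * cG z x y.
Proof. by rewrite /cE /cF /cG reparam_Du !(dotDl, dotDr, dotZl, dotZr) (dotC (Dv z x y) (Du z x y)); ring. Qed.
Lemma reparam_F : cF Z u v = p * r * cE z x y + (p * t + q * r) * cF z x y + q * t * cG z x y.
Proof. by rewrite /cE /cF /cG reparam_Du reparam_Dv !(dotDl, dotDr, dotZl, dotZr) (dotC (Dv z x y) (Du z x y)); ring. Qed.
Lemma reparam_G : cG Z u v = r ^ 2 * cE z x y + 2 * r * t * cF z x y + t ^ 2 * cG z x y.
Proof. by rewrite /cE /cF /cG reparam_Dv !(dotDl, dotDr, dotZl, dotZr) (dotC (Dv z x y) (Du z x y)); ring. Qed.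
Lemma reparam_W : W2 Z u v = jac h u v ^ 2 * W2 z x y.
Proof. by rewrite /W2 reparam_E reparam_F reparam_G /jac -/p -/q -/r -/t; ring. Qed.

Hypothesis J0 : jac h u v <> 0.

Lemma reparam_frame n1 n2 : normal_frame Z u v n1 n2 -> normal_frame z x y n1 n2.
Proof.
have J1 : p * t - r * q <> 0 by exact: J0.
have K n : dot n (Du Z u v) = 0 -> dot n (Dv Z u v) = 0 -> dot n (Du z x y) = 0 /\ dot n (Dv z x y) = 0.
  rewrite reparam_Du reparam_Dv !dotDr !dotZr.
  set A := dot n (Du z x y); set B := dot n (Dv z x y) => e1 e2.
  split; apply: (Rmult_eq_reg_l (p * t - r * q)) => //; rewrite Rmult_0_r.
  - transitivity (t * (p * A + q * B) - q * (r * A + t * B)); [ring | rewrite e1 e2; ring].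
  - transitivity (p * (r * A + t * B) - r * (p * A + q * B)); [ring | rewrite e1 e2; ring].
move=> [n11 [n22 [n12 [n1p [n1q [n2p n2q]]]]]].
by have [a1 a2] := K n1 n1p n1q; have [a3 a4] := K n2 n2p n2q.
Qed.

(** L, M, N come from the Jacobian of two quadratic forms, which is multiplied
    by jac h, divided by sqrt W, which is multiplied by |jac h|: they transform
    like a quadratic form up to the sign s of jac h. *)
Lemma reparam_LMN n1 n2 : normal_frame Z u v n1 n2 -> 0 < W2 z x y ->
  exists s, s ^ 2 = 1 /\
  cL Z n1 n2 u v = s * (p ^ 2 * cL z n1 n2 x y + 2 * p * q * cM z n1 n2 x y + q ^ 2 * cN z n1 n2 x y) /\
  cM Z n1 n2 u v = s * (p * r * cL z n1 n2 x y + (p * t + q * r) * cM z n1 n2 x y + q * t * cN z n1 n2 x y) /\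
  cN Z n1 n2 u v = s * (r ^ 2 * cL z n1 n2 x y + 2 * r * t * cM z n1 n2 x y + t ^ 2 * cN z n1 n2 x y).
Proof.
move=> /reparam_frame [_ [_ [_ [n1p [n1q [n2p n2q]]]]]] W0.
have [a1 [a2 a3]] := reparam_second n1 n1p n1q.
have [b1 [b2 b3]] := reparam_second n2 n2p n2q.
have sW := sqrt_lt_R0 _ W0.
have JA := Rabs_pos_lt _ J0.
have EW : sqrt (W2 Z u v) = Rabs (jac h u v) * sqrt (W2 z x y).
  by rewrite reparam_W sqrt_mult ?pow2_abs; [rewrite -(pow2_abs (jac h u v)) sqrt_pow2 //; lra | nra | lra].
exists (jac h u v / Rabs (jac h u v)).
have EJ : jac h u v = p * t - r * q by [].
split.
  transitivity (jac h u v ^ 2 / Rabs (jac h u v) ^ 2); first by field; lra.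
  by rewrite pow2_abs; field.
rewrite /cL /cM /cN EW a1 a2 a3 b1 b2 b3.
move: JA; set aJ := Rabs _ => JA; rewrite EJ.
by split; [|split]; field; lra.
Qed.

End Reparam.

(** * Principal directions *)
Definition disc (E F G L M N : R) : R :=
  (E * N - 2 * F * M + G * L) ^ 2 - 4 * (E * G - F ^ 2) * (L * N - M ^ 2).

(** The right-hand side is the discriminant of the quadratic equation for the
    directions that are conjugate for both forms. *)
Lemma disc_direction E F G L M N : disc E F G L M N =
  (E * N - G * L) ^ 2 - 4 * (E * M - F * L) * (F * N - G * M).
Proof. by rewrite /disc; ring. Qed.

Lemma kappa_disc z n1 n2 u v : 0 < W2 z u v ->
  inv_kappa z n1 n2 u v ^ 2 - inv_k z n1 n2 u v =
  disc (cE z u v) (cF z u v) (cG z u v) (cL z n1 n2 u v) (cM z n1 n2 u v) (cN z n1 n2 u v)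
   / (4 * W2 z u v ^ 2).
Proof.
move=> W0; rewrite /inv_kappa /inv_k /disc -/(W2 z u v).
set L := cL _ _ _ _ _; set M := cM _ _ _ _ _; set N := cN _ _ _ _ _; set W := W2 z u v in W0 *.
by field; lra.
Qed.

Lemma surface_reparam z U D V h : surface z U -> (forall p, V p -> U p) -> diffeo D V h ->
  surface (reparam z h) D.
Proof.
move=> [oU [sz W0]] sub dh; have [oD [oV [k [h1 [h2 [_ [_ [hk _]]]]]]]] := dh.
have sub' p : D p -> U (h p) by move=> /hk [/sub].
split=> //; split; first exact: (reparam_smooth z D U h).
move=> u v Duv; rewrite (reparam_W z D U h) //.
apply: Rmult_lt_0_compat; last by apply: W0; have := sub' _ Duv; rewrite /hu /hv; case: (h (u, v)).
have := diffeo_jac _ _ _ _ _ dh Duv; nra.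
Qed.

(** The discriminant is multiplied by the fourth power of the Jacobian. *)
Lemma free_reparam z U D V h : surface z U -> (forall p, V p -> U p) -> diffeo D V h ->
  free_of_minimal_points z U -> free_of_minimal_points (reparam z h) D.
Proof.
move=> sS sub dh fm u v n1 n2 Duv nf.
have [_ [_ W1]] := surface_reparam _ _ _ _ _ sS sub dh.
have {}W1 := W1 u v Duv.
have [oU [sz W0]] := sS; have [oD [oV [k [h1 [h2 [_ [_ [hk _]]]]]]]] := dh.
have sub' p : D p -> U (h p) by move=> /hk [/sub].
have J0 := diffeo_jac _ _ _ _ _ dh Duv.
have Uxy : U (hu h u v, hv h u v) by have := sub' _ Duv; rewrite /hu /hv; case: (h (u, v)).
have {}W0 := W0 _ _ Uxy.
have nf' := reparam_frame z D U h oU sz h1 h2 sub' u v Duv J0 n1 n2 nf.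
have [s [s2 [eL [eM eN]]]] := reparam_LMN z D U h oD oU sz h1 h2 sub' u v Duv J0 n1 n2 nf W0.
have := fm _ _ n1 n2 Uxy nf'; rewrite !kappa_disc // eL eM eN.
rewrite (reparam_E z D U h) // (reparam_F z D U h) // (reparam_G z D U h) //.
set E := cE z _ _; set F := cF z _ _; set G := cG z _ _.
set L := cL z _ _ _ _; set M := cM z _ _ _ _; set N := cN z _ _ _ _.
move=> d0; apply: Rdiv_lt_0_compat; last by nra.
have {}d0 : 0 < disc E F G L M N.
  have w4 : 0 < 4 * W2 z (hu h u v) (hv h u v) ^ 2 by nra.
  apply: (Rmult_lt_reg_r (/ (4 * W2 z (hu h u v) (hv h u v) ^ 2))); first exact: Rinv_0_lt_compat.
  by rewrite Rmult_0_l; exact: d0.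
have -> : forall p q r t, disc (p ^ 2 * E + 2 * p * q * F + q ^ 2 * G)
   (p * r * E + (p * t + q * r) * F + q * t * G) (r ^ 2 * E + 2 * r * t * F + t ^ 2 * G)
   (s * (p ^ 2 * L + 2 * p * q * M + q ^ 2 * N)) (s * (p * r * L + (p * t + q * r) * M + q * t * N))
   (s * (r ^ 2 * L + 2 * r * t * M + t ^ 2 * N)) = s ^ 2 * ((p * t - r * q) ^ 2) ^ 2 * disc E F G L M N.
  by move=> p q r t; rewrite /disc; ring.
rewrite s2 Rmult_1_l; apply: Rmult_lt_0_compat => //.
rewrite -/(jac h u v); have : 0 < jac h u v ^ 2 by nra.
by move=> ?; nra.
Qed.

(** Multiples of L, M, N by a common factor, expressed without a normal frame;
    principal directions only depend on the ratios. *)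
Definition tL (z : R -> R -> 'rV[R]_4) u v := det4 (Du z u v) (Dv z u v) (zuu z u v) (zuv z u v).
Definition tM (z : R -> R -> 'rV[R]_4) u v := / 2 * det4 (Du z u v) (Dv z u v) (zuu z u v) (zvv z u v).
Definition tN (z : R -> R -> 'rV[R]_4) u v := det4 (Du z u v) (Dv z u v) (zuv z u v) (zvv z u v).

Lemma LMN_proportional z u v n1 n2 : 0 < W2 z u v -> normal_frame z u v n1 n2 ->
  exists k, k <> 0 /\ cL z n1 n2 u v = k * tL z u v /\ cM z n1 n2 u v = k * tM z u v /\
    cN z n1 n2 u v = k * tN z u v.
Proof.
move=> W0 nf; have [dd H] := normal_frame_det _ _ _ _ _ nf.
set d := det4 _ _ _ _ in dd H.
have d0 : d <> 0 by move=> d0; rewrite d0 in dd; lra.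
have sW := sqrt_lt_R0 _ W0.
have E w1 w2 : normal_minor n1 n2 w1 w2 = det4 (Du z u v) (Dv z u v) w1 w2 / d.
  apply: (Rmult_eq_reg_l (W2 z u v)); last lra.
  by rewrite -H -dd; field.
exists (2 / sqrt (W2 z u v) / d); split; last split; last split.
- rewrite /Rdiv; apply: Rmult_integral_contrapositive_currified; last exact: Rinv_neq_0_compat.
  by apply: Rmult_integral_contrapositive_currified; [lra | apply: Rinv_neq_0_compat; lra].
- by rewrite /cL -/(normal_minor n1 n2 (zuu z u v) (zuv z u v)) E /tL; field; lra.
- by rewrite /cM -/(normal_minor n1 n2 (zuu z u v) (zvv z u v)) E /tM; field; lra.
- by rewrite /cN -/(normal_minor n1 n2 (zuv z u v) (zvv z u v)) E /tN; field; lra.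
Qed.

Lemma disc_tilde_pos z U u v : surface z U -> free_of_minimal_points z U -> U (u, v) ->
  0 < disc (cE z u v) (cF z u v) (cG z u v) (tL z u v) (tM z u v) (tN z u v).
Proof.
move=> [oU [sz W0]] fm Uuv; have {}W0 := W0 u v Uuv.
have [n1 [n2 nf]] := normal_frame_exists z u v W0.
have [k [k0 [eL [eM eN]]]] := LMN_proportional z u v n1 n2 W0 nf.
have := fm u v n1 n2 Uuv nf; rewrite kappa_disc // eL eM eN.
set E := cE z _ _; set F := cF z _ _; set G := cG z _ _.
have -> : disc E F G (k * tL z u v) (k * tM z u v) (k * tN z u v) =
  k ^ 2 * disc E F G (tL z u v) (tM z u v) (tN z u v) by rewrite /disc; ring.
move=> H; have W4 : 0 < 4 * W2 z u v ^ 2 by nra.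
have k2 : 0 < k ^ 2 by nra.
have {}H : 0 < k ^ 2 * disc E F G (tL z u v) (tM z u v) (tN z u v).
  apply: (Rmult_lt_reg_r (/ (4 * W2 z u v ^ 2))); first exact: Rinv_0_lt_compat.
  by rewrite Rmult_0_l; exact: H.
by apply: (Rmult_lt_reg_l (k ^ 2)) => //; rewrite Rmult_0_r.
Qed.

Section SmoothForms.
Variables (z : R -> R -> 'rV[R]_4) (U : R * R -> Prop).
Hypothesis (oU : open U) (sz : vsmooth U z).
Let su := vsmooth_Du U z sz.
Let sv := vsmooth_Dv U z sz.
Let suu := vsmooth_Du U _ su.
Let suv := vsmooth_Dv U _ su.
Let svv := vsmooth_Dv U _ sv.
Lemma smooth_cE : smooth_on U (cE z).
Proof. exact: smooth_dot. Qed.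
Lemma smooth_cF : smooth_on U (cF z).
Proof. exact: smooth_dot. Qed.
Lemma smooth_cG : smooth_on U (cG z).
Proof. exact: smooth_dot. Qed.
Lemma smooth_tL : smooth_on U (tL z).
Proof. exact: smooth_det4. Qed.
Lemma smooth_tM : smooth_on U (tM z).
Proof. by apply: smooth_mult => //; [exact: smooth_const | exact: smooth_det4]. Qed.
Lemma smooth_tN : smooth_on U (tN z).
Proof. exact: smooth_det4. Qed.
End SmoothForms.

Lemma cE_pos z u v : 0 < W2 z u v -> 0 < cE z u v.
Proof.
rewrite /W2 => W0; have := dot_ge0 (Du z u v); rewrite -/(cE z u v) => h.
case: (Rle_lt_or_eq_dec _ _ h) => // e; rewrite -e in W0; nra.
Qed.

Lemma cG_pos z u v : 0 < W2 z u v -> 0 < cG z u v.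
Proof.
rewrite /W2 => W0; have := dot_ge0 (Dv z u v); rewrite -/(cG z u v) => h.
case: (Rle_lt_or_eq_dec _ _ h) => // e; rewrite -e in W0; nra.
Qed.

Lemma locally_lt_open (U : R * R -> Prop) f : open U -> smooth_on U f ->
  open (fun p => U p /\ 0 < f (fst p) (snd p)).
Proof.
move=> oU sf; apply: locally_2d_open => u v [/= Uuv f0].
have [d Hd] := smooth_cont _ _ _ _ sf Uuv (mkposreal _ f0).
have [d' Hd'] := open_locally_2d U u v oU Uuv.
have pd : 0 < Rmin d d' by apply: Rmin_pos; exact: cond_pos.
exists (mkposreal _ pd) => /= x y hx hy; split.
- by apply: Hd'; [apply: Rlt_le_trans hx _ | apply: Rlt_le_trans hy _]; exact: Rmin_r.
- have /= := Hd x y (Rlt_le_trans _ _ _ hx (Rmin_l _ _)) (Rlt_le_trans _ _ _ hy (Rmin_l _ _)).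
  by move=> /Rabs_def2; lra.
Qed.

(** Roots of A + B m + C m^2 are written as -2 e A / (e B + sqrt Delta) with
    e = 1 or -1.  Unlike the usual formula this allows C = 0, and one choice of
    the sign keeps the denominator positive near the given point. *)
Lemma principal_direction z U p : surface z U -> free_of_minimal_points z U -> U p ->
  exists (O : R * R -> Prop) (m : R -> R -> R),
    open O /\ O p /\ (forall q, O q -> U q) /\ smooth_on O m /\
    forall u v n1 n2, O (u, v) -> normal_frame z u v n1 n2 ->
      (cE z u v * cM z n1 n2 u v - cF z u v * cL z n1 n2 u v)
      + (cE z u v * cN z n1 n2 u v - cG z u v * cL z n1 n2 u v) * m u v
      + (cF z u v * cN z n1 n2 u v - cG z u v * cM z n1 n2 u v) * m u v ^ 2 = 0.
Proof.
move=> sS fm; have [oU [sz W0]] := sS; case: p => u0 v0 U0.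
pose A u v := cE z u v * tM z u v - cF z u v * tL z u v.
pose B u v := cE z u v * tN z u v - cG z u v * tL z u v.
pose C u v := cF z u v * tN z u v - cG z u v * tM z u v.
have sE := smooth_cE z U oU sz; have sF := smooth_cF z U oU sz; have sG := smooth_cG z U oU sz.
have sL := smooth_tL z U oU sz; have sM := smooth_tM z U oU sz; have sN := smooth_tN z U oU sz.
have sA : smooth_on U A by apply: smooth_minus => //; apply: smooth_mult.
have sB : smooth_on U B by apply: smooth_minus => //; apply: smooth_mult.
pose Dl u v := disc (cE z u v) (cF z u v) (cG z u v) (tL z u v) (tM z u v) (tN z u v).
have Dpos u v : U (u, v) -> 0 < Dl u v by exact: disc_tilde_pos.
have DE u v : Dl u v = B u v ^ 2 - 4 * A u v * C u v by rewrite /Dl disc_direction.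
have sC : smooth_on U C by apply: smooth_minus => //; apply: smooth_mult.
have sD : smooth_on U Dl.
  apply: (smooth_ext U oU (fun u v => B u v ^ 2 - 4 * A u v * C u v)); first by move=> u v _; rewrite DE.
  apply: smooth_minus => //; first by apply: smooth_pow.
  by apply: smooth_mult => //; apply: smooth_mult => //; exact: smooth_const.
pose sq u v := sqrt (Dl u v).
have ssq : smooth_on U sq by apply: smooth_sqrt.
have sqpos u v : U (u, v) -> 0 < sq u v by move=> /Dpos; exact: sqrt_lt_R0.
have sq2 u v : U (u, v) -> sq u v ^ 2 = Dl u v by move=> /Dpos h; rewrite /sq pow2_sqrt //; lra.
have [e [e2 Q0]] : exists e, e ^ 2 = 1 /\ 0 < e * B u0 v0 + sq u0 v0.
  case: (Rle_dec 0 (B u0 v0)) => h; [exists 1 | exists (-1)];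
    have := sqpos _ _ U0; split; lra.
pose Q u v := e * B u v + sq u v.
have sQ : smooth_on U Q.
  by apply: smooth_plus => //; apply: smooth_mult => //; exact: smooth_const.
exists (fun q => U q /\ 0 < Q (fst q) (snd q)), (fun u v => - (2 * e * A u v) * / Q u v).
have oO := locally_lt_open U Q oU sQ.
split=> //; split=> //; split; first by move=> q [].
split.
  apply: smooth_mult => //.
    apply: smooth_opp => //; apply: smooth_mult => //; first exact: smooth_const.
    by apply: smooth_sub sA => q [].
  apply: smooth_inv => //; first by apply: smooth_sub sQ => q [].
  by move=> u v [_ /=]; lra.
move=> u v n1 n2 [Uuv /= Qp] nf.
have [k [k0 [-> [-> ->]]]] := LMN_proportional z u v n1 n2 (W0 u v Uuv) nf.
transitivity (k * (A u v + B u v * (- (2 * e * A u v) * / Q u v) + C u v * (- (2 * e * A u v) * / Q u v) ^ 2)).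
  by rewrite /A /B /C; ring.
have -> : A u v + B u v * (- (2 * e * A u v) * / Q u v) + C u v * (- (2 * e * A u v) * / Q u v) ^ 2 =
  A u v / Q u v ^ 2 * (Q u v ^ 2 - 2 * e * B u v * Q u v + e ^ 2 * (4 * A u v * C u v)).
  by field; lra.
have -> : Q u v ^ 2 - 2 * e * B u v * Q u v + e ^ 2 * (4 * A u v * C u v) = 0.
  have := sq2 u v Uuv; rewrite DE => h.
  have -> : Q u v ^ 2 - 2 * e * B u v * Q u v = sq u v ^ 2 - e ^ 2 * B u v ^ 2 by rewrite /Q; ring.
  by rewrite h e2; ring.
ring.
Qed.

(** * Principal parameters *)
Lemma box_conv x0 a y0 b x s s' t : box x0 a y0 b (x, s) -> box x0 a y0 b (x, s') ->
  s <= t <= s' -> box x0 a y0 b (x, t).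
Proof.
move=> [/= h1 h2] [/= _ h3] Ht; split=> //=.
by move: h2 h3; case_minmax.
Qed.

Lemma box_center x0 a y0 b : 0 < a -> 0 < b -> box x0 a y0 b (x0, y0).
Proof. by move=> a0 b0; split; rewrite /= Rminus_diag Rabs_R0. Qed.

(** The parameters are time and initial value, so the lines of constant second
    parameter are the integral curves of the direction field (1, m). *)
Lemma straighten (O : R * R -> Prop) m x0 y0 : open O -> O (x0, y0) -> smooth_on O m ->
  exists (Y : R -> R -> R) (a b : R) (V : R * R -> Prop), 0 < a /\ 0 < b /\
  diffeo (box x0 a y0 b) V (fun p => (fst p, Y (fst p) (snd p))) /\
  (forall q, V q -> O q) /\ Y x0 y0 = y0 /\
  (forall x s, box x0 a y0 b (x, s) -> du Y x s = m x (Y x s) /\ 0 < dv Y x s).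
Proof.
move=> oO O0 sm; have [Y [a [b [a0 [b0 [sY [H init]]]]]]] := local_flow O m x0 y0 oO O0 sm.
exists Y, a, b, (tri_image (box x0 a y0 b) Y); do 2 split => //.
split.
  apply: triangular_diffeo => //; first exact: open_box.
  - by move=> x s s' t; exact: box_conv.
  - by move=> x s /H [_ []].
split; first by move=> [x y] [s [/= /H [HO _] <-]].
by split=> // x s /H [].
Qed.

(** After one principal direction has become the first coordinate direction,
    E M = F L.  The field (-F/E, 1) is then orthogonal to it, and by this
    relation also conjugate for the second form.  Straightening this field,
    with the roles of the variables exchanged, keeps the lines of constant
    second variable and produces F = M = 0. *)
Lemma principal_coordinates z U p : surface z U -> free_of_minimal_points z U -> U p ->
  exists (x0 a y0 b : R) (V : R * R -> Prop) (h : R * R -> R * R), 0 < a /\ 0 < b /\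
  diffeo (box x0 a y0 b) V h /\ (forall q, V q -> U q) /\ h (x0, y0) = p /\
  principal (reparam z h) (box x0 a y0 b).
Proof.
move=> sS fm Up; have [oU [sz W0]] := sS.
have [O [m [oO [Op [OU [sm Hm]]]]]] := principal_direction z U p sS fm Up.
case: p Up Op => px py Up Op.
have [Y [a [b [V1 [a0 [b0 [d1 [V1O [Y0 HY]]]]]]]]] := straighten O m px py oO Op sm.
set D1 := box px a py b in d1 HY.
set A1 := (fun p : R * R => (fst p, Y (fst p) (snd p))) in d1.
have V1U q : V1 q -> U q by move=> /V1O /OU.
have oD1 : open D1 := open_box _ _ _ _.
pose z1 := reparam z A1.
have sS1 : surface z1 D1 by exact: (surface_reparam z U D1 V1 A1).
have [_ [sz1 W1]] := sS1.
have [_ [_ [k1 [s1 [s2 [_ [_ [hk1 _]]]]]]]] := d1.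
have sub1 q : D1 q -> U (A1 q) by move=> /hk1 [/V1U].
have P1 x s : D1 (x, s) -> du (hu A1) x s = 1 /\ dv (hu A1) x s = 0 /\
    du (hv A1) x s = m x (Y x s) /\ 0 < dv (hv A1) x s.
  by move=> /HY [h1 h2]; split; [exact: Derive_id | split => //; exact: Derive_const].
have E1M1 x s n1 n2 : D1 (x, s) -> normal_frame z1 x s n1 n2 ->
    cE z1 x s * cM z1 n1 n2 x s = cF z1 x s * cL z1 n1 n2 x s.
  move=> Dxs nf; have J0 := diffeo_jac _ _ _ _ _ d1 Dxs.
  have UA : U (hu A1 x s, hv A1 x s) by exact: (sub1 (x, s)).
  have OA : O (hu A1 x s, hv A1 x s) by apply: V1O; have [] := hk1 (x, s) Dxs.
  have nf' := reparam_frame z D1 U A1 oU sz s1 s2 sub1 x s Dxs J0 n1 n2 nf.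
  have [e [e2 [eL [eM _]]]] := reparam_LMN z D1 U A1 oD1 oU sz s1 s2 sub1 x s Dxs J0 n1 n2 nf (W0 _ _ UA).
  rewrite (reparam_E z D1 U A1) // (reparam_F z D1 U A1) // eL eM.
  have [-> [-> [-> _]]] := P1 x s Dxs.
  have := Hm _ _ n1 n2 OA nf'; rewrite [hu A1 x s]/= [hv A1 x s]/= => Hz.
  apply: Rminus_diag_uniq.
  set E := cE z _ _ in Hz *; set F := cF z _ _ in Hz *; set G := cG z _ _ in Hz *.
  set L := cL z _ _ _ _ in Hz *; set M := cM z _ _ _ _ in Hz *; set N := cN z _ _ _ _ in Hz *.
  rewrite /hu /hv /= in Hz *.
  set mm := m x (Y x s) in Hz *; set t := dv _ _ _.
  transitivity (e * t * ((E * M - F * L) + (E * N - G * L) * mm + (F * N - G * M) * mm ^ 2)); first by ring.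
  by rewrite Hz; ring.
pose O2 (q : R * R) := D1 (snd q, fst q).
have dsw := diffeo_swap D1 oD1; rewrite -/O2 in dsw.
have [oO2 _] := dsw.
(* the slope of the orthogonal field, with the second variable as time *)
pose n (t x : R) := - cF z1 x t * / cE z1 x t.
have sn : smooth_on O2 n.
  have sE1 : smooth_on O2 (fun t x => cE z1 x t).
    apply: (smooth_comp O2 oO2 D1 (cE z1) (fun _ x => x) (fun t _ => t)) => //;
      [exact: smooth_cE | exact: smooth_snd | exact: smooth_fst].
  have sF1 : smooth_on O2 (fun t x => cF z1 x t).
    apply: (smooth_comp O2 oO2 D1 (cF z1) (fun _ x => x) (fun t _ => t)) => //;
      [exact: smooth_cF | exact: smooth_snd | exact: smooth_fst].
  apply: smooth_mult => //; first exact: smooth_opp.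
  by apply: smooth_inv => // t x Otx; have := cE_pos _ _ _ (W1 x t Otx); lra.
have O2p : O2 (py, px) by exact: box_center.
have [X [a2 [b2 [V2 [a20 [b20 [d2 [V2O [X0 HX]]]]]]]]] := straighten O2 n py px oO2 O2p sn.
set D2 := box py a2 px b2 in d2 HX.
set A2 := (fun p : R * R => (fst p, X (fst p) (snd p))) in d2.
have [oD2 [oV2 _]] := d2.
have [V2' [d3 V2D]] := diffeo_restrict _ _ V2 _ dsw oV2 V2O.
have [_ [oV2' _]] := d3.
have [V3 [d4 V3V1]] := diffeo_restrict _ _ V2' _ d1 oV2' V2D.
have d5 := diffeo_comp _ _ _ _ _ d2 d3; have d6 := diffeo_comp _ _ _ _ _ d5 d4.
exists py, a2, px, b2, V3, (fun p => A1 (snd (A2 p), fst (A2 p))).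
split=> //; split=> //; split=> //.
split; first by move=> q /V3V1 /V1U.
split; first by rewrite /A1 /A2 /= X0 Y0.
set g := (fun p : R * R => (snd (A2 p), fst (A2 p))) in d5.
have -> : reparam z (fun p => A1 (snd (A2 p), fst (A2 p))) = reparam z1 g by [].
have [_ [_ [k5 [t1 [t2 [_ [_ [hk5 _]]]]]]]] := d5.
have sub2 q : D2 q -> D1 (g q) by move=> /hk5 [/V2D].
move=> u v Duv.
have [Xu Xv] := HX u v Duv.
have D1X : D1 (hu g u v, hv g u v) by exact: (sub2 (u, v)).
have W1X := W1 _ _ D1X; have E1X := cE_pos _ _ _ W1X.
have pu : du (hu g) u v = - cF z1 (hu g u v) (hv g u v) * / cE z1 (hu g u v) (hv g u v) by exact: Xu.
have pv : du (hv g) u v = 1 by exact: Derive_id.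
have pt : dv (hv g) u v = 0 by exact: Derive_const.
split.
  rewrite (reparam_F z1 D2 D1 g) // pu pv pt.
  by field; lra.
move=> n1 n2 nf.
have J0 := diffeo_jac _ _ _ _ _ d5 Duv.
have nf' := reparam_frame z1 D2 D1 g oD1 sz1 t1 t2 sub2 u v Duv J0 n1 n2 nf.
have [e [_ [_ [-> _]]]] := reparam_LMN z1 D2 D1 g oD2 oD1 sz1 t1 t2 sub2 u v Duv J0 n1 n2 nf W1X.
have := E1M1 _ _ n1 n2 D1X nf'; rewrite pu pv pt.
set E := cE z1 _ _ in E1X *; set F := cF z1 _ _; set L := cL z1 _ _ _ _; set M := cM z1 _ _ _ _ => EM.
set r := dv (hu g) u v.
transitivity (e * r / E * (E * M - F * L)); first by field; lra.
by rewrite EM; ring.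
Qed.

(** * The Codazzi equations *)

(** Cramer's rule: the four polynomials in the proof are the cofactors of the
    column of X in the matrix of the system, whose determinant is -Th. *)
Lemma codazzi_solve (l m a b lu lv mu mv av bu e g X Y P Q : R) :
  let Th := 4 * (l ^ 2 + m ^ 2) ^ 2 + (l ^ 2 - 2 * m ^ 2 - a * b) * (a - b) ^ 2
    - 4 * l ^ 2 * a * b in
  e <> 0 -> Th <> 0 ->
  (a - b) * X - 2 * l * Y + m * (g * P) = g * lu - e * av ->
  - 2 * l * X + (b - a) * Y + m * (e * Q) = e * lv - g * bu ->
  - 2 * m * Y - l * (g * P) + a * (e * Q) = g * mu ->
  - 2 * m * X + b * (g * P) - l * (e * Q) = e * mv ->
  X / e =
  - (1 / Th) * (/ 2 * (2 * (l ^ 2 + m ^ 2) * (2 * l * lv + 2 * m * mv)) - (2 * l * lv) * a * b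
     + 2 * m ^ 2 * b * av + (l ^ 2 * av - / 2 * (2 * m * mv) * a - / 2 * (2 * a * av) * b) * (a - b))
  + 1 / Th * (lu * (l ^ 2 - a * b) * (a - b) + 2 * lu * m ^ 2 * b + 2 * l ^ 3 * bu
     + / 2 * l * (2 * m * mu) * (a - 3 * b) + 2 * l * m ^ 2 * bu - l * a * (2 * b * bu)) * (g / e).
Proof.
move=> Th e0 Th0 h1 h2 h3 h4.
have H : Th * X = - (((b - a) * (l ^ 2 - a * b) - 2 * m ^ 2 * b) * (g * lu - e * av)
  + (2 * l * (l ^ 2 - a * b) + 2 * l * m ^ 2) * (e * lv - g * bu)
  + l * m * (3 * b - a) * (g * mu)
  + (2 * l ^ 2 * m + m * (a * (b - a) + 2 * m ^ 2)) * (e * mv)).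
  by rewrite -h1 -h2 -h3 -h4 /Th; ring.
have -> : X = Th * X / Th by field.
by rewrite H; field.
Qed.

(** The hypotheses are the equalities of mixed third derivatives, with all
    scalar products expanded in the frame x, y, b, l. *)
Lemma codazzi_simplify (e g eu ev gu gv l lu lv m mu mv a av b bu B1 B2 : R) :
  0 < e -> 0 < g ->
  (ev * e * a + e * ev * a + e * e * av) - (eu * g * l + e * gu * l + e * g * lu) =
    (eu * - (g * l) + - (e * ev / g) * - (g * b) + e * e * a * 0 + 0 * B2)
    - (ev * - (e * a) + gu * - (e * l) + e * g * l * 0 + e * g * m * B1) ->
  (gu * g * b + g * gu * b + g * g * bu) - (ev * g * l + e * gv * l + e * g * lv) =
    (- (g * gu / e) * - (e * a) + gv * - (e * l) + g * g * b * 0 + 0 * B1)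
    - (ev * - (g * l) + gu * - (g * b) + e * g * l * 0 + e * g * m * B2) ->
  0 - (eu * g * m + e * gu * m + e * g * mu) =
    (eu * - (g * m) + - (e * ev / g) * 0 + e * e * a * - B2 + 0 * 0)
    - (ev * 0 + gu * - (e * m) + e * g * l * - B1 + e * g * m * 0) ->
  0 - (ev * g * m + e * gv * m + e * g * mv) =
    (- (g * gu / e) * 0 + gv * - (e * m) + g * g * b * - B1 + 0 * 0)
    - (ev * - (g * m) + gu * 0 + e * g * l * - B2 + e * g * m * 0) ->
  (a - b) * ev - 2 * l * gu + m * (g * B1) = g * lu - e * av /\
  - 2 * l * ev + (b - a) * gu + m * (e * B2) = e * lv - g * bu /\
  - 2 * m * gu - l * (g * B1) + a * (e * B2) = g * mu /\
  - 2 * m * ev + b * (g * B1) - l * (e * B2) = e * mv.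
Proof.
move=> e0 g0 q1 q2 q3 q4.
have R x y (k : R) : 0 < k -> k * x = k * y -> x = y.
  by move=> k0 E; apply: (Rmult_eq_reg_l k) => //; lra.
split; [|split; [|split]].
- apply: (R _ _ e e0); move: q1.
  have -> : - (e * ev / g) * - (g * b) = e * ev * b by field; lra.
  lra.
- apply: (R _ _ g g0); move: q2.
  have -> : - (g * gu / e) * - (e * a) = g * gu * a by field; lra.
  lra.
- apply: (R _ _ e e0); move: q3; lra.
- apply: (R _ _ g g0); move: q4; lra.
Qed.

Section CodazziSolution.
Variables (D : R * R -> Prop) (la mu n1 n2 : R -> R -> R) (u v : R).
Hypotheses (oD : open D) (sla : smooth_on D la) (smu : smooth_on D mu)
  (sn1 : smooth_on D n1) (sn2 : smooth_on D n2) (Duv : D (u, v)).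

Lemma d_sq f : smooth_on D f ->
  du (fun u v => f u v ^ 2) u v = 2 * f u v * du f u v /\
  dv (fun u v => f u v ^ 2) u v = 2 * f u v * dv f u v.
Proof.
move=> sf.
have P := partials_mult _ _ _ _ _ _ _ (smooth_partials _ _ sf) (smooth_partials _ _ sf).
have Q := partials_ext _ _ _ _ (fun u v => f u v ^ 2) _ _ oD P
  (fun u v _ => ltac:(simpl; ring)) (fun _ _ _ => erefl) (fun _ _ _ => erefl).
by rewrite (partials_on_du _ _ _ _ _ _ Q Duv) (partials_on_dv _ _ _ _ _ _ Q Duv); split; ring.
Qed.

Lemma d_sumsq :
  du (fun u v => (la u v ^ 2 + mu u v ^ 2) ^ 2) u v =
   2 * (la u v ^ 2 + mu u v ^ 2) * (2 * la u v * du la u v + 2 * mu u v * du mu u v) /\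
  dv (fun u v => (la u v ^ 2 + mu u v ^ 2) ^ 2) u v =
   2 * (la u v ^ 2 + mu u v ^ 2) * (2 * la u v * dv la u v + 2 * mu u v * dv mu u v).
Proof.
have sl := smooth_pow D oD _ 2 sla; have sm := smooth_pow D oD _ 2 smu.
have [-> ->] := d_sq (fun u v => la u v ^ 2 + mu u v ^ 2) (smooth_plus D oD _ _ sl sm).
have P := partials_plus _ _ _ _ _ _ _ (smooth_partials _ _ sl) (smooth_partials _ _ sm).
rewrite (partials_on_du _ _ _ _ _ _ P Duv) (partials_on_dv _ _ _ _ _ _ P Duv).
by have [-> ->] := d_sq _ sla; have [-> ->] := d_sq _ smu.
Qed.

(** Exchanging the two parameters exchanges n1 and n2, e and g, X and Y, and B1
    and B2; it maps f1, f2 to f4, f3, so one solution of the system gives both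
    formulas. *)
Lemma codazzi_solution e g X Y B1 B2 :
  0 < e -> 0 < g -> ThetaF la mu n1 n2 u v <> 0 ->
  (n1 u v - n2 u v) * X - 2 * la u v * Y + mu u v * (g * B1) = g * du la u v - e * dv n1 u v ->
  - 2 * la u v * X + (n2 u v - n1 u v) * Y + mu u v * (e * B2) = e * dv la u v - g * du n2 u v ->
  - 2 * mu u v * Y - la u v * (g * B1) + n1 u v * (e * B2) = g * du mu u v ->
  - 2 * mu u v * X + n2 u v * (g * B1) - la u v * (e * B2) = e * dv mu u v ->
  X / e = f1F la mu n1 n2 u v + f2F la mu n1 n2 u v * (g / e) /\
  Y / g = f3F la mu n1 n2 u v * (e / g) + f4F la mu n1 n2 u v.
Proof.
move=> e0 g0 Th h1 h2 h3 h4.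
have [d1 d2] := d_sumsq; have [d3 d4] := d_sq _ sla; have [d5 d6] := d_sq _ smu.
have [d7 d8] := d_sq _ sn1; have [d9 d10] := d_sq _ sn2.
rewrite /f1F /f2F /f3F /f4F d1 d2 d3 d4 d5 d6 d8 d9.
split.
  by rewrite (codazzi_solve _ _ _ _ _ _ _ _ _ _ e g X Y B1 B2 _ Th h1 h2 h3 h4) //; lra.
have ThE : 4 * (la u v ^ 2 + mu u v ^ 2) ^ 2
   + (la u v ^ 2 - 2 * mu u v ^ 2 - n2 u v * n1 u v) * (n2 u v - n1 u v) ^ 2
   - 4 * la u v ^ 2 * n2 u v * n1 u v = ThetaF la mu n1 n2 u v by rewrite /ThetaF; ring.
rewrite -ThE in Th *.
rewrite (codazzi_solve (la u v) (mu u v) (n2 u v) (n1 u v) (dv la u v) (du la u v) (dv mu u v)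
  (du mu u v) (du n2 u v) (dv n1 u v) g e Y X B2 B1 _ Th) //; lra.
Qed.
End CodazziSolution.

Section VSmooth.
Variables (D : R * R -> Prop) (oD : open D).
Lemma vsmooth_vscale k A : smooth_on D k -> vsmooth D A ->
  vsmooth D (fun u v => vscale (k u v) (A u v)).
Proof.
move=> sk sA i; apply: (smooth_ext D oD (fun u v => k u v * Defs.comp A i u v)).
  by move=> u v _; rewrite /Defs.comp /vscale mxE.
exact: smooth_mult.
Qed.
Lemma vsmooth_plus A B : vsmooth D A -> vsmooth D B ->
  vsmooth D (fun u v => (A u v + B u v)%V).
Proof.
move=> sA sB i; apply: (smooth_ext D oD (fun u v => Defs.comp A i u v + Defs.comp B i u v)).
  by move=> u v _; rewrite /Defs.comp mxE.
exact: smooth_plus.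
Qed.
Lemma vsmooth_normal_part X Y A : vsmooth D X -> vsmooth D Y -> vsmooth D A ->
  vsmooth D (fun u v => normal_part (X u v) (Y u v) (A u v)).
Proof.
move=> sX sY sA i; apply: (smooth_ext D oD (fun u v => Defs.comp A i u v
   - dot (A u v) (X u v) * Defs.comp X i u v - dot (A u v) (Y u v) * Defs.comp Y i u v)).
  by move=> u v _; rewrite /Defs.comp /normal_part !mxE.
by repeat apply: smooth_minus => //; apply: smooth_mult => //; apply: smooth_dot.
Qed.
Lemma vsmooth_normalize A : vsmooth D A -> (forall u v, D (u, v) -> 0 < dot (A u v) (A u v)) ->
  vsmooth D (fun u v => normalize (A u v)).
Proof.
move=> sA H; have sd := smooth_dot D A A oD sA sA.
apply: (vsmooth_vscale (fun u v => / sqrt (dot (A u v) (A u v)))) => //.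
apply: smooth_inv => //; first exact: smooth_sqrt.
by move=> u v /H /sqrt_lt_R0; lra.
Qed.
Lemma vsmooth_cross A B C : vsmooth D A -> vsmooth D B -> vsmooth D C ->
  vsmooth D (fun u v => cross (A u v) (B u v) (C u v)).
Proof.
move=> sA sB sC i; apply: (smooth_ext D oD (fun u v => det4 (A u v) (B u v) (C u v) (delta_mx ord0 i))).
  by move=> u v _; rewrite /Defs.comp /cross mxE.
by apply: (smooth_det4 D A B C (fun _ _ => delta_mx ord0 i)) => // j; exact: smooth_const.
Qed.
End VSmooth.

Section Codazzi.
Variables (z : R -> R -> 'rV[R]_4) (D : R * R -> Prop).
Hypotheses (sS : surface z D) (fm : free_of_minimal_points z D) (pr : principal z D).

Let oD : open D := proj1 sS.
Let sz : vsmooth D z := proj1 (proj2 sS).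
Let Wp u v : D (u, v) -> 0 < W2 z u v.
Proof. by case: sS => _ [_ H] Duv; exact: H. Qed.
Let Ep u v : D (u, v) -> 0 < cE z u v.
Proof. by move=> /Wp /cE_pos. Qed.
Let Gp u v : D (u, v) -> 0 < cG z u v.
Proof. by move=> /Wp /cG_pos. Qed.
Let F0 u v : D (u, v) -> cF z u v = 0.
Proof. by move=> /pr []. Qed.

Let e u v := sqrt (cE z u v).
Let g u v := sqrt (cG z u v).

Lemma smooth_sqrtE : smooth_on D e.
Proof. by apply: smooth_sqrt => //; exact: smooth_cE. Qed.
Lemma smooth_sqrtG : smooth_on D g.
Proof. by apply: smooth_sqrt => //; exact: smooth_cG. Qed.

Let ep u v : D (u, v) -> 0 < e u v.
Proof. by move=> /Ep; exact: sqrt_lt_R0. Qed.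
Let gp u v : D (u, v) -> 0 < g u v.
Proof. by move=> /Gp; exact: sqrt_lt_R0. Qed.
Let ee u v : D (u, v) -> cE z u v = e u v * e u v.
Proof. by move=> /Ep h; rewrite sqrt_sqrt //; lra. Qed.
Let gg u v : D (u, v) -> cG z u v = g u v * g u v.
Proof. by move=> /Gp h; rewrite sqrt_sqrt //; lra. Qed.

Let szu := vsmooth_Du D z sz.
Let szv := vsmooth_Dv D z sz.
Let szuu := vsmooth_Du D _ szu.
Let szuv := vsmooth_Dv D _ szu.
Let szvv := vsmooth_Dv D _ szv.

Lemma vsmooth_fx : vsmooth D (fx z).
Proof.
apply: vsmooth_vscale => //; apply: smooth_inv => //; first exact: smooth_sqrtE.
by move=> u v /ep; rewrite /e; lra.
Qed.
Lemma vsmooth_fy : vsmooth D (fy z).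
Proof.
apply: vsmooth_vscale => //; apply: smooth_inv => //; first exact: smooth_sqrtG.
by move=> u v /gp; rewrite /g; lra.
Qed.

Lemma dot_fx_l u v w : D (u, v) -> dot (Du z u v) w = e u v * dot (fx z u v) w.
Proof. by move=> Duv; have h := ep u v Duv; rewrite dot_vscalel -/(e u v); field; lra. Qed.
Lemma dot_fy_l u v w : D (u, v) -> dot (Dv z u v) w = g u v * dot (fy z u v) w.
Proof. by move=> Duv; have h := gp u v Duv; rewrite dot_vscalel -/(g u v); field; lra. Qed.

Lemma dot_fx_r u v w k : D (u, v) -> dot w (Du z u v) = e u v * k -> dot w (fx z u v) = k.
Proof.
move=> Duv H; have h := ep u v Duv; apply: (etrans (dot_vscaler _ _ _)).
by rewrite H -/(e u v); field; lra.
Qed.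
Lemma dot_fy_r u v w k : D (u, v) -> dot w (Dv z u v) = g u v * k -> dot w (fy z u v) = k.
Proof.
move=> Duv H; have h := gp u v Duv; apply: (etrans (dot_vscaler _ _ _)).
by rewrite H -/(g u v); field; lra.
Qed.

Lemma fx_unit u v : D (u, v) -> dot (fx z u v) (fx z u v) = 1.
Proof.
move=> Duv; have h := ep u v Duv.
rewrite dot_vscalel dot_vscaler -/(cE z u v) -/(e u v) ee //; field; lra.
Qed.
Lemma fy_unit u v : D (u, v) -> dot (fy z u v) (fy z u v) = 1.
Proof.
move=> Duv; have h := gp u v Duv.
rewrite dot_vscalel dot_vscaler -/(cG z u v) -/(g u v) gg //; field; lra.
Qed.
Lemma fx_fy_orth u v : D (u, v) -> dot (fx z u v) (fy z u v) = 0.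
Proof. by move=> Duv; rewrite dot_vscalel dot_vscaler -/(cF z u v) F0 //; ring. Qed.

Lemma normal_part_x u v w : D (u, v) -> dot (normal_part (fx z u v) (fy z u v) w) (fx z u v) = 0.
Proof. by move=> Duv; rewrite dot_normal_part fx_unit // (dotC (fy z u v)) fx_fy_orth //; ring. Qed.
Lemma normal_part_y u v w : D (u, v) -> dot (normal_part (fx z u v) (fy z u v) w) (fy z u v) = 0.
Proof. by move=> Duv; rewrite dot_normal_part fx_fy_orth // fy_unit //; ring. Qed.

Lemma mean_x u v : D (u, v) -> dot (mean_curvature z u v) (fx z u v) = 0.
Proof. by move=> Duv; rewrite dot_midpoint !dot_vscalel !normal_part_x //; ring. Qed.
Lemma mean_y u v : D (u, v) -> dot (mean_curvature z u v) (fy z u v) = 0.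
Proof. by move=> Duv; rewrite dot_midpoint !dot_vscalel !normal_part_y //; ring. Qed.

Lemma dot_mean_normal u v n : D (u, v) -> dot n (fx z u v) = 0 -> dot n (fy z u v) = 0 ->
  dot (mean_curvature z u v) n = / 2 * (dot (zuu z u v) n / cE z u v + dot (zvv z u v) n / cG z u v).
Proof.
move=> Duv nx ny; rewrite dot_midpoint !dot_vscalel !dot_normal_part.
rewrite (dotC (fx z u v) n) (dotC (fy z u v) n) nx ny; field.
by have := Ep u v Duv; have := Gp u v Duv; lra.
Qed.

Lemma normal_fx u v n : dot n (Du z u v) = 0 -> dot n (fx z u v) = 0.
Proof. by move=> h; rewrite dot_vscaler h; ring. Qed.
Lemma normal_fy u v n : dot n (Dv z u v) = 0 -> dot n (fy z u v) = 0.
Proof. by move=> h; rewrite dot_vscaler h; ring. Qed.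

(** If H = 0, then the normal parts of z_uu / E and z_vv / G are opposite, which
    forces E N = G L; together with F = M = 0 the discriminant vanishes, and the
    point is minimal. *)
Lemma mean_pos u v : D (u, v) -> 0 < dot (mean_curvature z u v) (mean_curvature z u v).
Proof.
move=> Duv; case: (Rle_lt_or_eq_dec _ _ (dot_ge0 (mean_curvature z u v))) => // /esym H0.
have [n1 [n2 nf]] := normal_frame_exists z u v (Wp u v Duv).
have := fm u v n1 n2 Duv nf; rewrite kappa_disc; last exact: Wp.
have [_ [_ [_ [n1p [n1q [n2p n2q]]]]]] := nf.
have E1 := dot_eq0 _ H0 n1; have E2 := dot_eq0 _ H0 n2.
rewrite dot_mean_normal // in E1; try by [apply: normal_fx | apply: normal_fy].
rewrite dot_mean_normal // in E2; try by [apply: normal_fx | apply: normal_fy].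
have M0 := proj2 (pr u v Duv) n1 n2 nf.
have E0 := Ep u v Duv; have G0 := Gp u v Duv; have W0 := Wp u v Duv.
have sW := sqrt_lt_R0 _ W0.
rewrite disc_direction F0 // M0.
suff -> : cE z u v * cN z n1 n2 u v - cG z u v * cL z n1 n2 u v = 0.
  by rewrite /Rdiv => h; exfalso; move: h; set w := / _; nra.
rewrite /cN /cL.
set a1 := dot (zuu z u v) n1 in E1 *; set a2 := dot (zuu z u v) n2 in E2 *.
set c1 := dot (zvv z u v) n1 in E1 *; set c2 := dot (zvv z u v) n2 in E2 *.
have -> : c1 = - (cG z u v * (a1 / cE z u v)).
  transitivity (cG z u v * (c1 / cG z u v)); first by field; lra.
  have -> : c1 / cG z u v = - (a1 / cE z u v) by lra.
  by ring.
have -> : c2 = - (cG z u v * (a2 / cE z u v)).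
  transitivity (cG z u v * (c2 / cG z u v)); first by field; lra.
  have -> : c2 / cG z u v = - (a2 / cE z u v) by lra.
  by ring.
by field; lra.
Qed.

Lemma vsmooth_mean : vsmooth D (mean_curvature z).
Proof.
have s1 : smooth_on D (fun u v => / cE z u v).
  by apply: smooth_inv => //; [exact: smooth_cE | move=> u v /Ep; lra].
have s2 : smooth_on D (fun u v => / cG z u v).
  by apply: smooth_inv => //; [exact: smooth_cG | move=> u v /Gp; lra].
have h1 := vsmooth_vscale D oD _ _ s1 (vsmooth_normal_part D oD _ _ _ vsmooth_fx vsmooth_fy szuu).
have h2 := vsmooth_vscale D oD _ _ s2 (vsmooth_normal_part D oD _ _ _ vsmooth_fx vsmooth_fy szvv).
exact: (vsmooth_vscale D oD (fun _ _ => (2^-1)%V) _ (smooth_const _ _) (vsmooth_plus D oD _ _ h1 h2)).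
Qed.

Lemma vsmooth_fb : vsmooth D (fb z).
Proof. by apply: vsmooth_normalize => //; [exact: vsmooth_mean | exact: mean_pos]. Qed.
Lemma vsmooth_fl : vsmooth D (fl z).
Proof. by apply: vsmooth_cross => //; [exact: vsmooth_fx | exact: vsmooth_fy | exact: vsmooth_fb]. Qed.

Lemma fb_x u v : D (u, v) -> dot (fb z u v) (fx z u v) = 0.
Proof. by move=> Duv; rewrite dot_normalize mean_x //; ring. Qed.
Lemma fb_y u v : D (u, v) -> dot (fb z u v) (fy z u v) = 0.
Proof. by move=> Duv; rewrite dot_normalize mean_y //; ring. Qed.
Lemma fb_unit u v : D (u, v) -> dot (fb z u v) (fb z u v) = 1.
Proof. by move=> Duv; apply: normalize_unit; exact: mean_pos. Qed.

Lemma frame_orthonormal u v : D (u, v) -> orthonormal3 (fx z u v) (fy z u v) (fb z u v).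
Proof.
move=> Duv; rewrite /orthonormal3 fx_unit // fy_unit // fb_unit // fx_fy_orth // (dotC (fx z u v)) fb_x //.
by rewrite (dotC (fy z u v)) fb_y.
Qed.

Lemma fl_facts u v : D (u, v) -> dot (fl z u v) (fl z u v) = 1 /\ dot (fl z u v) (fx z u v) = 0 /\
  dot (fl z u v) (fy z u v) = 0 /\ dot (fl z u v) (fb z u v) = 0.
Proof. by move=> Duv; exact: cross_orthonormal (frame_orthonormal u v Duv). Qed.

Lemma b_l_frame u v : D (u, v) -> normal_frame z u v (fb z u v) (fl z u v).
Proof.
move=> Duv; have [ll [lx [ly lb]]] := fl_facts u v Duv.
rewrite /normal_frame fb_unit // ll (dotC (fb z u v) (fl z u v)) lb.
rewrite !(dotC _ (Du z u v)) !(dotC _ (Dv z u v)) !dot_fx_l // !dot_fy_l //.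
rewrite !(dotC (fx z u v)) !(dotC (fy z u v)) lx ly fb_x // fb_y //.
by rewrite !Rmult_0_r.
Qed.

(** M = 0 says that sigma(x,x) and sigma(y,y) are parallel; their sum is nonzero
    and has the direction of b, so each of them has this direction. *)
Lemma zuu_zvv_l u v : D (u, v) -> dot (zuu z u v) (fl z u v) = 0 /\ dot (zvv z u v) (fl z u v) = 0.
Proof.
move=> Duv; have [ll [lx [ly lb]]] := fl_facts u v Duv.
have E0 := Ep u v Duv; have G0 := Gp u v Duv; have W0 := Wp u v Duv.
have sW := sqrt_lt_R0 _ W0; have Hp := mean_pos u v Duv; have sH := sqrt_lt_R0 _ Hp.
have Hl : dot (mean_curvature z u v) (fl z u v) = 0.
  have := lb; rewrite dotC dot_normalize => h.
  by case: (Rmult_integral _ _ h) => //; have := Rinv_0_lt_compat _ sH; lra.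
have Hb : 0 < dot (mean_curvature z u v) (fb z u v).
  rewrite dotC dot_normalize; apply: Rmult_lt_0_compat => //; exact: Rinv_0_lt_compat.
rewrite dot_mean_normal // in Hl.
rewrite dot_mean_normal // in Hb; [|exact: fb_x|exact: fb_y].
have := proj2 (pr u v Duv) _ _ (b_l_frame u v Duv); rewrite /cM.
set a1 := dot (zuu z u v) (fb z u v) in Hb *; set a2 := dot (zuu z u v) (fl z u v) in Hl *.
set c1 := dot (zvv z u v) (fb z u v) in Hb *; set c2 := dot (zvv z u v) (fl z u v) in Hl * => M0.
have {}M0 : a1 * c2 - a2 * c1 = 0.
  case: (Rmult_integral _ _ M0) => // h; exfalso; move: h; rewrite /Rdiv Rmult_1_l.
  by have := Rinv_0_lt_compat _ sW; lra.
have Ec2 : c2 = - (cG z u v * (a2 / cE z u v)).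
  apply: (Rmult_eq_reg_r (/ cG z u v)); last by apply: Rinv_neq_0_compat; lra.
  have -> : - (cG z u v * (a2 / cE z u v)) * / cG z u v = - (a2 / cE z u v) by field; lra.
  by move: Hl; rewrite /Rdiv; lra.
have : a2 * (/ 2 * (a1 / cE z u v + c1 / cG z u v)) = 0.
  transitivity (- / 2 * / cG z u v * (a1 * c2 - a2 * c1)); last by rewrite M0; ring.
  by rewrite Ec2; field; lra.
move=> h; have a20 : a2 = 0 by case: (Rmult_integral _ _ h) => //; lra.
by split=> //; rewrite Ec2 a20; field; lra.
Qed.

Lemma zuu_b u v : D (u, v) -> dot (zuu z u v) (fb z u v) = e u v * e u v * nu1 z u v.
Proof.
move=> Duv; have h := Ep u v Duv; rewrite -ee // /nu1 dot_vscalel dot_normal_part.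
rewrite (dotC (fx z u v) (fb z u v)) (dotC (fy z u v) (fb z u v)) fb_x // fb_y //; field; lra.
Qed.
Lemma zvv_b u v : D (u, v) -> dot (zvv z u v) (fb z u v) = g u v * g u v * nu2 z u v.
Proof.
move=> Duv; have h := Gp u v Duv; rewrite -gg // /nu2 dot_vscalel dot_normal_part.
rewrite (dotC (fx z u v) (fb z u v)) (dotC (fy z u v) (fb z u v)) fb_x // fb_y //; field; lra.
Qed.
Lemma zuv_b u v : D (u, v) -> dot (zuv z u v) (fb z u v) = e u v * g u v * lambda z u v.
Proof.
move=> Duv; have h := ep u v Duv; have h' := gp u v Duv.
rewrite /lambda dot_vscalel dot_normal_part -/(e u v) -/(g u v).
rewrite (dotC (fx z u v) (fb z u v)) (dotC (fy z u v) (fb z u v)) fb_x // fb_y //; field; lra.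
Qed.
Lemma zuv_l u v : D (u, v) -> dot (zuv z u v) (fl z u v) = e u v * g u v * mu z u v.
Proof.
move=> Duv; have h := ep u v Duv; have h' := gp u v Duv.
have [ll [lx [ly lb]]] := fl_facts u v Duv.
rewrite /mu dot_vscalel dot_normal_part -/(e u v) -/(g u v).
rewrite (dotC (fx z u v) (fl z u v)) (dotC (fy z u v) (fl z u v)) lx ly; field; lra.
Qed.

Lemma d_cE u v : D (u, v) -> du (cE z) u v = 2 * e u v * du e u v /\ dv (cE z) u v = 2 * e u v * dv e u v.
Proof.
move=> Duv; have P := partials_mult _ _ _ _ _ _ _ (smooth_partials _ _ smooth_sqrtE) (smooth_partials _ _ smooth_sqrtE).
have Q := partials_ext _ _ _ _ (cE z) _ _ oD P (fun u v Duv => esym (ee u v Duv)) (fun _ _ _ => erefl) (fun _ _ _ => erefl).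
by rewrite (partials_on_du _ _ _ _ _ _ Q Duv) (partials_on_dv _ _ _ _ _ _ Q Duv); split; ring.
Qed.
Lemma d_cG u v : D (u, v) -> du (cG z) u v = 2 * g u v * du g u v /\ dv (cG z) u v = 2 * g u v * dv g u v.
Proof.
move=> Duv; have P := partials_mult _ _ _ _ _ _ _ (smooth_partials _ _ smooth_sqrtG) (smooth_partials _ _ smooth_sqrtG).
have Q := partials_ext _ _ _ _ (cG z) _ _ oD P (fun u v Duv => esym (gg u v Duv)) (fun _ _ _ => erefl) (fun _ _ _ => erefl).
by rewrite (partials_on_du _ _ _ _ _ _ Q Duv) (partials_on_dv _ _ _ _ _ _ Q Duv); split; ring.
Qed.
Lemma d_cF u v : D (u, v) -> du (cF z) u v = 0 /\ dv (cF z) u v = 0.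
Proof.
move=> Duv.
have P : partials_on D (fun _ _ => 0) (fun _ _ => 0) (fun _ _ => 0).
  by move=> *; split; exact: is_derive_const.
have Q := partials_ext _ _ _ _ (cF z) _ _ oD P (fun u v Duv => esym (F0 u v Duv)) (fun _ _ _ => erefl) (fun _ _ _ => erefl).
by rewrite (partials_on_du _ _ _ _ _ _ Q Duv) (partials_on_dv _ _ _ _ _ _ Q Duv).
Qed.

(** The Christoffel symbols in principal parameters, read off from the
    derivatives of E, F = 0 and G. *)
Lemma tangential u v : D (u, v) ->
  dot (zuu z u v) (fx z u v) = du e u v /\
  dot (zuu z u v) (fy z u v) = - (e u v * dv e u v / g u v) /\
  dot (zuv z u v) (fx z u v) = dv e u v /\
  dot (zuv z u v) (fy z u v) = du g u v /\
  dot (zvv z u v) (fx z u v) = - (g u v * du g u v / e u v) /\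
  dot (zvv z u v) (fy z u v) = dv g u v.
Proof.
move=> Duv; have h := ep u v Duv; have h' := gp u v Duv.
have [Eu Ev] := d_cE u v Duv; have [Gu Gv] := d_cG u v Duv; have [Fu Fv] := d_cF u v Duv.
have S : Du (Dv z) u v = zuv z u v by exact: (vec_schwarz D).
have a1 : 2 * dot (zuu z u v) (Du z u v) = 2 * e u v * du e u v.
  by rewrite -Eu /cE (du_dot D) // (dotC (Du z u v)) -/(zuu z u v); ring.
have a2 : 2 * dot (zuv z u v) (Du z u v) = 2 * e u v * dv e u v.
  by rewrite -Ev /cE (dv_dot D) // (dotC (Du z u v)) -/(zuv z u v); ring.
have a3 : 2 * dot (zuv z u v) (Dv z u v) = 2 * g u v * du g u v.
  by rewrite -Gu /cG (du_dot D) // S (dotC (Dv z u v)); ring.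
have a4 : 2 * dot (zvv z u v) (Dv z u v) = 2 * g u v * dv g u v.
  by rewrite -Gv /cG (dv_dot D) // (dotC (Dv z u v)) -/(zvv z u v); ring.
have a5 : dot (zuu z u v) (Dv z u v) + dot (zuv z u v) (Du z u v) = 0.
  by rewrite -Fu /cF (du_dot D) // S (dotC (Du z u v)) -/(zuu z u v).
have a6 : dot (zuv z u v) (Dv z u v) + dot (zvv z u v) (Du z u v) = 0.
  by rewrite -Fv /cF (dv_dot D) // (dotC (Du z u v) (Dv (Dv z) u v)).
rewrite !dot_vscaler -/(e u v) -/(g u v).
have q1 : dot (zuu z u v) (Du z u v) = e u v * du e u v by lra.
have q2 : dot (zuv z u v) (Du z u v) = e u v * dv e u v by lra.
have q3 : dot (zuv z u v) (Dv z u v) = g u v * du g u v by lra.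
have q4 : dot (zvv z u v) (Dv z u v) = g u v * dv g u v by lra.
have q5 : dot (zuu z u v) (Dv z u v) = - (e u v * dv e u v) by lra.
have q6 : dot (zvv z u v) (Du z u v) = - (g u v * du g u v) by lra.
by rewrite q1 q2 q3 q4 q5 q6; do 5 (split; first by field; lra); field; lra.
Qed.

(** Differentiating the orthogonality relations of the frame gives the
    components of the derivatives of b and l. *)
Lemma dot_cst_d A B c u v : vsmooth D A -> vsmooth D B ->
  (forall u v, D (u, v) -> dot (A u v) (B u v) = c) -> D (u, v) ->
  dot (Du A u v) (B u v) = - dot (A u v) (Du B u v) /\
  dot (Dv A u v) (B u v) = - dot (A u v) (Dv B u v).
Proof.
move=> sA sB H Duv.
have P := partials_dot D A B oD sA sB.
have Q := partials_ext _ _ _ _ (fun _ _ => c) _ _ oD P H (fun _ _ _ => erefl) (fun _ _ _ => erefl).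
have [/is_derive_unique + /is_derive_unique] := Q u v Duv.
by rewrite !Derive_const; split; lra.
Qed.

Lemma fb_Du u v : D (u, v) -> dot (fb z u v) (Du z u v) = 0.
Proof. by move=> Duv; rewrite dotC dot_fx_l // dotC fb_x //; ring. Qed.
Lemma fb_Dv u v : D (u, v) -> dot (fb z u v) (Dv z u v) = 0.
Proof. by move=> Duv; rewrite dotC dot_fy_l // dotC fb_y //; ring. Qed.
Lemma fl_Du u v : D (u, v) -> dot (fl z u v) (Du z u v) = 0.
Proof. by move=> Duv; have [_ [h _]] := fl_facts u v Duv; rewrite dotC dot_fx_l // dotC h; ring. Qed.
Lemma fl_Dv u v : D (u, v) -> dot (fl z u v) (Dv z u v) = 0.
Proof. by move=> Duv; have [_ [_ [h _]]] := fl_facts u v Duv; rewrite dotC dot_fy_l // dotC h; ring. Qed.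

(** Coefficients of the normal connection in the frame b, l, not normalized by
    e and g. *)
Definition beta1 u v := dot (Du (fb z) u v) (fl z u v).
Definition beta2 u v := dot (Dv (fb z) u v) (fl z u v).

Lemma d_fb u v : D (u, v) ->
  dot (Du (fb z) u v) (fx z u v) = - (e u v * nu1 z u v) /\
  dot (Du (fb z) u v) (fy z u v) = - (e u v * lambda z u v) /\
  dot (Du (fb z) u v) (fb z u v) = 0 /\
  dot (Dv (fb z) u v) (fx z u v) = - (g u v * lambda z u v) /\
  dot (Dv (fb z) u v) (fy z u v) = - (g u v * nu2 z u v) /\
  dot (Dv (fb z) u v) (fb z u v) = 0.
Proof.
move=> Duv; have h := ep u v Duv; have h' := gp u v Duv.
have S : Du (Dv z) u v = zuv z u v by exact: (vec_schwarz D).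
have [p1 p2] := dot_cst_d _ _ 0 u v vsmooth_fb szu fb_Du Duv.
have [p3 p4] := dot_cst_d _ _ 0 u v vsmooth_fb szv fb_Dv Duv.
have [p5 p6] := dot_cst_d _ _ 1 u v vsmooth_fb vsmooth_fb fb_unit Duv.
have q1 := etrans p1 (f_equal Ropp (etrans (dotC _ _) (zuu_b u v Duv))).
have q2 := etrans p2 (f_equal Ropp (etrans (dotC _ _) (zuv_b u v Duv))).
have q3 := etrans p3 (f_equal Ropp (etrans (f_equal (dot _) S) (etrans (dotC _ _) (zuv_b u v Duv)))).
have q4 := etrans p4 (f_equal Ropp (etrans (dotC _ _) (zvv_b u v Duv))).
have q5 := etrans p5 (f_equal Ropp (dotC _ _)).
have q6 := etrans p6 (f_equal Ropp (dotC _ _)).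
split; first by apply: (dot_fx_r _ _ _ _ Duv); apply: (etrans q1); ring.
split; first by apply: (dot_fy_r _ _ _ _ Duv); apply: (etrans q3); ring.
split; first by lra.
split; first by apply: (dot_fx_r _ _ _ _ Duv); apply: (etrans q2); ring.
split; first by apply: (dot_fy_r _ _ _ _ Duv); apply: (etrans q4); ring.
by lra.
Qed.

Lemma d_fl u v : D (u, v) ->
  dot (Du (fl z) u v) (fx z u v) = 0 /\
  dot (Du (fl z) u v) (fy z u v) = - (e u v * mu z u v) /\
  dot (Du (fl z) u v) (fb z u v) = - beta1 u v /\
  dot (Du (fl z) u v) (fl z u v) = 0 /\
  dot (Dv (fl z) u v) (fx z u v) = - (g u v * mu z u v) /\
  dot (Dv (fl z) u v) (fy z u v) = 0 /\
  dot (Dv (fl z) u v) (fb z u v) = - beta2 u v /\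
  dot (Dv (fl z) u v) (fl z u v) = 0.
Proof.
move=> Duv; have h := ep u v Duv; have h' := gp u v Duv.
have S : Du (Dv z) u v = zuv z u v by exact: (vec_schwarz D).
have [n1 n2] := zuu_zvv_l u v Duv.
have [p1 p2] := dot_cst_d _ _ 0 u v vsmooth_fl szu fl_Du Duv.
have [p3 p4] := dot_cst_d _ _ 0 u v vsmooth_fl szv fl_Dv Duv.
have [p5 p6] := dot_cst_d _ _ 1 u v vsmooth_fl vsmooth_fl (fun u v Duv => proj1 (fl_facts u v Duv)) Duv.
have [p7 p8] := dot_cst_d _ _ 0 u v vsmooth_fl vsmooth_fb
  (fun u v Duv => proj2 (proj2 (proj2 (fl_facts u v Duv)))) Duv.
have q1 := etrans p1 (f_equal Ropp (etrans (dotC _ _) n1)).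
have q2 := etrans p2 (f_equal Ropp (etrans (dotC _ _) (zuv_l u v Duv))).
have q3 := etrans p3 (f_equal Ropp (etrans (f_equal (dot _) S) (etrans (dotC _ _) (zuv_l u v Duv)))).
have q4 := etrans p4 (f_equal Ropp (etrans (dotC _ _) n2)).
have q5 := etrans p5 (f_equal Ropp (dotC _ _)).
have q6 := etrans p6 (f_equal Ropp (dotC _ _)).
have q7 := etrans p7 (f_equal Ropp (dotC _ _)).
have q8 := etrans p8 (f_equal Ropp (dotC _ _)).
split; first by apply: (dot_fx_r _ _ _ _ Duv); apply: (etrans q1); ring.
split; first by apply: (dot_fy_r _ _ _ _ Duv); apply: (etrans q3); ring.
split; first exact: q7.
split; first by lra.
split; first by apply: (dot_fx_r _ _ _ _ Duv); apply: (etrans q2); ring.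
split; first by apply: (dot_fy_r _ _ _ _ Duv); apply: (etrans q4); ring.
split; first exact: q8.
by lra.
Qed.

Lemma smooth_nu1 : smooth_on D (nu1 z).
Proof.
apply: (smooth_dot D (sigma_xx z) (fb z)) => //; last exact: vsmooth_fb.
apply: vsmooth_vscale => //; last by apply: vsmooth_normal_part => //; [exact: vsmooth_fx | exact: vsmooth_fy].
by apply: smooth_inv => //; [exact: smooth_cE | move=> u v /Ep; lra].
Qed.
Lemma smooth_nu2 : smooth_on D (nu2 z).
Proof.
apply: (smooth_dot D (sigma_yy z) (fb z)) => //; last exact: vsmooth_fb.
apply: vsmooth_vscale => //; last by apply: vsmooth_normal_part => //; [exact: vsmooth_fx | exact: vsmooth_fy].
by apply: smooth_inv => //; [exact: smooth_cG | move=> u v /Gp; lra].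
Qed.
Lemma vsmooth_sigma_xy : vsmooth D (sigma_xy z).
Proof.
apply: vsmooth_vscale => //; last by apply: vsmooth_normal_part => //; [exact: vsmooth_fx | exact: vsmooth_fy].
apply: smooth_inv => //; first by apply: smooth_mult => //; [exact: smooth_sqrtE | exact: smooth_sqrtG].
move=> u v Duv; have := ep u v Duv; have := gp u v Duv; rewrite /e /g; nra.
Qed.
Lemma smooth_lambda : smooth_on D (lambda z).
Proof. by apply: (smooth_dot D (sigma_xy z) (fb z)) => //; [exact: vsmooth_sigma_xy | exact: vsmooth_fb]. Qed.
Lemma smooth_mu : smooth_on D (mu z).
Proof. by apply: (smooth_dot D (sigma_xy z) (fl z)) => //; [exact: vsmooth_sigma_xy | exact: vsmooth_fl]. Qed.

(** The scalar product of the vector A with the two equal derivatives of z_uu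
    and z_uv, after moving the derivatives from z to A. *)
Lemma cross_diff_uv A fuu fuv u v : vsmooth D A -> 
  (forall u v, D (u, v) -> dot (zuu z u v) (A u v) = fuu u v) ->
  (forall u v, D (u, v) -> dot (zuv z u v) (A u v) = fuv u v) -> D (u, v) ->
  dv fuu u v - du fuv u v = dot (zuu z u v) (Dv A u v) - dot (zuv z u v) (Du A u v).
Proof.
move=> sA H1 H2 Duv.
have Q1 := partials_ext _ _ _ _ fuu _ _ oD (partials_dot D _ A oD szuu sA) H1 (fun _ _ _ => erefl) (fun _ _ _ => erefl).
have Q2 := partials_ext _ _ _ _ fuv _ _ oD (partials_dot D _ A oD szuv sA) H2 (fun _ _ _ => erefl) (fun _ _ _ => erefl).
rewrite (partials_on_dv _ _ _ _ _ _ Q1 Duv) (partials_on_du _ _ _ _ _ _ Q2 Duv).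
have -> : Du (Dv (Du z)) u v = Dv (Du (Du z)) u v by exact: (vec_schwarz D).
by rewrite -/(zuu z u v) -/(zuv z u v); ring.
Qed.

Lemma cross_diff_vu A fvv fuv u v : vsmooth D A -> 
  (forall u v, D (u, v) -> dot (zvv z u v) (A u v) = fvv u v) ->
  (forall u v, D (u, v) -> dot (zuv z u v) (A u v) = fuv u v) -> D (u, v) ->
  du fvv u v - dv fuv u v = dot (zvv z u v) (Du A u v) - dot (zuv z u v) (Dv A u v).
Proof.
move=> sA H1 H2 Duv.
have H2' u' v' : D (u', v') -> dot (Du (Dv z) u' v') (A u' v') = fuv u' v'.
  by move=> Duv'; rewrite (vec_schwarz D) //; exact: H2.
have szvu := vsmooth_Du D _ szv.
have Q1 := partials_ext _ _ _ _ fvv _ _ oD (partials_dot D _ A oD szvv sA) H1 (fun _ _ _ => erefl) (fun _ _ _ => erefl).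
have Q2 := partials_ext _ _ _ _ fuv _ _ oD (partials_dot D _ A oD szvu sA) H2' (fun _ _ _ => erefl) (fun _ _ _ => erefl).
rewrite (partials_on_du _ _ _ _ _ _ Q1 Duv) (partials_on_dv _ _ _ _ _ _ Q2 Duv).
have -> : Du (Dv (Dv z)) u v = Dv (Du (Dv z)) u v by exact: (vec_schwarz D).
have -> : Du (Dv z) u v = zuv z u v by exact: (vec_schwarz D).
by rewrite -/(zvv z u v); ring.
Qed.

Lemma d_mult3 f1 f2 f3 u v : smooth_on D f1 -> smooth_on D f2 -> smooth_on D f3 -> D (u, v) ->
  du (fun u v => f1 u v * f2 u v * f3 u v) u v =
    du f1 u v * f2 u v * f3 u v + f1 u v * du f2 u v * f3 u v + f1 u v * f2 u v * du f3 u v /\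
  dv (fun u v => f1 u v * f2 u v * f3 u v) u v =
    dv f1 u v * f2 u v * f3 u v + f1 u v * dv f2 u v * f3 u v + f1 u v * f2 u v * dv f3 u v.
Proof.
move=> s1 s2 s3 Duv.
have P := partials_mult _ _ _ _ _ _ _ (partials_mult _ _ _ _ _ _ _ (smooth_partials _ _ s1) (smooth_partials _ _ s2)) (smooth_partials _ _ s3).
by rewrite (partials_on_du _ _ _ _ _ _ P Duv) (partials_on_dv _ _ _ _ _ _ P Duv); split; ring.
Qed.

(** Stated with named components, because the scalar products in question are
    known only through equations. *)
Lemma dot_components u v w w' p1 p2 p3 p4 q1 q2 q3 q4 : D (u, v) ->
  dot w (fx z u v) = p1 -> dot w (fy z u v) = p2 -> dot w (fb z u v) = p3 -> dot w (fl z u v) = p4 ->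
  dot w' (fx z u v) = q1 -> dot w' (fy z u v) = q2 -> dot w' (fb z u v) = q3 -> dot w' (fl z u v) = q4 ->
  dot w w' = p1 * q1 + p2 * q2 + p3 * q3 + p4 * q4.
Proof.
move=> Duv <- <- <- <- <- <- <- <-; have [ll [lx [ly lb]]] := fl_facts u v Duv.
exact: dot_expand (frame_orthonormal u v Duv) ll lx ly lb.
Qed.

Lemma codazzi_equations u v : D (u, v) ->
  let l := lambda z u v in let m := mu z u v in let a := nu1 z u v in let b := nu2 z u v in
  let X := dv e u v in let Y := du g u v in
  (a - b) * X - 2 * l * Y + m * (g u v * beta1 u v) = g u v * du (lambda z) u v - e u v * dv (nu1 z) u v /\
  - 2 * l * X + (b - a) * Y + m * (e u v * beta2 u v) = e u v * dv (lambda z) u v - g u v * du (nu2 z) u v /\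
  - 2 * m * Y - l * (g u v * beta1 u v) + a * (e u v * beta2 u v) = g u v * du (mu z) u v /\
  - 2 * m * X + b * (g u v * beta1 u v) - l * (e u v * beta2 u v) = e u v * dv (mu z) u v.
Proof.
move=> Duv l m a b X Y.
have h := ep u v Duv; have h' := gp u v Duv.
have [t1 [t2 [t3 [t4 [t5 t6]]]]] := tangential u v Duv.
have [b1 [b2 [b3 [b4 [b5 b6]]]]] := d_fb u v Duv.
have [l1 [l2 [l3 [l4 [l5 [l6 [l7 l8]]]]]]] := d_fl u v Duv.
have [n1 n2] := zuu_zvv_l u v Duv.
have sE := smooth_sqrtE; have sG := smooth_sqrtG.
have uu_b := zuu_b u v Duv; have uv_b := zuv_b u v Duv; have vv_b := zvv_b u v Duv.
have uv_l := zuv_l u v Duv.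
have x1 := dot_components u v _ _ _ _ _ _ _ _ _ _ Duv t1 t2 uu_b n1 b4 b5 b6 erefl.
have x2 := dot_components u v _ _ _ _ _ _ _ _ _ _ Duv t3 t4 uv_b uv_l b1 b2 b3 erefl.
have x3 := dot_components u v _ _ _ _ _ _ _ _ _ _ Duv t5 t6 vv_b n2 b1 b2 b3 erefl.
have x4 := dot_components u v _ _ _ _ _ _ _ _ _ _ Duv t3 t4 uv_b uv_l b4 b5 b6 erefl.
have x5 := dot_components u v _ _ _ _ _ _ _ _ _ _ Duv t1 t2 uu_b n1 l5 l6 l7 l8.
have x6 := dot_components u v _ _ _ _ _ _ _ _ _ _ Duv t3 t4 uv_b uv_l l1 l2 l3 l4.
have x7 := dot_components u v _ _ _ _ _ _ _ _ _ _ Duv t5 t6 vv_b n2 l1 l2 l3 l4.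
have x8 := dot_components u v _ _ _ _ _ _ _ _ _ _ Duv t3 t4 uv_b uv_l l5 l6 l7 l8.
have [mu_u mu_v] := d_mult3 e g (mu z) u v sE sG smooth_mu Duv.
have [la_u la_v] := d_mult3 e g (lambda z) u v sE sG smooth_lambda Duv.
have [_ nu1_v] := d_mult3 e e (nu1 z) u v sE sE smooth_nu1 Duv.
have [nu2_u _] := d_mult3 g g (nu2 z) u v sG sG smooth_nu2 Duv.
have z_u : du (fun _ _ => 0) u v = 0 := Derive_const 0 u.
have z_v : dv (fun _ _ => 0) u v = 0 := Derive_const 0 v.
have q1 := etrans (esym (f_equal2 Rminus nu1_v la_u))
  (etrans (cross_diff_uv (fb z) _ _ u v vsmooth_fb zuu_b zuv_b Duv) (f_equal2 Rminus x1 x2)).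
have q2 := etrans (esym (f_equal2 Rminus nu2_u la_v))
  (etrans (cross_diff_vu (fb z) _ _ u v vsmooth_fb zvv_b zuv_b Duv) (f_equal2 Rminus x3 x4)).
have q3 := etrans (esym (f_equal2 Rminus z_v mu_u))
  (etrans (cross_diff_uv (fl z) (fun _ _ => 0) _ u v vsmooth_fl
    (fun u v Duv => proj1 (zuu_zvv_l u v Duv)) zuv_l Duv) (f_equal2 Rminus x5 x6)).
have q4 := etrans (esym (f_equal2 Rminus z_u mu_v))
  (etrans (cross_diff_vu (fl z) (fun _ _ => 0) _ u v vsmooth_fl
    (fun u v Duv => proj2 (zuu_zvv_l u v Duv)) zuv_l Duv) (f_equal2 Rminus x7 x8)).
exact: (codazzi_simplify _ _ _ _ _ _ _ _ _ _ _ _ _ _ _ _ _ _ h h' q1 q2 q3 q4).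
Qed.

Let solved u v (Duv : D (u, v)) (Th : Theta z u v <> 0) :=
  let: conj h1 (conj h2 (conj h3 h4)) := codazzi_equations u v Duv in
  codazzi_solution D (lambda z) (mu z) (nu1 z) (nu2 z) u v oD smooth_lambda smooth_mu smooth_nu1
    smooth_nu2 Duv (e u v) (g u v) _ _ _ _ (ep u v Duv) (gp u v Duv) Th h1 h2 h3 h4.

(** The integrands in the definition of canonical parameters are logarithmic
    derivatives. *)
Lemma integrand_v_log u v : D (u, v) -> Theta z u v <> 0 ->
  integrand_v z u v = dv (fun u v => sqrt (cE z u v)) u v / sqrt (cE z u v).
Proof. by move=> Duv Th; exact: (esym (proj1 (solved u v Duv Th))). Qed.

Lemma integrand_u_log u v : D (u, v) -> Theta z u v <> 0 ->
  integrand_u z u v = du (fun u v => sqrt (cG z u v)) u v / sqrt (cG z u v).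
Proof. by move=> Duv Th; exact: (esym (proj2 (solved u v Duv Th))). Qed.

End Codazzi.

(** * Canonical principal parameters *)
Lemma RInt_log_derivative (f df h : R -> R) a b :
  (forall t, Rmin a b <= t <= Rmax a b -> 0 < f t /\ is_derive f t (df t) /\ continuous df t
      /\ h t = df t / f t) ->
  RInt h a b = ln (f b) - ln (f a).
Proof.
move=> H.
apply: is_RInt_unique.
apply: (is_RInt_ext (fun t => df t / f t)).
  by move=> t Ht; have [_ [_ [_ ->]]] := H t (conj (Rlt_le _ _ (proj1 Ht)) (Rlt_le _ _ (proj2 Ht))).
apply: (is_RInt_derive (V := R_CompleteNormedModule) (fun t => ln (f t))) => t /H [f0 [df' [cdf _]]].
  have := is_derive_comp ln f t _ _ (is_derive_ln _ f0) df'.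
  by rewrite /scal /= /mult /=.
apply: (continuous_mult (K := R_AbsRing)) => //.
apply: continuous_Rinv_comp; last by lra.
by apply: (ex_derive_continuous (V := R_NormedModule)); exists (df t).
Qed.

Lemma mult_exp_logs a b c d k : 0 < a -> 0 < b -> 0 < c -> 0 < d ->
  a * exp (- (ln a - ln b) - (ln c - ln d) + k) = b / c * d * exp k.
Proof.
move=> a0 b0 c0 d0.
have -> : - (ln a - ln b) - (ln c - ln d) + k = - ln a + (ln b + (- ln c + (ln d + k))) by ring.
by rewrite !exp_plus !exp_Ropp !exp_ln //; field; lra.
Qed.

Section CanonicalExpressions.
Variables (z : R -> R -> 'rV[R]_4) (D : R * R -> Prop).
Hypotheses (sS : surface z D) (fm : free_of_minimal_points z D) (pr : principal z D).
Hypothesis Th : forall u v, D (u, v) -> Theta z u v <> 0.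
Hypothesis conv1 : forall u u' v t, D (u, v) -> D (u', v) -> Rmin u u' <= t <= Rmax u u' -> D (t, v).
Hypothesis conv2 : forall u v v' t, D (u, v) -> D (u, v') -> Rmin v v' <= t <= Rmax v v' -> D (u, t).

Lemma RInt_integrand_v u v0 v : D (u, v0) -> D (u, v) ->
  RInt (fun t => integrand_v z u t) v0 v = ln (sqrt (cE z u v)) - ln (sqrt (cE z u v0)).
Proof.
move=> D0 D1; have [oD [sz W0]] := sS.
have se := smooth_sqrtE z D sS.
apply: (RInt_log_derivative (fun t => sqrt (cE z u t)) (fun t => dv (fun u v => sqrt (cE z u v)) u t)) => t Ht.
have Dt := conv2 _ _ _ _ D0 D1 Ht.
split; first by apply: sqrt_lt_R0; apply: cE_pos; apply: W0.
split; first by have [] := smooth_partials _ _ se u t Dt.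
split; last exact: (integrand_v_log z D sS fm pr u t Dt (Th u t Dt)).
apply: (continuity_2d_pt_snd (dv (fun u v => sqrt (cE z u v)))); exact: smooth_cont (smooth_dv _ _ se) Dt.
Qed.

Lemma RInt_integrand_u u0 u v : D (u0, v) -> D (u, v) ->
  RInt (fun s => integrand_u z s v) u0 u = ln (sqrt (cG z u v)) - ln (sqrt (cG z u0 v)).
Proof.
move=> D0 D1; have [oD [sz W0]] := sS.
have sg := smooth_sqrtG z D sS.
apply: (RInt_log_derivative (fun t => sqrt (cG z t v)) (fun t => du (fun u v => sqrt (cG z u v)) t v)) => t Ht.
have Dt := conv1 _ _ _ _ D0 D1 Ht.
split; first by apply: sqrt_lt_R0; apply: cG_pos; apply: W0.
split; first by have [] := smooth_partials _ _ sg t v Dt.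
split; last exact: (integrand_u_log z D sS fm pr t v Dt (Th t v Dt)).
apply: (continuity_2d_pt_fst (du (fun u v => sqrt (cG z u v)))); exact: smooth_cont (smooth_du _ _ sg) Dt.
Qed.

Lemma phi_expr_value u0 v0 c1 u v : D (u0, v0) -> D (u, v0) -> D (u, v) ->
  phi_expr z u0 v0 c1 u v =
  sqrt (cE z u v0) / sqrt (cG z u v0) * sqrt (cG z u0 v0) * exp c1.
Proof.
move=> D00 Du0 Duv; have [_ [_ W0]] := sS.
have p1 := sqrt_lt_R0 _ (cE_pos _ _ _ (W0 _ _ Duv)).
have p2 := sqrt_lt_R0 _ (cE_pos _ _ _ (W0 _ _ Du0)).
have p3 := sqrt_lt_R0 _ (cG_pos _ _ _ (W0 _ _ Du0)).
have p4 := sqrt_lt_R0 _ (cG_pos _ _ _ (W0 _ _ D00)).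
rewrite /phi_expr RInt_integrand_v // RInt_integrand_u //.
exact: mult_exp_logs.
Qed.

Lemma psi_expr_value u0 v0 c2 u v : D (u0, v0) -> D (u0, v) -> D (u, v) ->
  psi_expr z u0 v0 c2 u v =
  sqrt (cG z u0 v) / sqrt (cE z u0 v) * sqrt (cE z u0 v0) * exp c2.
Proof.
move=> D00 D0v Duv; have [_ [_ W0]] := sS.
have p1 := sqrt_lt_R0 _ (cG_pos _ _ _ (W0 _ _ Duv)).
have p2 := sqrt_lt_R0 _ (cG_pos _ _ _ (W0 _ _ D0v)).
have p3 := sqrt_lt_R0 _ (cE_pos _ _ _ (W0 _ _ D0v)).
have p4 := sqrt_lt_R0 _ (cE_pos _ _ _ (W0 _ _ D00)).
rewrite /psi_expr RInt_integrand_v // RInt_integrand_u //.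
exact: mult_exp_logs.
Qed.
End CanonicalExpressions.

Lemma open_strip l r : open (fun p : R * R => l < fst p < r).
Proof.
apply: locally_2d_open => u v /= Hu.
have pd : 0 < Rmin (u - l) (r - u) by apply: Rmin_pos; lra.
exists (mkposreal _ pd) => /= x y hx _.
by have := Rmin_l (u - l) (r - u); have := Rmin_r (u - l) (r - u); have := Rabs_def2 _ _ hx; lra.
Qed.

(** The larger interval (l', r') makes the primitive [Phi] of g defined at the
    ends of (l, r), so that the image is a bounded open interval. *)
Lemma increasing_inverse (l r l' r' s0 : R) (g : R -> R) : l' < l -> l < s0 -> s0 < r -> r < r' ->
  smooth_on (fun p => l' < fst p < r') (fun s _ => g s) ->
  (forall s, l' < s < r' -> 0 < g s) ->
  exists (Phi rho : R -> R),
    Phi s0 = 0 /\ smooth_on (fun p => l' < fst p < r') (fun s _ => Phi s) /\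
    (forall s, l < s < r -> Phi l < Phi s < Phi r /\ rho (Phi s) = s) /\
    (forall u, Phi l < u < Phi r -> l < rho u < r /\ Phi (rho u) = u) /\
    smooth_on (fun p => Phi l < fst p < Phi r) (fun u _ => rho u) /\
    (forall u, Phi l < u < Phi r -> is_derive rho u (/ g (rho u))).
Proof.
move=> ll ls sr rr sg gpos.
pose S : R * R -> Prop := fun p => l' < fst p < r'.
have oS : open S := open_strip l' r'.
have star x s t : S (x, s) -> Rmin s0 x <= t <= Rmax s0 x -> S (t, s).
  by rewrite /S /= => h; case_minmax.
pose Phi x := RInt g s0 x.
have sPhi : smooth_on S (fun x _ => Phi x).
  apply/smooth_onP => n; move/smooth_onP: sg => /(_ n).
  exact: (Ck_RInt_param S s0 oS star n (fun s _ => g s)).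
have dPhi x : l' < x < r' -> is_derive Phi x (g x).
  move=> Hx.
  have gc t : l' < t < r' -> continuous g t.
    by move=> Ht; apply: (continuity_2d_pt_fst (fun s _ => g s) t 0); exact: smooth_cont sg Ht.
  apply: (is_derive_RInt (V := R_NormedModule) g Phi s0 x); last exact: gc.
  apply: filter_imp (open_locally_1 S x 0 oS Hx) => y Sy.
  by apply: RInt_correct; apply: ex_RInt_continuous => t Ht; apply: gc; exact: star Sy Ht.
(* the inverse is a section of the inverse of (x, s) |-> (x, Phi s) *)
pose T : R * R -> Prop := fun p => l < snd p < r.
have oT : open T.
  apply: locally_2d_open => u v /= Hu.
  have [d Hd] := open_locally_2d _ v u (open_strip l r) Hu.
  by exists d => x y hx hy; apply: (Hd y x).
have convT x s s' t : T (x, s) -> T (x, s') -> s <= t <= s' -> T (x, t).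
  by rewrite /T /=; lra.
pose Y (_ s : R) := Phi s.
have TS x s : T (x, s) -> S (s, x) by rewrite /T /S /=; lra.
have sY : smooth_on T Y.
  exact: (smooth_comp T oT S (fun x _ => Phi x) (fun _ s => s) (fun x _ => x) oS sPhi
    (smooth_snd _ oT) (smooth_fst _ oT)).
have dY x s : T (x, s) -> dv Y x s = g s.
  by move=> Txs; apply: is_derive_unique; apply: dPhi; have := TS _ _ Txs.
have Ypos x s : T (x, s) -> 0 < dv Y x s.
  by move=> Txs; rewrite dY //; apply: gpos; have := TS _ _ Txs.
have mono x y : l' < x -> x < y -> y < r' -> Phi x < Phi y.
  move=> hx xy hy.
  have [c [Hc E]] : exists c, Rmin x y <= c <= Rmax x y /\ Phi y - Phi x = g c * (y - x).
    apply: (MVT_gen Phi x y g) => c; rewrite Rmin_left ?Rmax_right; try lra; move=> Hc.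
    - by apply: dPhi; lra.
    - by apply/continuity_pt_filterlim; apply: (ex_derive_continuous (V := R_NormedModule)); eexists; apply: dPhi; lra.
  rewrite Rmin_left ?Rmax_right in Hc; try lra.
  have := gpos c ltac:(lra); nra.
have image u : Phi l < u < Phi r -> exists s, l < s < r /\ Phi s = u.
  move=> Hu.
  have [s [Hs E]] : {s | l <= s <= r /\ Phi s - u = 0}.
    apply: (Ranalysis5.IVT_interv (fun s => Phi s - u)); try lra.
    move=> a Ha; apply: continuity_pt_minus; last by apply: continuity_pt_const => ? ?.
    by apply/continuity_pt_filterlim; apply: (ex_derive_continuous (V := R_NormedModule)); eexists; apply: dPhi; lra.
  exists s; split; last lra.
  have nl : s <> l by move=> sl; rewrite sl in E; lra.
  have nr : s <> r by move=> sl; rewrite sl in E; lra.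
  lra.
have imT x u : Phi l < u < Phi r -> tri_image T Y (x, u) by move=> /image [s [H1 H2]]; exists s.
pose rho u := tri_inv T Y 0 u.
have rhoP u : Phi l < u < Phi r -> l < rho u < r /\ Phi (rho u) = u.
  by move=> /(imT 0) /(tri_invP T Y 0 u).
exists Phi, rho; split; first exact: RInt_point.
split=> //; split.
  move=> s Hs; split; last exact: (tri_inv_uniq T Y convT sY Ypos 0 s).
  by split; apply: mono; lra.
split=> //.
have sI := smooth_tri_inv T Y oT convT sY Ypos.
have oI := open_tri_image T Y oT convT sY Ypos.
have oJ := open_strip (Phi l) (Phi r).
split.
  apply: (smooth_comp _ oJ (tri_image T Y) (tri_inv T Y) (fun _ _ => 0) (fun u _ => u) oI sI) => //.
  - exact: smooth_const.
  - exact: smooth_fst.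
  - by move=> u v; exact: imT.
move=> u Hu; have [H1 H2] := rhoP u Hu.
have [_] := partials_tri_inv T Y oT convT sY Ypos 0 u (imT 0 u Hu).
by rewrite dY.
Qed.

(** F and M are only multiplied by products of the two derivatives, so
    parameters that are principal remain so when each is changed separately. *)
Section SeparateReparametrization.
Variables (z : R -> R -> 'rV[R]_4) (D D' : R * R -> Prop) (rho1 rho2 r1 r2 : R -> R).
Hypotheses (sS : surface z D) (oD' : open D').
Hypotheses (s1 : smooth_on D' (fun u _ => rho1 u)) (s2 : smooth_on D' (fun _ v => rho2 v)).
Hypothesis sub : forall u v, D' (u, v) -> D (rho1 u, rho2 v).
Hypothesis d1 : forall u v, D' (u, v) -> is_derive rho1 u (r1 u) /\ 0 < r1 u.
Hypothesis d2 : forall u v, D' (u, v) -> is_derive rho2 v (r2 v) /\ 0 < r2 v.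

Let h (p : R * R) : R * R := (rho1 (fst p), rho2 (snd p)).
Let subh p : D' p -> D (h p).
Proof. by case: p => u v; exact: sub. Qed.

Lemma separate_partials u v : D' (u, v) ->
  du (hu h) u v = r1 u /\ dv (hu h) u v = 0 /\ du (hv h) u v = 0 /\ dv (hv h) u v = r2 v.
Proof.
move=> Duv; have [e1 _] := d1 u v Duv; have [e2 _] := d2 u v Duv.
split; first exact: is_derive_unique e1.
split; first exact: (Derive_const (rho1 u) v).
split; first exact: (Derive_const (rho2 v) u).
exact: is_derive_unique e2.
Qed.

Lemma separate_sqrtE u v : D' (u, v) ->
  sqrt (cE (reparam z h) u v) = r1 u * sqrt (cE z (rho1 u) (rho2 v)).
Proof.
move=> Duv; have [oD [sz W0]] := sS; have [_ p1] := d1 u v Duv.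
rewrite (reparam_E z D' D h oD sz s1 s2 subh u v Duv).
have [-> [_ [-> _]]] := separate_partials u v Duv.
rewrite -[hu h u v]/(rho1 u) -[hv h u v]/(rho2 v).
rewrite (_ : _ + _ + _ = r1 u ^ 2 * cE z (rho1 u) (rho2 v)); last by ring.
rewrite sqrt_mult ?sqrt_pow2 //; try lra; first nra.
by have := cE_pos _ _ _ (W0 _ _ (sub u v Duv)); lra.
Qed.

Lemma separate_sqrtG u v : D' (u, v) ->
  sqrt (cG (reparam z h) u v) = r2 v * sqrt (cG z (rho1 u) (rho2 v)).
Proof.
move=> Duv; have [oD [sz W0]] := sS; have [_ p2] := d2 u v Duv.
rewrite (reparam_G z D' D h oD sz s1 s2 subh u v Duv).
have [_ [-> [_ ->]]] := separate_partials u v Duv.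
rewrite -[hu h u v]/(rho1 u) -[hv h u v]/(rho2 v).
rewrite (_ : _ + _ + _ = r2 v ^ 2 * cG z (rho1 u) (rho2 v)); last by ring.
rewrite sqrt_mult ?sqrt_pow2 //; try lra; first nra.
by have := cG_pos _ _ _ (W0 _ _ (sub u v Duv)); lra.
Qed.

Lemma separate_principal : principal z D -> principal (reparam z h) D'.
Proof.
move=> pr u v Duv; have [oD [sz W0]] := sS.
have [F0 M0] := pr _ _ (sub u v Duv).
have [e1 [e2 [e3 e4]]] := separate_partials u v Duv.
have [_ p1] := d1 u v Duv; have [_ p2] := d2 u v Duv.
split.
  rewrite (reparam_F z D' D h oD sz s1 s2 subh u v Duv) e1 e2 e3 e4.
  by rewrite -[hu h u v]/(rho1 u) -[hv h u v]/(rho2 v) F0; ring.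
move=> n1 n2 nf.
have J0 : jac h u v <> 0 by rewrite /jac e1 e2 e3 e4; nra.
have nf' := reparam_frame z D' D h oD sz s1 s2 subh u v Duv J0 n1 n2 nf.
have W1 : 0 < W2 z (hu h u v) (hv h u v) by exact: (W0 _ _ (sub u v Duv)).
have [e [_ [_ [-> _]]]] := reparam_LMN z D' D h oD' oD sz s1 s2 subh u v Duv J0 n1 n2 nf W1.
have {}M0 : cM z n1 n2 (hu h u v) (hv h u v) = 0 by exact: (M0 n1 n2 nf').
by rewrite e1 e2 e3 e4 M0; ring.
Qed.
End SeparateReparametrization.

Lemma box_interval x0 a y0 b u v : box x0 a y0 b (u, v) <->
  (x0 - a < u < x0 + a) /\ (y0 - b < v < y0 + b).
Proof.
split.
- by move=> [/= /Rabs_def2 h1 /Rabs_def2 h2]; lra.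
- by move=> [h1 h2]; split=> /=; apply: Rabs_def1; lra.
Qed.

(** In the new parameters e becomes e / Phi' and g becomes g / Psi'.  By
    [phi_expr_value] and [psi_expr_value], canonicity at the base point requires
    e = exp (- c1) and g = exp (- c2) there, and along the two coordinate lines
    through it that e / g is constant.  This prescribes Phi' on the first line
    and Psi' on the second. *)
Lemma canonical_change z x0 a y0 b s0 t0 c1 c2 :
  let B2 := box x0 a y0 b in let B1 := box x0 (a / 2) y0 (b / 2) in
  0 < a -> 0 < b ->
  surface z B2 -> free_of_minimal_points z B2 -> principal z B2 -> B1 (s0, t0) ->
  exists (D : R * R -> Prop) (h : R * R -> R * R),
    open_rectangle D /\ diffeo D B1 h /\ D (0, 0) /\ h (0, 0) = (s0, t0) /\
    principal (reparam z h) D /\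
    ((forall u v, D (u, v) -> Theta (reparam z h) u v <> 0) ->
     canonical_principal (reparam z h) D 0 0 c1 c2).
Proof.
move=> B2 B1 a0 b0 sS fm pr B1st.
have oB1 : open B1 := open_box _ _ _ _.
have B12 q : B1 q -> B2 q by move=> [h1 h3]; split; lra.
have B2st := B12 _ B1st.
have [_ [sz W2p]] := sS.
have [hs ht] := proj1 (box_interval _ _ _ _ _ _) B1st.
pose e u v := sqrt (cE z u v); pose g u v := sqrt (cG z u v).
have se : smooth_on B2 e := smooth_sqrtE z B2 sS.
have sg : smooth_on B2 g := smooth_sqrtG z B2 sS.
have ep u v : B2 (u, v) -> 0 < e u v by move=> /W2p /cE_pos; exact: sqrt_lt_R0.
have gp u v : B2 (u, v) -> 0 < g u v by move=> /W2p /cG_pos; exact: sqrt_lt_R0.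
have e00 := ep _ _ B2st; have g00 := gp _ _ B2st.
have oB2 : open B2 := open_box _ _ _ _.
(* the prescribed derivatives of Phi and Psi *)
pose g1 s := g s0 t0 * exp c1 * (e s t0 * / g s t0).
pose g2 t := e s0 t0 * exp c2 * (g s0 t * / e s0 t).
have B2s s : x0 - a < s < x0 + a -> B2 (s, t0) by move=> Hs; apply/box_interval; lra.
have B2t t : y0 - b < t < y0 + b -> B2 (s0, t) by move=> Ht; apply/box_interval; lra.
have g1p s : x0 - a < s < x0 + a -> 0 < g1 s.
  move=> /B2s Bs; have es := ep _ _ Bs; have gs := gp _ _ Bs.
  by repeat apply: Rmult_lt_0_compat => //; [exact: exp_pos | exact: Rinv_0_lt_compat].
have g2p t : y0 - b < t < y0 + b -> 0 < g2 t.
  move=> /B2t Bs; have es := ep _ _ Bs; have gs := gp _ _ Bs.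
  by repeat apply: Rmult_lt_0_compat => //; [exact: exp_pos | exact: Rinv_0_lt_compat].
have sg1 : smooth_on (fun w => x0 - a < fst w < x0 + a) (fun s _ => g1 s).
  have o1 := open_strip (x0 - a) (x0 + a).
  have es : smooth_on (fun w => x0 - a < fst w < x0 + a) (fun s _ => e s t0).
    apply: (smooth_comp _ o1 B2 e (fun s _ => s) (fun _ _ => t0)) => //; [exact: smooth_fst | exact: smooth_const | by move=> u v; exact: B2s].
  have gs : smooth_on (fun w => x0 - a < fst w < x0 + a) (fun s _ => g s t0).
    apply: (smooth_comp _ o1 B2 g (fun s _ => s) (fun _ _ => t0)) => //; [exact: smooth_fst | exact: smooth_const | by move=> u v; exact: B2s].
  apply: smooth_mult => //; first exact: smooth_const.
  apply: smooth_mult => //; apply: smooth_inv => // s w /= /B2s /gp; lra.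
have sg2 : smooth_on (fun w => y0 - b < fst w < y0 + b) (fun t _ => g2 t).
  have o1 := open_strip (y0 - b) (y0 + b).
  have es : smooth_on (fun w => y0 - b < fst w < y0 + b) (fun t _ => e s0 t).
    apply: (smooth_comp _ o1 B2 e (fun _ _ => s0) (fun t _ => t)) => //; [exact: smooth_const | exact: smooth_fst | by move=> u v; exact: B2t].
  have gs : smooth_on (fun w => y0 - b < fst w < y0 + b) (fun t _ => g s0 t).
    apply: (smooth_comp _ o1 B2 g (fun _ _ => s0) (fun t _ => t)) => //; [exact: smooth_const | exact: smooth_fst | by move=> u v; exact: B2t].
  apply: smooth_mult => //; first exact: smooth_const.
  apply: smooth_mult => //; apply: smooth_inv => // s w /= /B2t /ep; lra.
have [Phi [rho1 [Phi0 [sPhi [Phi_in [rho1_in [srho1 drho1]]]]]]] :=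
  increasing_inverse (x0 - a / 2) (x0 + a / 2) (x0 - a) (x0 + a) s0 g1
   ltac:(lra) ltac:(lra) ltac:(lra) ltac:(lra) sg1 g1p.
have [Psi [rho2 [Psi0 [sPsi [Psi_in [rho2_in [srho2 drho2]]]]]]] :=
  increasing_inverse (y0 - b / 2) (y0 + b / 2) (y0 - b) (y0 + b) t0 g2
   ltac:(lra) ltac:(lra) ltac:(lra) ltac:(lra) sg2 g2p.
pose D : R * R -> Prop := fun w => (Phi (x0 - a / 2) < fst w < Phi (x0 + a / 2)) /\
   (Psi (y0 - b / 2) < snd w < Psi (y0 + b / 2)).
pose h3 (w : R * R) := (rho1 (fst w), rho2 (snd w)).
have oD : open D.
  apply: locally_2d_open => u v [/= Hu Hv].
  have [d Hd] := open_locally_2d _ u 0 (open_strip (Phi (x0 - a / 2)) (Phi (x0 + a / 2))) Hu.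
  have [d' Hd'] := open_locally_2d _ v 0 (open_strip (Psi (y0 - b / 2)) (Psi (y0 + b / 2))) Hv.
  have pd : 0 < Rmin d d' by apply: Rmin_pos; exact: cond_pos.
  have z0 (eps : posreal) : Rabs (0 - 0) < eps by rewrite Rminus_diag Rabs_R0; exact: cond_pos.
  exists (mkposreal _ pd) => /= x y hx hy; split=> /=.
  - by apply: (Hd x 0) => //; apply: Rlt_le_trans hx (Rmin_l _ _).
  - by apply: (Hd' y 0) => //; apply: Rlt_le_trans hy (Rmin_r _ _).
have sr1 : smooth_on D (fun u _ => rho1 u) by apply: smooth_sub srho1 => w [].
have sr2 : smooth_on D (fun _ v => rho2 v).
  apply: (smooth_comp D oD (fun w => Psi (y0 - b / 2) < fst w < Psi (y0 + b / 2))
    (fun v _ => rho2 v) (fun _ v => v) (fun u _ => u) (open_strip _ _)) => //; first exact: smooth_snd.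
  - exact: smooth_fst.
  - by move=> u v [].
have D_B1 u v : D (u, v) -> B1 (rho1 u, rho2 v).
  move=> [/= /rho1_in [H1 _] /rho2_in [H2 _]]; apply/box_interval; lra.
have d3 : diffeo D B1 h3.
  split=> //; split=> //; exists (fun w => (Phi (fst w), Psi (snd w))).
  split; first exact: sr1.
  split; first exact: sr2.
  split; first by apply: smooth_sub sPhi => -[u v] /B12 /box_interval [].
  split.
    apply: (smooth_comp B1 oB1 (fun w => y0 - b < fst w < y0 + b)
      (fun v _ => Psi v) (fun _ v => v) (fun u _ => u) (open_strip _ _)) => //; first exact: smooth_snd.
    - exact: smooth_fst.
    - by move=> u v /B12 /box_interval [].
  split=> -[u v] /=.
  - move=> Duv; split; first exact: D_B1.
    by case: Duv => /= /rho1_in [_ ->] /rho2_in [_ ->].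
  - move=> /box_interval [/Phi_in [H1 H2] /Psi_in [H3 H4]].
    by split; [split | rewrite /h3 /= H2 H4].
have rho10 : rho1 0 = s0 by rewrite -Phi0; have [] := Phi_in s0 hs.
have rho20 : rho2 0 = t0 by rewrite -Psi0; have [] := Psi_in t0 ht.
have Phi0in := proj1 (Phi_in s0 hs); have Psi0in := proj1 (Psi_in t0 ht).
rewrite Phi0 in Phi0in; rewrite Psi0 in Psi0in.
have D00 : D (0, 0) by split.
have sS4 : surface (reparam z h3) D.
  exact: (surface_reparam z B2 D B1 h3 sS B12 d3).
have fm4 : free_of_minimal_points (reparam z h3) D.
  exact: (free_reparam z B2 D B1 h3 sS B12 d3 fm).
have D_B2 u v : D (u, v) -> B2 (rho1 u, rho2 v) by move=> /D_B1 /B12.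
have dr1 u v : D (u, v) -> is_derive rho1 u (/ g1 (rho1 u)) /\ 0 < / g1 (rho1 u).
  move=> [/= Hu _]; split; first exact: drho1.
  apply: Rinv_0_lt_compat; apply: g1p; have [h _] := rho1_in u Hu; lra.
have dr2 u v : D (u, v) -> is_derive rho2 v (/ g2 (rho2 v)) /\ 0 < / g2 (rho2 v).
  move=> [/= _ Hv]; split; first exact: drho2.
  apply: Rinv_0_lt_compat; apply: g2p; have [h _] := rho2_in v Hv; lra.
have pr4 : principal (reparam z h3) D.
  exact: (separate_principal z B2 D rho1 rho2 _ _ sS oD sr1 sr2 D_B2 dr1 dr2 pr).
exists D, h3; split.
  by exists (Finite (Phi (x0 - a / 2))), (Finite (Phi (x0 + a / 2))),
    (Finite (Psi (y0 - b / 2))), (Finite (Psi (y0 + b / 2))).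
split=> //; split=> //; split; first by rewrite /h3 /= rho10 rho20.
split=> // Th4.
have cv1 u u' v t : D (u, v) -> D (u', v) -> Rmin u u' <= t <= Rmax u u' -> D (t, v).
  by move=> [/= H1 H2] [/= H3 _] Ht; split=> //=; move: H1 H3 Ht; case_minmax.
have cv2 u v v' t : D (u, v) -> D (u, v') -> Rmin v v' <= t <= Rmax v v' -> D (u, t).
  by move=> [/= H1 H2] [/= _ H3] Ht; split=> //=; move: H2 H3 Ht; case_minmax.
split=> // u v Duv.
have Du0 : D (u, 0) by case: Duv => H1 _; split.
have D0v : D (0, v) by case: Duv => _ H1; split.
have sqE u' v' : D (u', v') -> sqrt (cE (reparam z h3) u' v') = / g1 (rho1 u') * e (rho1 u') (rho2 v').
  exact: (separate_sqrtE z B2 D rho1 rho2 _ _ sS sr1 sr2 D_B2 dr1 dr2 u' v').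
have sqG u' v' : D (u', v') -> sqrt (cG (reparam z h3) u' v') = / g2 (rho2 v') * g (rho1 u') (rho2 v').
  exact: (separate_sqrtG z B2 D rho1 rho2 _ _ sS sr1 sr2 D_B2 dr1 dr2 u' v').
have x1 := exp_pos c1; have x2 := exp_pos c2.
split.
- rewrite (phi_expr_value _ D sS4 fm4 pr4 Th4 cv1 cv2) // !sqE // !sqG // rho10 rho20 /g1 /g2.
  have y1 := ep _ _ (D_B2 _ _ Du0); have y2 := gp _ _ (D_B2 _ _ Du0).
  by rewrite rho20 in y1 y2; field; lra.
- rewrite (psi_expr_value _ D sS4 fm4 pr4 Th4 cv1 cv2) // !sqE // !sqG // rho10 rho20 /g1 /g2.
  have y1 := ep _ _ (D_B2 _ _ D0v); have y2 := gp _ _ (D_B2 _ _ D0v).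
  by rewrite rho10 in y1 y2; field; lra.
Qed.

Theorem proposition3p4 (U : R * R -> Prop) (z : R -> R -> 'rV[R]_4)
    (Hsurf : surface z U) (Hmin : free_of_minimal_points z U)
    (Htheta : Theta_nonzero U z) :
  forall p : R * R, U p ->
  exists V : R * R -> Prop,
    open V /\ V p /\ (forall q, V q -> U q) /\
    forall (q : R * R) (c1 c2 : R), V q ->
    exists (D : R * R -> Prop) (h : R * R -> R * R) (u0 v0 : R),
      open_rectangle D /\ diffeo D V h /\
      D (u0, v0) /\ h (u0, v0) = q /\
      canonical_principal (reparam z h) D u0 v0 c1 c2.
Proof.
move=> p Up.
have [x0 [a [y0 [b [V2 [h2 [a0 [b0 [d2 [V2U [h2p pr2]]]]]]]]]]] := principal_coordinates z U p Hsurf Hmin Up.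
set B2 := box x0 a y0 b in d2 pr2.
pose z2 := reparam z h2.
have sS2 : surface z2 B2 by exact: (surface_reparam z U B2 V2 h2).
have fm2 : free_of_minimal_points z2 B2 by exact: (free_reparam z U B2 V2 h2).
(* The two quadratures are carried out on the whole box; their values at the
   ends of the half box bound the rectangle of the new parameters. *)
set B1 := box x0 (a / 2) y0 (b / 2).
have oB1 : open B1 := open_box _ _ _ _.
have B12 q : B1 q -> B2 q by move=> [h1 h3]; split; lra.
have [V [dV VV2]] := diffeo_restrict B2 V2 B1 h2 d2 oB1 B12.
have [_ [oV [k [_ [_ [_ [_ [hk kh]]]]]]]] := dV.
exists V; split=> //.
split.
  have [Vc _] := hk (x0, y0) (box_center x0 (a / 2) y0 (b / 2) ltac:(lra) ltac:(lra)).
  by rewrite h2p in Vc.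
split; first by move=> q /VV2 /V2U.
move=> q c1 c2 Vq; have [] := kh q Vq.
case: (k q) => s0 t0 B1st h2q.
have [D [h3 [rect [d3 [D00 [h300 [pr3 canon]]]]]]] :=
  canonical_change z2 x0 a y0 b s0 t0 c1 c2 a0 b0 sS2 fm2 pr2 B1st.
have VU w : V w -> U w by move=> /VV2 /V2U.
exists D, (fun w => h2 (h3 w)), 0, 0.
have E : reparam z (fun w => h2 (h3 w)) = reparam z2 h3.
  apply: functional_extensionality => u; apply: functional_extensionality => v.
  by rewrite /z2 /reparam; case: (h3 (u, v)).
split=> //; split; first exact: (diffeo_comp D B1 V h3 h2 d3 dV).
split=> //; split; first by rewrite h300.
rewrite E; apply: canon => u v.
have := Htheta D V (fun w => h2 (h3 w)) VU (diffeo_comp D B1 V h3 h2 d3 dV).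
by rewrite E => /(_ pr3 u v).
Qed.
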